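(* Let $\psi\colon\Sigma\to\mathbb{R}^{3}$ be a weakly complete improper affine front. If its Lagrangian Gauss map $\nu\colon\Sigma\to\mathbb{C}\cup\{\infty\}$ is nonconstant, then $\nu$ can omit at most three values, i.e. $(\mathbb{C}\cup\{\infty\})\setminus\nu(\Sigma)$ has at most three elements.
   Context: Improper affine fronts. Let $\Sigma$ be a connected oriented two-manifold. Equip $\mathbb{C}^{2}=\mathbb{R}^2+\sqrt{-1}\,\mathbb{R}^2$, with coordinates $\zeta=(\zeta_1,\zeta_2)=x+\sqrt{-1}\,n$ ($x,n\in\mathbb{R}^{2}$), with the standard metric, the symplectic form $\omega'=\frac{\sqrt{-1}}{2}(d\zeta_1\wedge d\bar\zeta_1+d\zeta_2\wedge d\bar\zeta_2)$ and $\Omega'=d\zeta_1\wedge d\zeta_2$. A special Lagrangian immersion $L\colon\Sigma\to\mathbb{C}^2$ (with respect to the calibration $\mathrm{Re}(\sqrt{-1}\,\Omega')$) is an immersion with $L^*\omega'\equiv0$ and $L^*\mathrm{Im}(\sqrt{-1}\,\Omega')\equiv 0$ (oriented so that $L^*\mathrm{Re}(\sqrt{-1}\,\Omega')>0$). A map $\psi=(x,\varphi)\colon\Sigma\to\mathbb{R}^{3}=\mathbb{R}^2\times\mathbb{R}$ is an improper affine front if there is a special Lagrangian immersion $L_\psi=x+\sqrt{-1}\,n\colon\Sigma\to\mathbb{C}^2$ such that $\varphi=-\int\langle n,dx\rangle$ (so this integral must be well defined on $\Sigma$), with $\langle\cdot,\cdot\rangle$ the standard inner product of $\mathbb{R}^2$.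 Let $d\tau^2=\langle dx,dx\rangle+\langle dn,dn\rangle$ be the metric induced by $L_\psi$. $\Sigma$ is regarded as a Riemann surface with the conformal structure of $d\tau^2$. Identifying $\mathbb{R}^2$ with $\mathbb{C}$, the functions $F$, $G$ on $\Sigma$ defined by $x=G+\bar F$, $n=\bar F-G$ are holomorphic, $(F,G)\colon\Sigma\to\mathbb{C}^2$ is a regular curve, and $d\tau^2=2(|dF|^2+|dG|^2)$. The Lagrangian Gauss map of $\psi$ is the meromorphic function $\nu=dF/dG\colon\Sigma\to\mathbb{C}\cup\{\infty\}$. Weak completeness. $\psi$ is weakly complete if $d\tau^2$ is a complete Riemannian metric on $\Sigma$. *)

(* Defs.v *)
From HB Require Import structures.
From mathcomp Require Import all_boot all_order all_algebra.
From mathcomp Require Import complex ring lra.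
From mathcomp Require Import all_classical all_reals all_analysis.

Set Implicit Arguments.
Unset Strict Implicit.
Unset Printing Implicit Defensive.

Import Order.TTheory GRing.Theory Num.Theory.
Import numFieldNormedType.Exports.

Local Open Scope classical_set_scope.
Local Open Scope ring_scope.
Local Open Scope complex_scope.

(* Meant for [U] open and [V] finite-dimensional: there, continuity of every
   [fun x => 'd f x v] is continuity of the differential. *)
Fixpoint Ck_on (R : realType) (V W : normedModType R) (k : nat)
    (U : set V) (f : V -> W) : Prop :=
  match k with
  | 0 => forall x, U x -> {for x, continuous f}
  | k'.+1 => (forall x, U x -> differentiable f x) /\
             (forall v, Ck_on k' U (fun x => 'd f x v))
  end.

Definition smooth_on (R : realType) (V W : normedModType R)
    (U : set V) (f : V -> W) : Prop := forall k, Ck_on k U f.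

(* [cmap] matters only on [cdom], and [cinv] only on [cmap @` cdom]. *)
Record chart (R : realType) (M : topologicalType) := Chart {
  cdom : set M;
  cmap : M -> 'rV[R]_2;
  cinv : 'rV[R]_2 -> M;
  cdom_open : open cdom;
  cimg_open : open (cmap @` cdom);
  cmapK : forall p, cdom p -> cinv (cmap p) = p;
  cmap_continuous : {within cdom, continuous cmap};
  cinv_continuous : {within cmap @` cdom, continuous cinv} }.

Definition transition (R : realType) (M : topologicalType) (c1 c2 : chart R M)
  : 'rV[R]_2 -> 'rV[R]_2 := cmap c2 \o cinv c1.

Definition overlap (R : realType) (M : topologicalType) (c1 c2 : chart R M)
  : set 'rV[R]_2 := cmap c1 @` (cdom c1 `&` cdom c2).

(* A connected oriented smooth two-manifold.  [chart_at] selects a preferred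
   chart of the atlas around each point; it identifies the tangent space at
   that point with ['rV[R]_2]. *)
Record orientedSurface (R : realType) := OrientedSurface {
  surface_carrier :> topologicalType;
  surface_hausdorff : hausdorff_space surface_carrier;
  surface_second_countable : @second_countable surface_carrier;
  surface_connected : connected [set: surface_carrier];
  atlas : set (chart R surface_carrier);
  chart_at : surface_carrier -> chart R surface_carrier;
  chart_at_atlas : forall p, atlas (chart_at p);
  chart_at_dom : forall p, cdom (chart_at p) p;
  atlas_smooth : forall c1 c2, atlas c1 -> atlas c2 ->
    smooth_on (overlap c1 c2) (transition c1 c2);
  atlas_oriented : forall c1 c2, atlas c1 -> atlas c2 ->
    forall q, overlap c1 c2 q -> 0 < \det ('J (transition c1 c2) q) }.

Definition smooth_map (R : realType) (S : orientedSurface R)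
    (W : normedModType R) (f : S -> W) : Prop :=
  forall c, atlas c -> smooth_on (cmap c @` cdom c) (f \o cinv c).

Definition tdiff (R : realType) (S : orientedSurface R)
    (W : normedModType R) (f : S -> W) (p : S) (v : 'rV[R]_2) : W :=
  'd (f \o cinv (chart_at p)) (cmap (chart_at p) p) v.

(* Real differential of a complex-valued function. *)
Definition cdiff (R : realType) (S : orientedSurface R)
    (f : S -> R[i]) (p : S) (v : 'rV[R]_2) : R[i] :=
  tdiff (fun q => complex.Re (f q)) p v
  +i* tdiff (fun q => complex.Im (f q)) p v.

Definition cdiff2 (R : realType) (S : orientedSurface R)
    (L : S -> 'rV[R[i]]_2) (p : S) (v : 'rV[R]_2) : 'rV[R[i]]_2 :=
  \row_k cdiff (fun q => L q 0 k) p v.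

Definition smooth_map_C2 (R : realType) (S : orientedSurface R)
    (L : S -> 'rV[R[i]]_2) : Prop :=
  forall k : 'I_2, smooth_map (fun q => complex.Re (L q 0 k)) /\
                   smooth_map (fun q => complex.Im (L q 0 k)).

Definition omega' (R : realType) (a b : 'rV[R[i]]_2) : R[i] :=
  (0 +i* 1) / 2%:R * \sum_(k < 2) (a 0 k * conjc (b 0 k) - b 0 k * conjc (a 0 k)).

Definition Omega' (R : realType) (a b : 'rV[R[i]]_2) : R[i] :=
  a 0 0 * b 0 1 - b 0 0 * a 0 1.

Definition iOmega' (R : realType) (a b : 'rV[R[i]]_2) : R[i] :=
  (0 +i* 1) * Omega' a b.

Definition basis0 (R : realType) : 'rV[R]_2 := delta_mx 0 0.
Definition basis1 (R : realType) : 'rV[R]_2 := delta_mx 0 1.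

(* [(basis0, basis1)] is a positive frame, since [chart_at p] lies in the
   oriented atlas. *)
Definition special_lagrangian_immersion (R : realType) (S : orientedSurface R)
    (L : S -> 'rV[R[i]]_2) : Prop :=
  [/\ smooth_map_C2 L,
      forall p v, cdiff2 L p v = 0 -> v = 0,
      forall p v w, omega' (cdiff2 L p v) (cdiff2 L p w) = 0,
      forall p v w,
        complex.Im (iOmega' (cdiff2 L p v) (cdiff2 L p w)) = 0
    & forall p,
        0 < complex.Re (iOmega' (cdiff2 L p (basis0 R)) (cdiff2 L p (basis1 R)))].

Definition dotp (R : realType) (u v : 'rV[R]_2) : R :=
  \sum_(k < 2) u 0 k * v 0 k.

Definition to_C2 (R : realType) (x n : 'rV[R]_2) : 'rV[R[i]]_2 :=
  \row_k (x 0 k +i* n 0 k).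

Definition to_C (R : realType) (u : 'rV[R]_2) : R[i] := u 0 0 +i* u 0 1.

(* A map [psi = (x, phi)] together with [n] such that [x + i n] is its special
   Lagrangian immersion; [phi = - \int <n, dx>] says that [phi] is a global
   primitive of the 1-form [- <n, dx>]. *)
Record improperAffineFront (R : realType) (S : orientedSurface R) :=
    ImproperAffineFront {
  front_map :> S -> 'rV[R]_2 * R;
  front_n : S -> 'rV[R]_2;
  front_special_lagrangian :
    special_lagrangian_immersion (fun p => to_C2 (front_map p).1 (front_n p));
  front_phi_smooth : smooth_map (fun p => (front_map p).2);
  front_phi_primitive : forall p v,
    tdiff (fun q => (front_map q).2) p v =
    - dotp (front_n p) (tdiff (fun q => (front_map q).1) p v) }.

Definition front_x (R : realType) (S : orientedSurface R)
    (psi : improperAffineFront S) (p : S) : 'rV[R]_2 := (psi p).1.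

(* The metric d tau^2, as a quadratic form on the tangent space at [p]. *)
Definition dtau2 (R : realType) (S : orientedSurface R)
    (psi : improperAffineFront S) (p : S) (v : 'rV[R]_2) : R :=
  let dx := tdiff (front_x psi) p v in
  let dn := tdiff (@front_n R S psi) p v in
  dotp dx dx + dotp dn dn.

Definition C1_curve (R : realType) (S : orientedSurface R) (g : R -> S) : Prop :=
  continuous g /\
  forall c, atlas c ->
    Ck_on 1 (g @^-1` cdom c) (cmap c \o g).

Definition velocity (R : realType) (S : orientedSurface R) (g : R -> S) (t : R)
  : 'rV[R]_2 := derive1 (cmap (chart_at (g t)) \o g) t.

Definition curve_length (R : realType) (S : orientedSurface R)
    (psi : improperAffineFront S) (g : R -> S) : \bar R :=
  (\int[lebesgue_measure]_(t in `[0%R, 1%R])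
     (Num.sqrt (dtau2 psi (g t) (velocity g t)))%:E)%E.

(* Curves are C^1 on all of [R], which avoids one-sided derivatives; a
   piecewise C^1 curve on [0, 1] can be reparametrized, stopping at its corners
   and ends, to such a curve of the same length, so the infimum is the usual
   Riemannian distance. *)
Definition riemannian_dist (R : realType) (S : orientedSurface R)
    (psi : improperAffineFront S) (p q : S) : \bar R :=
  ereal_inf [set curve_length psi g | g in
               [set g : R -> S | [/\ C1_curve g, g 0 = p & g 1 = q]]].

Definition weakly_complete (R : realType) (S : orientedSurface R)
    (psi : improperAffineFront S) : Prop :=
  forall u : nat -> S,
    (forall e : R, 0 < e -> exists N : nat, forall m k : nat,
       (N <= m)%N -> (N <= k)%N -> (riemannian_dist psi (u m) (u k) < e%:E)%E) ->
    exists p : S, forall e : R, 0 < e -> exists N : nat, forall m : nat,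
      (N <= m)%N -> (riemannian_dist psi (u m) p < e%:E)%E.

(* [F] and [G] solve x = G + conj F, n = conj F - G. *)
Definition front_F (R : realType) (S : orientedSurface R)
    (psi : improperAffineFront S) (p : S) : R[i] :=
  conjc ((to_C (front_x psi p) + to_C (@front_n R S psi p)) / 2%:R).

Definition front_G (R : realType) (S : orientedSurface R)
    (psi : improperAffineFront S) (p : S) : R[i] :=
  (to_C (front_x psi p) - to_C (@front_n R S psi p)) / 2%:R.

Lemma front_xE (R : realType) (S : orientedSurface R)
    (psi : improperAffineFront S) (p : S) :
  to_C (front_x psi p) = front_G psi p + conjc (front_F psi p).
Proof.
rewrite /front_G /front_F conjcK -mulrDl addrACA [- _ + _]addrC subrr addr0.
by rewrite -mulr2n -(mulr_natr (to_C _)) mulfK // pnatr_eq0.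
Qed.

Lemma front_nE (R : realType) (S : orientedSurface R)
    (psi : improperAffineFront S) (p : S) :
  to_C (front_n psi p) = conjc (front_F psi p) - front_G psi p.
Proof.
rewrite /front_G /front_F conjcK -mulrBl opprB addrC addrA subrK.
by rewrite -mulr2n -(mulr_natr (to_C _)) mulfK // pnatr_eq0.
Qed.

(* The Riemann sphere; [None] is the point at infinity. *)
Definition sphere (R : realType) : Type := option R[i].

(* The value at [p] is the unique [c] with dF = c dG at [p], or infinity if dG
   vanishes at [p]. *)
Definition gauss_map (R : realType) (S : orientedSurface R)
    (psi : improperAffineFront S) (p : S) : sphere R :=
  if `[< forall v, cdiff (front_G psi) p v = 0 >] then None
  else Some (xget 0 [set c : R[i] |
    forall v, cdiff (front_F psi) p v = c * cdiff (front_G psi) p v]).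

Lemma special_lagrangian_FG (R : realType) (a b : 'rV[R[i]]_2) :
  let x (a : 'rV[R[i]]_2) k := complex.Re (a 0 k) in
  let n (a : 'rV[R[i]]_2) k := complex.Im (a 0 k) in
  omega' a b = 0 -> complex.Im (iOmega' a b) = 0 ->
  let F a := ((x a 0 + n a 0) / 2%:R) +i* (- ((x a 1 + n a 1) / 2%:R)) in
  let G a := ((x a 0 - n a 0) / 2%:R) +i* ((x a 1 - n a 1) / 2%:R) in
  F a * G b = F b * G a.
Proof.
rewrite /omega' /iOmega' /Omega' !big_ord_recl big_ord0 /=.
have -> : lift ord0 ord0 = 1 :> 'I_2 by apply/val_inj.
have -> : ord0 = 0 :> 'I_2 by apply/val_inj.
case: (a 0 0) => a0 c0; case: (a 0 1) => a1 c1.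
case: (b 0 0) => b0 d0; case: (b 0 1) => b1 d1 /=.
move/eqP; rewrite mulf_eq0 => /orP[|/eqP].
  rewrite mulf_eq0 invr_eq0 pnatr_eq0 orbF eq_complex /= oner_eq0 andbF; done.
simpc => -[_ h1].
move=> h2.
congr Complex; lra.
Qed.


Lemma tdiff_lin (R : realType) (S : orientedSurface R) (f g : S -> R) p v (a b : R) :
  smooth_map f -> smooth_map g ->
  tdiff (fun q => a * f q + b * g q) p v = a * tdiff f p v + b * tdiff g p v.
Proof.
move=> sf sg; rewrite /tdiff.
have h : (cmap (chart_at p) @` cdom (chart_at p)) (cmap (chart_at p) p).
  by exists p => //; apply: chart_at_dom.
have df := proj1 (sf _ (chart_at_atlas p) 1%N) _ h.
have dg := proj1 (sg _ (chart_at_atlas p) 1%N) _ h.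
set F := f \o _ in df *; set G := g \o _ in dg *.
have -> : (fun q => a * f q + b * g q) \o cinv (chart_at p) = (a *: F) + (b *: G) by [].
rewrite diffD; [|exact: differentiableZ|exact: differentiableZ].
by rewrite diffZ// diffZ.
Qed.

(* Where dG does not vanish, the constant chosen in [gauss_map] exists. *)
Lemma gauss_mapP (R : realType) (S : orientedSurface R)
    (psi : improperAffineFront S) (p : S) c :
  gauss_map psi p = Some c ->
  forall v, cdiff (front_F psi) p v = c * cdiff (front_G psi) p v.
Proof.
have [sL iL o1 o2 _] := front_special_lagrangian psi.
set L := fun p => _ in sL iL o1 o2.
have sx k : smooth_map (fun q => complex.Re (L q 0 k)) by have [] := sL k.
have sn k : smooth_map (fun q => complex.Im (L q 0 k)) by have [] := sL k.
have half (z : R[i]) : z / 2%:R = (complex.Re z / 2%:R) +i* (complex.Im z / 2%:R).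
  have t : (2%:R : R[i]) != 0 by rewrite pnatr_eq0.
  apply: (mulIf t); rewrite mulfVK//; case: z => x y /=.
  by rewrite mulr_natr mulr2n; simpc; congr Complex; field.
have hF v : cdiff (front_F psi) p v =
   (((complex.Re (cdiff2 L p v 0 0) + complex.Im (cdiff2 L p v 0 0)) / 2%:R) +i*
    (- ((complex.Re (cdiff2 L p v 0 1) + complex.Im (cdiff2 L p v 0 1)) / 2%:R))).
  rewrite !mxE; congr Complex.
    transitivity (tdiff (fun q => 2%:R^-1 * complex.Re (L q 0 0) + 2%:R^-1 * complex.Im (L q 0 0)) p v).
      congr (tdiff _ _ _); apply/funext => q.
      by rewrite /front_F half /front_x /L !mxE /=; field.
    by rewrite tdiff_lin//; field.
  transitivity (tdiff (fun q => (-2%:R^-1) * complex.Re (L q 0 1) + (-2%:R^-1) * complex.Im (L q 0 1)) p v).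
    congr (tdiff _ _ _); apply/funext => q.
    by rewrite /front_F half /front_x /L !mxE /=; field.
  by rewrite tdiff_lin//; field.
have hG v : cdiff (front_G psi) p v =
   (((complex.Re (cdiff2 L p v 0 0) - complex.Im (cdiff2 L p v 0 0)) / 2%:R) +i*
    ((complex.Re (cdiff2 L p v 0 1) - complex.Im (cdiff2 L p v 0 1)) / 2%:R)).
  rewrite !mxE; congr Complex.
    transitivity (tdiff (fun q => 2%:R^-1 * complex.Re (L q 0 0) + (-2%:R^-1) * complex.Im (L q 0 0)) p v).
      congr (tdiff _ _ _); apply/funext => q.
      by rewrite /front_G half /front_x /L !mxE /=; field.
    by rewrite tdiff_lin//; field.
  transitivity (tdiff (fun q => 2%:R^-1 * complex.Re (L q 0 1) + (-2%:R^-1) * complex.Im (L q 0 1)) p v).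
    congr (tdiff _ _ _); apply/funext => q.
    by rewrite /front_G half /front_x /L !mxE /=; field.
  by rewrite tdiff_lin//; field.
rewrite /gauss_map; case: asboolP => // /existsNP[v0 /eqP nz] [<-].
set A := [set c : R[i] | _].
suff : A (xget 0 A) by [].
apply: (@xgetPex _ 0 A).
exists (cdiff (front_F psi) p v0 / cdiff (front_G psi) p v0) => v.
have H := special_lagrangian_FG (o1 p v v0) (o2 p v v0).
by rewrite mulrAC; apply: (mulIf nz); rewrite mulfVK// !hF !hG; apply: H.
Qed.

(* Main.v *)
Require Import Defs.
From HB Require Import structures.
From mathcomp Require Import all_boot all_order all_algebra.
From mathcomp Require Import complex ring lra.
From mathcomp Require Import all_classical all_reals all_analysis measurable_realfun.

(** Suppose the Lagrangian Gauss map omits four values.  A unitary change of the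
    pair [(F, G)], which preserves [d tau^2], moves one of them to infinity: then
    [dG] has no zero, [G] is a local coordinate, and [nu = dF/dG] is a holomorphic
    function omitting three values [a_j].  The density

      [f = |nu'|^2 \prod_j (1 + |nu - a_j|^(1/4)) / |nu - a_j|^(7/4)]

    dominates [|nu'|^2 / (1 + |nu|^2)^3], which is up to a constant minus the
    curvature of [d tau^2], and satisfies [Delta ln f >= c f (1 + |nu|^2)]: the
    metric [f (1 + |nu|^2) |dG|^2] has curvature bounded above by a negative
    constant.

    On a region where [f] is at most [4 f(p)], the curvature bound allows one to
    invert the rotated coordinate [H = alpha G + conj(beta) F], adapted to a given
    point [q], on a square whose size is a constant times [f(p)^(-1/2)]:
    completeness gives the limits of the lifted rays.  On that square the maximum
    principle for [ln f - a |H|^2] forces [f] to grow by a definite factor.  Hence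
    from any [p] with [f(p) > 0] one reaches, within distance
    [A f(p)^(-1/2)], a point where [f] is at least [4 f(p)].  Iterating gives a
    Cauchy sequence along which [f] tends to infinity, which contradicts
    completeness.  Therefore [f = 0], [nu' = 0] and [nu] is constant. *)

Set Implicit Arguments.
Unset Strict Implicit.
Unset Printing Implicit Defensive.

Import Order.TTheory GRing.Theory Num.Theory.
Import numFieldNormedType.Exports.

Local Open Scope classical_set_scope.
Local Open Scope ring_scope.

Local Notation cRe := complex.Re.
Local Notation cIm := complex.Im.
Local Notation reC h := (fun p => complex.Re (h p)).
Local Notation imC h := (fun p => complex.Im (h p)).

(** * One-variable calculus *)

(** The number three comes from the factor 1 + |nu|^2, which appears because d tau^2 = 2 (1 +
    |nu|^2) |dG|^2 while Laplacians are taken in [G]. For large y = |nu|^(1/4) this factor costs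
    y^8. The product over k finite values decays like y^(-6k), and the Laplacian of the logarithm of
    one of its factors only like y^(-9), both up to |nu'|^2. The curvature inequality therefore asks
    for 6k - 8 >= 9, that is k >= 3. The coordinate [G] cannot serve for the lifting, since |nu| may
    be unbounded and then |dG| does not control d tau. Rotating so that the Gauss map vanishes at
    [q] gives a form dH = m dG comparable with d tau as long as the rotated Gauss map has modulus
    below 1. The derivative of the rotated Gauss map with respect to H is nu' / m^3, whose size is
    exactly what the curvature bound controls, so this condition persists on a square of definite
    size. Small squares around moving points thus take the place of a global conformal model of the
    surface. *)

Lemma eq_ler (R : numDomainType) (x y : R) : x = y -> x <= y.
Proof. by move=> ->. Qed.

Section der.
Variable R : realType.
Implicit Types (f g : R -> R) (t : R).

Definition der f t (d : R) : Prop := is_derive t (1 : R) f d.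

Lemma dr_eq f t (a b : R) : der f t a -> a = b -> der f t b.
Proof. by move=> h <-. Qed.

Lemma dr_uniq f t a b : der f t a -> der f t b -> a = b.
Proof. by move=> [_ <-] [_ <-]. Qed.

Lemma dr_derivable f t a : der f t a -> derivable f t 1.
Proof. by case. Qed.

Lemma dr_cont f t a : der f t a -> {for t, continuous f}.
Proof. by case=> h _; apply/differentiable_continuous/derivable1_diffP. Qed.

Lemma dr_near f g t a : (\forall s \near t, f s = g s) -> der f t a -> der g t a.
Proof. exact: near_eq_is_derive. Qed.

Lemma dr_cst (c : R) t : der (fun=> c) t 0.
Proof. exact: is_derive_cst. Qed.

Lemma dr_id t : der (fun s => s) t 1.
Proof. exact: is_derive_id. Qed.

Lemma dr_add f g t a b : der f t a -> der g t b -> der (fun s => f s + g s) t (a + b).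
Proof. by move=> hf hg; exact: (@is_deriveD _ _ _ f g t 1 a b hf hg). Qed.

Lemma dr_opp f t a : der f t a -> der (fun s => - f s) t (- a).
Proof. by move=> hf; exact: (@is_deriveN _ _ _ f t 1 a hf). Qed.

Lemma dr_sub f g t a b : der f t a -> der g t b -> der (fun s => f s - g s) t (a - b).
Proof. by move=> hf hg; exact: (dr_add hf (dr_opp hg)). Qed.

Lemma dr_mul f g t a b : der f t a -> der g t b -> der (fun s => f s * g s) t (a * g t + f t * b).
Proof.
move=> hf hg; apply: (dr_eq (@is_deriveM _ _ f g t 1 a b hf hg)).
by rewrite addrC /GRing.scale /= [X in X + _]mulrC.
Qed.

Lemma dr_scale (c : R) f t a : der f t a -> der (fun s => c * f s) t (c * a).
Proof. by move=> hf; apply: (dr_eq (dr_mul (dr_cst c t) hf)); rewrite mul0r add0r. Qed.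

Lemma dr_inv f t a : f t != 0 -> der f t a -> der (fun s => (f s)^-1) t (- a / f t ^+ 2).
Proof.
move=> h0 [hf <-]; apply: DeriveDef; first exact: derivableV.
by rewrite deriveV// /GRing.scale /= !mulNr mulrC.
Qed.

Lemma dr_comp f g t a b : der f t a -> der g (f t) b -> der (fun s => g (f s)) t (b * a).
Proof.
move=> hf hg; have /= h := @is_derive1_comp _ g f t b a hg hf; apply: (dr_eq h).
by rewrite /GRing.scale.
Qed.

Lemma dr_exp f t a : der f t a -> der (fun s => expR (f s)) t (expR (f t) * a).
Proof. by move=> hf; apply: (dr_comp hf); exact: is_derive_expR. Qed.

Lemma dr_ln f t a : 0 < f t -> der f t a -> der (fun s => ln (f s)) t (a / f t).
Proof.
by move=> f0 hf; rewrite mulrC; apply: (@dr_comp f (@ln R)) => //; exact: is_derive1_ln.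
Qed.

Lemma der_cvgP f t a : der f t a <-> (h^-1 * (f (t + h) - f t) @[h --> 0^'] --> a).
Proof.
have E : (fun h => h^-1 * (f (t + h) - f t)) = (fun h => h^-1 *: ((f \o shift t) (h *: 1) - f t)).
  by apply/funext => h /=; rewrite [_%:A]mulr1 [h + t]addrC.
split=> [[df <-]|]; first by rewrite E; exact: df.
rewrite E => cf; apply: DeriveDef; first by apply/cvg_ex; exists a.
by apply/cvg_lim.
Qed.

Lemma dr_MVT f (df : R -> R) (a b : R) : a < b ->
  (forall s, a <= s <= b -> der f s (df s)) ->
  exists2 c, a < c < b & f b - f a = df c * (b - a).
Proof.
move=> ab h; have [||c] := @MVT _ f df a b ab.
- by move=> x; rewrite in_itv /= => /andP[h1 h2]; apply: h; rewrite !ltW.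
- apply: derivable_within_continuous => x; rewrite in_itv /= => /h; exact: dr_derivable.
by rewrite in_itv /= => ? ?; exists c.
Qed.

Lemma dr_gt0 f t d : der f t d -> 0 < d ->
  exists2 e : R, 0 < e & forall h, 0 < h < e -> f (t - h) < f t < f (t + h).
Proof.
move=> /der_cvgP hf d0; have [e /= e0 eP] : \forall h \near 0^', 0 < h^-1 * (f (t + h) - f t).
  exact: (cvgr_gt _ hf).
exists e => // h /andP[h0 he]; apply/andP; split.
  have := eP (- h); rewrite /ball_ /= sub0r opprK gtr0_norm// oppr_eq0 gt_eqF// => /(_ he isT).
  by rewrite invrN mulNr -mulrN opprB pmulr_rgt0 ?invr_gt0// subr_gt0.
have := eP h; rewrite /ball_ /= sub0r normrN gtr0_norm// gt_eqF// => /(_ he isT).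
by rewrite pmulr_rgt0 ?invr_gt0// subr_gt0.
Qed.

Lemma dr_max f t d : der f t d -> (\forall s \near t, f s <= f t) -> d = 0.
Proof.
move=> hf /nbhs_ballP[r /= r0 rP]; apply/eqP; rewrite eq_le; apply/andP; split; rewrite leNgt; apply/negP => d0.
  have [e e0 eP] := dr_gt0 hf d0.
  have m0 : 0 < Num.min e r / 2 by rewrite divr_gt0// lt_min e0.
  have m1 : Num.min e r <= e by rewrite ge_min lexx.
  have m2 : Num.min e r <= r by rewrite ge_min lexx orbT.
  have /andP[_ h1] := eP (Num.min e r / 2) ltac:(apply/andP; split; lra).
  have : f (t + Num.min e r / 2) <= f t.
    by apply: rP; rewrite /ball /= opprD addrA subrr sub0r normrN gtr0_norm//; lra.
  by rewrite leNgt h1.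
have d0' : 0 < - d by rewrite oppr_gt0.
have [e e0 eP] := dr_gt0 (dr_opp hf) d0'.
have m0 : 0 < Num.min e r / 2 by rewrite divr_gt0// lt_min e0.
have m1 : Num.min e r <= e by rewrite ge_min lexx.
have m2 : Num.min e r <= r by rewrite ge_min lexx orbT.
have /andP[h1 _] := eP (Num.min e r / 2) ltac:(apply/andP; split; lra).
have : f (t - Num.min e r / 2) <= f t.
  by apply: rP; rewrite /ball /= opprB addrC subrK gtr0_norm//; lra.
by move: h1; rewrite ltrN2 => h1; rewrite leNgt h1.
Qed.

(** At the maximum [g t = 0]. If [d] were positive, [g] would be positive just to the right of [t],
    and the mean value theorem would make [f] exceed [f t] there. *)
Lemma dr2_max f g t d : (\forall s \near t, der f s (g s)) -> der g t d ->
  (\forall s \near t, f s <= f t) -> d <= 0.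
Proof.
move=> hf hg fm; have g0 : g t = 0 by exact: (dr_max (nbhs_singleton hf) fm).
rewrite leNgt; apply/negP => d0; have [e e0 eP] := dr_gt0 hg d0.
have : nbhs t ((fun s => der f s (g s)) `&` (fun s => f s <= f t)) by exact: filterI.
move=> /nbhs_ballP[r /= r0 rP].
have m0 : 0 < Num.min e r / 2 by rewrite divr_gt0// lt_min e0.
have m1 : Num.min e r <= e by rewrite ge_min lexx.
have m2 : Num.min e r <= r by rewrite ge_min lexx orbT.
set h := Num.min e r / 2 in m0.
have hE : h < e /\ h < r by rewrite /h; split; lra.
have bt s : t <= s <= t + h -> ball t r s.
  move=> /andP[h1 h2]; rewrite /ball /= distrC ger0_norm ?subr_ge0//.
  case: hE => _ hr; lra.
have [||c cI E] := @dr_MVT f g t (t + h); first by rewrite ltrDl.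
  by move=> s /bt /rP[].
have thB : t <= t + h <= t + h by rewrite lexx andbT lerDl ltW.
have [_] := rP (t + h) (bt _ thB).
rewrite -subr_le0 E addrAC subrr add0r; apply/negP; rewrite -ltNge mulr_gt0//.
have /eP/andP[_] : 0 < c - t < e by case/andP: cI => ? ?; case: hE => ? ?; apply/andP; split; lra.
by rewrite addrCA subrr addr0 g0.
Qed.

End der.

(** * Inverse function theorem in the plane *)

Section plane.
Variable R : realType.
Local Notation V := 'rV[R]_2.

Definition ev (k : 'I_2) : V := delta_mx 0 k.
(* Locked: unfolding ['d] makes unification diverge. *)
Fact pd_key : unit. Proof. exact: tt. Qed.
Definition pd : bool -> (V -> R) -> V -> R :=
  locked_with pd_key (fun k T x => 'd T x (ev (if k then 1 else 0))).
(** The two gradients are taken at different points because the mean value theorem gives each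
    function its own intermediate point. *)
Definition jac2 (f g : V -> R) (x y : V) : R :=
  pd false f x * pd true g y - pd true f x * pd false g y.
Definition jac f g x := jac2 f g x x.

Lemma rV2_ev (v : V) : v = v 0 0 *: ev 0 + v 0 1 *: ev 1.
Proof.
apply/rowP => i; rewrite !mxE.
by case: i => [[|[|//]]] ? /=; rewrite ?mulr1 ?mulr0 ?addr0 ?add0r; congr (v _ _); apply: val_inj.
Qed.

Lemma pdE k (T : V -> R) x : pd k T x = 'd T x (ev (if k then 1 else 0)).
Proof. by rewrite /pd unlock. Qed.

Lemma diffE2 (T : V -> R) x v : 'd T x v = pd false T x * v 0 0 + pd true T x * v 0 1.
Proof. by rewrite !pdE {1}[v]rV2_ev linearD !linearZ /= mulrC [X in _ + X]mulrC. Qed.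

Lemma rV2_norm_le (v : V) e : `|v 0 0| <= e -> `|v 0 1| <= e -> `|v| <= e.
Proof.
move=> h0 h1; rewrite /Num.Def.normr/= mx_normrE (bigmax_le _ (le_trans (normr_ge0 _) h0))//=.
move=> [i j] _ /=; rewrite (ord1 i).
by case: j => [[|[|//]]] hj /=; [have -> : Ordinal hj = 0 by apply: val_inj|have -> : Ordinal hj = 1 by apply: val_inj].
Qed.

Lemma is_derive_line (x v : V) (s : R) : is_derive s 1 (fun s : R => x + s *: v) v.
Proof.
have -> : (fun s : R => x + s *: v) = cst x + (fun s : R => s *: v) by [].
have d1 : is_derive s (1 : R) (fun s : R => s *: v) v.
  apply: DeriveDef; first exact/derivable1_diffP/differentiableZl.
  rewrite deriveE; last exact: differentiableZl.
  by rewrite diffZl//= diff_val scale1r.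
rewrite -[v in X in is_derive _ _ _ X]add0r; exact: is_deriveD.
Qed.

Lemma is_derive_comp_diff (W W' : normedModType R) (T : W -> W') (g : R -> W) s w :
  differentiable T (g s) -> is_derive s (1 : R) g w ->
  is_derive s (1 : R) (T \o g) ('d T (g s) w).
Proof.
move=> dT [dg <-]; have dg' : differentiable g s by exact/derivable1_diffP.
apply: DeriveDef; first exact/derivable1_diffP/(differentiable_comp dg' dT).
rewrite deriveE; last exact: differentiable_comp.
rewrite diff_comp//=; congr ('d T _ _); by rewrite deriveE.
Qed.

Lemma MVT_line (T : V -> R) (x y : V) :
  (forall s : R, 0 <= s <= 1 -> differentiable T (x + s *: (y - x))) ->
  exists2 s : R, 0 <= s <= 1 & T y - T x = 'd T (x + s *: (y - x)) (y - x).
Proof.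
move=> dT.
pose f (s : R) := T (x + s *: (y - x)).
have df (s : R) : 0 <= s <= 1 -> is_derive s (1 : R) f ('d T (x + s *: (y - x)) (y - x)).
  move=> s01; have dTs := dT s s01.
  exact: (is_derive_comp_diff dTs (is_derive_line x (y - x) s)).
have [||s s01 E] := @MVT_segment _ f (fun s => 'd T (x + s *: (y - x)) (y - x)) 0 1 ler01.
- by move=> s; rewrite in_itv/= => /andP[? ?]; apply: df; rewrite !ltW.
- apply: derivable_within_continuous => s; rewrite in_itv/= => /df[]; done.
exists s; first by move: s01; rewrite in_itv.
by move: E; rewrite subr0 mulr1 /f scale1r scale0r addr0 addrCA subrr addr0.
Qed.

Lemma ball_line (W : normedModType R) (x0 x y : W) (r s : R) : ball x0 r x -> ball x0 r y ->
  0 <= s <= 1 -> ball x0 r (x + s *: (y - x)).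
Proof.
rewrite -ball_normE /ball_ /= => hx hy /andP[s0 s1].
have -> : x0 - (x + s *: (y - x)) = (1 - s) *: (x0 - x) + s *: (x0 - y).
  rewrite opprD addrA -scalerN opprB [in RHS]scalerBl scale1r -[RHS]addrA -(scalerN s (x0 - x)).
  by rewrite -scalerDr opprB addrA subrK.
apply: (le_lt_trans (ler_normD _ _)); rewrite !normrZ (ger0_norm s0) ger0_norm ?subr_ge0//.
have [->|sn0] := eqVneq s 0; first by rewrite subr0 mul1r mul0r addr0.
have sp : 0 < s by rewrite lt_def sn0.
rewrite (_ : r = (1 - s) * r + s * r); last by ring.
by apply: ler_ltD; [rewrite ler_wpM2l ?subr_ge0// ltW|rewrite ltr_pM2l].
Qed.

Lemma C1_pd_cont (U : set V) (T : V -> R) k x : Ck_on 1 U T -> U x -> {for x, continuous (pd k T)}.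
Proof.
move=> [_ h] Ux; have := h (ev (if k then 1 else 0)) x Ux.
by rewrite (_ : pd k T = fun x => 'd T x (ev (if k then 1 else 0)))//; apply/funext => z; rewrite pdE.
Qed.

Lemma C1_diff (U : set V) (T : V -> R) x : Ck_on 1 U T -> U x -> differentiable T x.
Proof. by move=> [h _]; apply: h. Qed.

(** The intermediate points of the mean value theorem, chosen for all [y] at once, lie no farther
    from [x0] than [y] does, hence the continuity of [xi] at [x0]. Such an expansion can be
    evaluated along a curve that is only known to be continuous. *)
Lemma MVT_near (U : set V) (T : V -> R) x0 : open U -> U x0 -> Ck_on 1 U T ->
  exists xi : V -> V, [/\ xi x0 = x0, {for x0, continuous xi} &
   \forall y \near x0, T y - T x0 = pd false T (xi y) * (y - x0) 0 0 + pd true T (xi y) * (y - x0) 0 1].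
Proof.
move=> oU Ux CT.
have /nbhs_ballP[r /= r0 rU] := open_nbhs_nbhs (conj oU Ux).
have key (y : V) : exists xi : V, `|xi - x0| <= `|y - x0| /\ (ball x0 r y ->
   T y - T x0 = pd false T xi * (y - x0) 0 0 + pd true T xi * (y - x0) 0 1).
  have [yB|yB] := pselect (ball x0 r y); last first.
    by exists x0; rewrite subrr normr0; split => // /yB.
  have [s s01 E] : exists2 s : R, 0 <= s <= 1 & T y - T x0 = 'd T (x0 + s *: (y - x0)) (y - x0).
    apply: MVT_line => s s01; apply: (C1_diff CT); apply: rU.
    by apply: ball_line => //; exact: ballxx.
  exists (x0 + s *: (y - x0)); rewrite -diffE2; split => //.
  rewrite addrC addKr normrZ ler_piMl//; case/andP: s01 => ? ?; by rewrite ger0_norm.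
have [xi xiP] := @choice V V _ key.
have xi0 : xi x0 = x0.
  have [+ _] := xiP x0; rewrite subrr normr0 normr_le0 subr_eq0 => /eqP; done.
exists xi; split => //; last first.
  by near=> y; apply: (xiP y).2; near: y; exact: nbhsx_ballx.
have cxi : xi y @[y --> x0] --> x0.
  move=> A /nbhs_ballP[e /= e0 eA]; apply/nbhs_ballP; exists e => //= y yB; apply: eA.
  move: yB; rewrite -ball_normE /= => yB.
  by rewrite distrC; apply: (le_lt_trans (xiP y).1); rewrite distrC.
by rewrite /prop_for /continuous_at xi0; exact: cxi.
Unshelve. all: by end_near. Qed.

(** The curve [g] is only continuous. Solving the mean value expansions of [X] and [Y] for the
    coordinate increments by Cramer's rule, and inserting them in that of [f], writes the difference
    quotient of [f] through those of [X] and [Y]. *)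
Lemma is_derive_cramer (U : set V) (X Y f : V -> R) (g : R -> V) t a b :
  open U -> Ck_on 1 U X -> Ck_on 1 U Y -> Ck_on 1 U f -> U (g t) ->
  {for t, continuous g} -> jac X Y (g t) != 0 ->
  der (X \o g) t a -> der (Y \o g) t b ->
  der (f \o g) t ((a * jac f Y (g t) + b * jac X f (g t)) / jac X Y (g t)).
Proof.
move=> oU CX CY Cf Ug cg J0 /der_cvgP dX /der_cvgP dY; apply/der_cvgP.
have [x1 [x10 cx1 x1P]] := MVT_near oU Ug CX.
have [x2 [x20 cx2 x2P]] := MVT_near oU Ug CY.
have [x3 [x30 cx3 x3P]] := MVT_near oU Ug Cf.
have cg0 : g (t + h) @[h --> 0^'] --> g t.
  apply: cvg_within_filter.
  have : g (t + h) @[h --> 0] --> g (t + 0).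
    apply: continuous_comp; first by apply: cvgD; [exact: cvg_cst|exact: cvg_id].
    by rewrite addr0.
  by rewrite addr0.
have cp k (T : V -> R) (xi : V -> V) : Ck_on 1 U T -> xi (g t) = g t -> {for g t, continuous xi} ->
    pd k T (xi (g (t + h))) @[h --> 0^'] --> pd k T (g t).
  move=> CT E cxi; apply: (@cvg_comp _ _ _ _ (pd k T)); last exact: (C1_pd_cont CT Ug).
  by apply: (@cvg_comp _ _ _ _ xi); [exact: cg0|rewrite -{2}E].
have cj (T T' : V -> R) (xi xi' : V -> V) : Ck_on 1 U T -> xi (g t) = g t -> {for g t, continuous xi} ->
   Ck_on 1 U T' -> xi' (g t) = g t -> {for g t, continuous xi'} ->
   jac2 T T' (xi (g (t + h))) (xi' (g (t + h))) @[h --> 0^'] --> jac T T' (g t).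
  move=> *; by apply: cvgB; apply: cvgM; apply: cp.
have cJ := cj _ _ _ _ CX x10 cx1 CY x20 cx2.
have lim : (h^-1 * (X (g (t + h)) - X (g t)) * jac2 f Y (x3 (g (t + h))) (x2 (g (t + h))) +
   h^-1 * (Y (g (t + h)) - Y (g t)) * jac2 X f (x1 (g (t + h))) (x3 (g (t + h))))
   / jac2 X Y (x1 (g (t + h))) (x2 (g (t + h))) @[h --> 0^']
   --> (a * jac f Y (g t) + b * jac X f (g t)) / jac X Y (g t).
  apply: cvgM; last exact: cvgV.
  apply: cvgD; apply: cvgM; [exact: dX|exact: cj|exact: dY|exact: cj].
apply: cvg_trans lim; apply: near_eq_cvg.
have nn (T : V -> R) (xi : V -> V) :
    (\forall y \near g t, T y - T (g t) = pd false T (xi y) * (y - g t) 0 0 + pd true T (xi y) * (y - g t) 0 1) ->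
    \forall h \near 0^', T (g (t + h)) - T (g t) = pd false T (xi (g (t + h))) * (g (t + h) - g t) 0 0
     + pd true T (xi (g (t + h))) * (g (t + h) - g t) 0 1.
  by move=> h; exact: (cg0 _ h).
have nJ : \forall h \near 0^', jac2 X Y (x1 (g (t + h))) (x2 (g (t + h))) != 0.
  exact: (cvgr_neq0 _ cJ J0).
apply: (filter_app _ _ nJ); apply: (filter_app _ _ (nn _ _ x3P)); apply: (filter_app _ _ (nn _ _ x2P)).
apply: (filter_app _ _ (nn _ _ x1P)); apply: filterE => h e1 e2 e3 J1.
rewrite /= e1 e2 e3; apply: (mulIf J1); rewrite divfK//.
rewrite /jac2; move: ((g (t + h) - g t) 0 0) ((g (t + h) - g t) 0 1) => D0 D1; ring.
Qed.

(** Mixed determinants with the two gradients at different points stay away from 0 near the diagonal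
    point [(x0, x0)], so Cramer's rule bounds [y - x] by the increments of [X] and [Y]. *)
Lemma inverse_lower (U : set V) (X Y : V -> R) x0 : open U -> U x0 ->
  Ck_on 1 U X -> Ck_on 1 U Y -> jac X Y x0 != 0 ->
  exists r c : R, [/\ 0 < r, 0 < c, ball x0 r `<=` U,
    forall x, ball x0 r x -> jac X Y x != 0 &
    forall x y e, ball x0 r x -> ball x0 r y -> `|X y - X x| <= e -> `|Y y - Y x| <= e -> `|y - x| <= c * e].
Proof.
move=> oU Ux CX CY J0.
set M : R := 1 + `|pd false X x0| + `|pd true X x0| + `|pd false Y x0| + `|pd true Y x0|.
have M0 : 0 < M by rewrite /M; do 4 (apply: ltr_wpDr => //).
have cJ : jac2 X Y z.1 z.2 @[z --> (x0, x0)] --> jac X Y x0.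
  have f1 k (T : V -> R) : Ck_on 1 U T -> pd k T z.1 @[z --> (x0, x0)] --> pd k T x0.
    move=> CT; apply: (@cvg_comp _ _ _ fst (pd k T) _ (nbhs x0)); last exact: (C1_pd_cont CT Ux).
    exact: cvg_fst.
  have f2 k (T : V -> R) : Ck_on 1 U T -> pd k T z.2 @[z --> (x0, x0)] --> pd k T x0.
    move=> CT; apply: (@cvg_comp _ _ _ snd (pd k T) _ (nbhs x0)); last exact: (C1_pd_cont CT Ux).
    exact: cvg_snd.
  exact: (cvgB (cvgM (f1 false X CX) (f2 true Y CY)) (cvgM (f1 true X CX) (f2 false Y CY))).
set d : R := `|jac X Y x0|; have d0 : 0 < d by rewrite normr_gt0.
have : \forall z \near (x0, x0), d / 2 < `|jac2 X Y z.1 z.2|.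
  apply: (cvgr_gt _ (cvg_norm cJ)).
  by rewrite ltr_pdivrMr// ltr_pMr// ltr1n.
case=> -[/= A B] [nA nB] AB.
have nM k (T : V -> R) : Ck_on 1 U T -> `|pd k T x0| < M -> \forall x \near x0, `|pd k T x| < M.
  by move=> CT; apply: (cvgr_lt _ (cvg_norm (C1_pd_cont (k := k) CT Ux))).
have lM k : `|pd k X x0| < M /\ `|pd k Y x0| < M.
  have k01 : k = false \/ k = true by case: k; [right|left].
  have h (a b c e : R) : 0 <= a -> 0 <= b -> 0 <= c -> 0 <= e ->
    [/\ a < 1 + a + b + c + e, b < 1 + a + b + c + e, c < 1 + a + b + c + e & e < 1 + a + b + c + e].
    by move=> *; split; lra.
  have [h1 h2 h3 h4] := h _ _ _ _ (normr_ge0 (pd false X x0)) (normr_ge0 (pd true X x0)) (normr_ge0 (pd false Y x0)) (normr_ge0 (pd true Y x0)).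
  by case: k01 => ->; [exact: (conj h1 h3)|exact: (conj h2 h4)].
have nU : nbhs x0 U by exact: (open_nbhs_nbhs (conj oU Ux)).
have : \forall x \near x0, [/\ A x, B x, U x & (`|pd false X x| < M /\ `|pd true X x| < M /\ `|pd false Y x| < M /\ `|pd true Y x| < M)].
  have n1 := nM false X CX (lM false).1; have n2 := nM true X CX (lM true).1.
  have n3 := nM false Y CY (lM false).2; have n4 := nM true Y CY (lM true).2.
  apply: (filter_app _ _ n4); apply: (filter_app _ _ n3); apply: (filter_app _ _ n2); apply: (filter_app _ _ n1).
  apply: (filter_app _ _ nU); apply: (filter_app _ _ nB); apply: (filter_app _ _ nA).
  by apply: filterE => x ? ? ? h1 h2 h3 h4; split => //; exact: (conj h1 (conj h2 (conj h3 h4))).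
move=> /nbhs_ballP[r /= r0 rP].
(* The numerators in Cramer's rule are at most [2 * M * e] and the determinant is at least
   [d / 2]. *)
exists r, (4 * M / d); split => //.
- by rewrite !mulr_gt0 ?invr_gt0.
- by move=> x /rP[].
- move=> x xB; have [Ax Bx _ _] := rP x xB; have := AB (x, x) (conj Ax Bx).
  rewrite /= => h; rewrite -normr_gt0; apply: lt_trans h.
  by rewrite divr_gt0.
move=> x y e xB yB hX hY.
have e0 : 0 <= e by apply: le_trans hX.
have mv (T : V -> R) : Ck_on 1 U T -> exists2 xi, ball x0 r xi & T y - T x = pd false T xi * (y - x) 0 0 + pd true T xi * (y - x) 0 1.
  move=> CT; have [s s01 E] : exists2 s : R, 0 <= s <= 1 & T y - T x = 'd T (x + s *: (y - x)) (y - x).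
    apply: MVT_line => s s01; apply: (C1_diff CT).
    by have [] := rP _ (ball_line xB yB s01).
  by exists (x + s *: (y - x)); [exact: ball_line|rewrite -diffE2].
have [x1 b1 E1] := mv X CX; have [x2 b2 E2] := mv Y CY.
have [A1 _ _ [m1 [m2 _]]] := rP _ b1; have [_ B2 _ [_ [_ [m3 m4]]]] := rP _ b2.
have := AB (x1, x2) (conj A1 B2) => /= hJ.
set J := jac2 X Y x1 x2 in hJ.
have [D0 D0E] : exists D0, D0 = (y - x) 0 0 by exists ((y - x) 0 0).
have [D1 D1E] : exists D1, D1 = (y - x) 0 1 by exists ((y - x) 0 1).
rewrite -D0E -D1E in E1 E2.
have F0 : J * D0 = (X y - X x) * pd true Y x2 - (Y y - Y x) * pd true X x1.
  by rewrite E1 E2 /J /jac2; ring.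
have F1 : J * D1 = (Y y - Y x) * pd false X x1 - (X y - X x) * pd false Y x2.
  by rewrite E1 E2 /J /jac2; ring.
have bnd (u v p q D : R) : `|u| <= e -> `|v| <= e -> `|p| < M -> `|q| < M -> J * D = u * p - v * q -> `|D| <= 4 * M / d * e.
  move=> hu hv hp hq E.
  have h1 : `|J| * `|D| <= 2 * M * e.
    rewrite -normrM E; apply: (le_trans (ler_normB _ _)); rewrite !normrM.
    rewrite (_ : 2 * M * e = e * M + e * M); last by ring.
    by apply: lerD; apply: ler_pM => //; exact: ltW.
  have h2 : d / 2 * `|D| <= 2 * M * e by apply: le_trans h1; rewrite ler_wpM2r// ltW.
  rewrite -(ler_pM2l (_ : 0 < d / 2)); last by rewrite divr_gt0.
  apply: (le_trans h2); apply: eq_ler; field; exact: lt0r_neq0.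
by apply: rV2_norm_le; rewrite -?D0E -?D1E; [exact: (bnd _ _ _ _ _ hX hY m4 m2 F0)|exact: (bnd _ _ _ _ _ hY hX m1 m3 F1)].
Qed.

End plane.

Section inverse.
Variable R : realType.
Local Notation V := 'rV[R]_2.

Lemma closed_ball_compact (x0 : V) (r : R) : 0 < r -> compact [set x | `|x - x0| <= r].
Proof.
move=> r0; have -> : [set x | `|x - x0| <= r] = closed_ball x0 r.
  by rewrite closed_ballE//; apply/seteqP; split => x /=; rewrite /closed_ball_ /= distrC.
apply: bounded_closed_compact; last exact: closed_ball_closed.
exists (`|x0| + r); split; first exact: num_real.
move=> M hM x; rewrite closed_ballE// /closed_ball_ /= => h.
have := ler_distD x0 x 0; rewrite !subr0 distrC; lra.
Qed.

Lemma is_derive_dir (T : V -> R) (x : V) k : differentiable T x ->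
  is_derive (0 : R) (1 : R) (fun t : R => T (x + t *: ev R (if k then 1 else 0))) (pd k T x).
Proof.
move=> dT; have := @is_derive_comp_diff R _ _ T (fun t : R => x + t *: ev R (if k then 1 else 0)) 0 _.
rewrite /= scale0r addr0 => /(_ _ dT (is_derive_line x _ 0)).
by rewrite -pdE.
Qed.

(** A preimage of [z] is found by minimizing the squared error [phi] over a closed ball. The lower
    bound of [inverse_lower] makes [phi] larger on the boundary than at [x0], so the minimum is
    interior. There the gradient of [phi] vanishes, and the nonzero Jacobian forces both errors to
    be 0. *)
Lemma local_inverse (U N : set V) (X Y : V -> R) x0 : open U -> U x0 -> nbhs x0 N ->
  Ck_on 1 U X -> Ck_on 1 U Y -> jac X Y x0 != 0 ->
  exists (r : R) (P : R * R -> V), [/\ 0 < r,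
    forall z, ball (X x0, Y x0) r z -> [/\ U (P z), N (P z), jac X Y (P z) != 0, X (P z) = z.1 & Y (P z) = z.2],
    forall z, ball (X x0, Y x0) r z -> {for z, continuous P},
    \forall x \near x0, P (X x, Y x) = x &
    exists2 B : set V, nbhs x0 B & {in B &, forall x y, X x = X y -> Y x = Y y -> x = y}].
Proof.
move=> oU Ux /nbhs_ballP[rN /= rN0 NP] CX CY J0.
have [r0 [c [r00 c0 r0U Jn low]]] := inverse_lower oU Ux CX CY J0.
pose rho : R := Num.min rN r0 / 2.
have rho0 : 0 < rho by rewrite divr_gt0// lt_min rN0.
have m1 : Num.min rN r0 <= rN by rewrite ge_min lexx.
have m2 : Num.min rN r0 <= r0 by rewrite ge_min lexx orbT.
have rhoN : rho < rN by move: rho0; rewrite /rho; lra.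
have rhor : rho < r0 by move: rho0; rewrite /rho; lra.
(* On the sphere of radius [rho] one of [X], [Y] then moves by at least [4 * r], so [phi] is at
   least [9 * r ^+ 2] there, against less than [2 * r ^+ 2] at the centre. *)
pose r : R := rho / (4 * c).
have r_gt0 : 0 < r by rewrite divr_gt0// mulr_gt0.
have dX (x : V) : ball x0 r0 x -> differentiable X x by move=> /r0U /(C1_diff CX).
have dY (x : V) : ball x0 r0 x -> differentiable Y x by move=> /r0U /(C1_diff CY).
have inb (x : V) (s : R) : `|x - x0| <= s -> s < r0 -> ball x0 r0 x.
  by move=> h1 h2; rewrite -ball_normE /= distrC (le_lt_trans h1).
have sol (z : R * R) : ball (X x0, Y x0) r z -> exists x : V, [/\ `|x - x0| < rho, X x = z.1 & Y x = z.2].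
  move=> [/= zX zY].
  pose phi (x : V) : R := (X x - z.1) ^+ 2 + (Y x - z.2) ^+ 2.
  have cphi (x : V) : `|x - x0| <= rho -> {for x, continuous phi}.
    move=> xr; have xr0 := inb _ _ xr rhor.
    have cX := differentiable_continuous (dX _ xr0); have cY := differentiable_continuous (dY _ xr0).
    have c1 : {for x, continuous (fun y => X y - z.1)} by exact: (cvgB cX (cvg_cst (z.1 : R))).
    have c2 : {for x, continuous (fun y => Y y - z.2)} by exact: (cvgB cY (cvg_cst (z.2 : R))).
    exact: (cvgD (cvgM c1 c1) (cvgM c2 c2)).
  have [||x xB xmin] := @compact_EVT_min _ R phi [set x | `|x - x0| <= rho] _ (closed_ball_compact rho0).
  - by exists x0; rewrite /= subrr normr0 ltW.
  - by apply: continuous_in_subspaceT => x; rewrite inE /= => xr; exact: cphi.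
  move: xB; rewrite inE /= => xB.
  have xin : `|x - x0| < rho.
    rewrite lt_neqAle xB andbT; apply/eqP => E.
    have /xmin : x0 \in [set x | `|x - x0| <= rho] by rewrite inE /= subrr normr0 ltW.
    set e := Num.max `|X x - X x0| `|Y x - Y x0|.
    have he : rho <= c * e.
      rewrite -E; apply: low; [exact: ballxx|exact: (inb _ _ xB rhor)| |];
      by rewrite /e le_max lexx ?orbT.
    have er : 4 * r <= e.
      rewrite /r -(ler_pM2l c0); apply: le_trans he.
      by apply: eq_ler; field; rewrite lt0r_neq0.
    move: zX zY; rewrite /ball /= => zX zY.
    have a1 : (X x0 - z.1) ^+ 2 < r ^+ 2 by rewrite -real_normK ?num_real// ltrXn2r// ?nnegrE// ltW.
    have a2 : (Y x0 - z.2) ^+ 2 < r ^+ 2 by rewrite -real_normK ?num_real// ltrXn2r// ?nnegrE// ltW.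
    have key (a b w : R) : `|b - w| < r -> 4 * r <= `|a - b| -> 9 * r ^+ 2 <= (a - w) ^+ 2.
      move=> h1 h2.
      have h3 : 3 * r <= `|a - w|.
        have := ler_distD w a b; rewrite (distrC w b); lra.
      have -> : 9 * r ^+ 2 = (3 * r) ^+ 2 by ring.
      by rewrite -[leRHS]real_normK ?num_real// lerXn2r// nnegrE// mulr_ge0// ltW.
    move=> le1; have le2 : 9 * r ^+ 2 <= phi x.
      have : 4 * r <= `|X x - X x0| \/ 4 * r <= `|Y x - Y x0|.
        by move: er; rewrite /e le_max => /orP[]; [left|right].
      case=> h; have := key _ _ _ _ h.
        by move=> /(_ _ zX) h'; rewrite /phi; apply: (le_trans h'); rewrite lerDl sqr_ge0.
      by move=> /(_ _ zY) h'; rewrite /phi; apply: (le_trans h'); rewrite lerDr sqr_ge0.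
    have : phi x0 < 2 * r ^+ 2 by rewrite /phi; lra.
    have : 0 < r ^+ 2 by rewrite exprn_gt0.
    by lra.
  have xb := inb _ _ xB rhor.
  have grad k : (X x - z.1) * pd k X x + (Y x - z.2) * pd k Y x = 0.
    set u := ev R (if k then 1 else 0).
    pose d := rho - `|x - x0|; have d0 : 0 < d by rewrite subr_gt0.
    have nu : `|u| <= 1.
      by apply: rV2_norm_le; rewrite /u mxE; case: k {u}; rewrite /= ?normr1 ?normr0 ?ler01.
    have tin (t : R) : - d < t < d -> `|x + t *: u - x0| <= rho.
      rewrite -ltr_norml => td.
      rewrite addrAC; apply: (le_trans (ler_normD _ _)); rewrite normrZ.
      have : `|t| * `|u| <= `|t| by rewrite ler_piMr.
      rewrite /d in td; lra.
    have dXt : der (fun t : R => X (x + t *: u)) 0 (pd k X x) by exact: (is_derive_dir k (dX _ xb)).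
    have dYt : der (fun t : R => Y (x + t *: u)) 0 (pd k Y x) by exact: (is_derive_dir k (dY _ xb)).
    have dX1 := dr_sub dXt (dr_cst z.1 0); have dY1 := dr_sub dYt (dr_cst z.2 0).
    have := dr_opp (dr_add (dr_mul dX1 dX1) (dr_mul dY1 dY1)).
    rewrite scale0r addr0 !subr0 => /dr_max h.
    have : - (pd k X x * (X x - z.1) + (X x - z.1) * pd k X x + (pd k Y x * (Y x - z.2) + (Y x - z.2) * pd k Y x)) = 0.
      apply: h; apply/nbhs_ballP; exists d => // t; rewrite /ball /= sub0r normrN ltr_norml => td.
      rewrite lerN2 scale0r addr0.
      have /xmin : x + t *: u \in [set x | `|x - x0| <= rho] by rewrite inE /=; exact: tin.
      by rewrite /phi !expr2.
    by move: (pd k X x) (pd k Y x) => p q h'; lra.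
  have J1 := Jn _ xb.
  have g0 := grad false; have g1 := grad true.
  have e1 : (X x - z.1) * jac X Y x = 0.
    rewrite /jac /jac2; move: (X x - z.1) (Y x - z.2) g0 g1 => A B g0 g1.
    transitivity ((A * pd false X x + B * pd false Y x) * pd true Y x - (A * pd true X x + B * pd true Y x) * pd false Y x); last by rewrite g0 g1 !mul0r subrr.
    by ring.
  have e2 : (Y x - z.2) * jac X Y x = 0.
    rewrite /jac /jac2; move: (X x - z.1) (Y x - z.2) g0 g1 => A B g0 g1.
    transitivity ((A * pd true X x + B * pd true Y x) * pd false X x - (A * pd false X x + B * pd false Y x) * pd true X x); last by rewrite g0 g1 !mul0r subrr.
    by ring.
  exists x; split => //; apply/eqP; rewrite -subr_eq0; apply/eqP.
    by move/eqP: e1; rewrite mulf_eq0 (negbTE J1) orbF => /eqP.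
  by move/eqP: e2; rewrite mulf_eq0 (negbTE J1) orbF => /eqP.
have /choice[P PP] : forall z : R * R, exists x : V, ball (X x0, Y x0) r z -> [/\ `|x - x0| < rho, X x = z.1 & Y x = z.2].
  move=> z; have [zB|zB] := pselect (ball (X x0, Y x0) r z); last by exists x0 => /zB.
  by have [x xP] := sol _ zB; exists x.
have Pb (z : R * R) : ball (X x0, Y x0) r z -> ball x0 r0 (P z).
  by move=> /PP[h _ _]; apply: (inb _ _ (ltW h) rhor).
exists r, P; split => //.
- move=> z zB; have [h hX hY] := PP _ zB; split => //; [exact/r0U/Pb|apply: NP|exact/Jn/Pb].
  by rewrite -ball_normE /= distrC (lt_trans h).
- move=> z zB A /nbhs_ballP[e /= e0 eA].
  have : nbhs z (ball (X x0, Y x0) r `&` ball z (e / (2 * c))).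
    apply: filterI; last by apply: nbhsx_ballx; rewrite divr_gt0// mulr_gt0.
    by apply: open_nbhs_nbhs; split => //; exact: ball_open.
  apply: filterS => z' [zB' [/= h1 h2]]; apply: eA.
  have [_ hX hY] := PP _ zB; have [_ hX' hY'] := PP _ zB'.
  rewrite -ball_normE /= distrC.
  have : `|P z' - P z| <= c * (e / (2 * c)).
    apply: low; [exact: Pb|exact: Pb| |]; rewrite ?hX ?hY ?hX' ?hY' distrC ltW//.
  move=> h; apply: (le_lt_trans h).
  rewrite (_ : c * (e / (2 * c)) = e / 2); last by field; rewrite lt0r_neq0.
  by rewrite ltr_pdivrMr// ltr_pMr// ltr1n.
- have cX := differentiable_continuous (C1_diff CX Ux); have cY := differentiable_continuous (C1_diff CY Ux).
  have n1 : \forall x \near x0, ball (X x0) r (X x) by exact: (cX _ (nbhsx_ballx _ _ r_gt0)).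
  have n2 : \forall x \near x0, ball (Y x0) r (Y x) by exact: (cY _ (nbhsx_ballx _ _ r_gt0)).
  have n3 : \forall x \near x0, ball x0 r0 x by exact: nbhsx_ballx.
  apply: (filter_app _ _ n3); apply: (filter_app _ _ n2); apply: (filter_app _ _ n1).
  apply: filterE => x h1 h2 h3.
  have zB : ball (X x0, Y x0) r (X x, Y x) by split.
  have [_ hX hY] := PP _ zB.
  apply/eqP; rewrite -subr_eq0 -normr_le0 -(mulr0 c); apply: low => //; first exact: Pb.
    by rewrite hX subrr normr0.
  by rewrite hY subrr normr0.
- exists (ball x0 r0); first exact: nbhsx_ballx.
  move=> x y; rewrite !inE => xB yB hX hY.
  apply/eqP; rewrite -subr_eq0 -normr_le0 -(mulr0 c); apply: low => //.
    by rewrite hX subrr normr0.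
  by rewrite hY subrr normr0.
Qed.

End inverse.

(** * Closure properties of C^k functions and symmetry of second derivatives *)

Section smooth_closure.
Variables (R : realType) (V : normedModType R).

Lemma near_eq_diff (W : normedModType R) (f g : V -> W) x : (\forall y \near x, f y = g y) ->
  differentiable f x -> differentiable g x /\ 'd g x = 'd f x :> (V -> W).
Proof.
move=> fg df; have [cf ef] := (diff_locallyP x f).1 df.
have eg : g \o shift x = cst (g x) + 'd f x +o_ (0 : V) id.
  apply/eqaddoP => e e0; move/eqaddoP: ef => /(_ e e0).
  have fg0 : \forall h \near (0 : V), f (h + x) = g (h + x).
    by move/nbhs0P: fg; apply: filterS => h; rewrite addrC.
  have gx := nbhs_singleton fg.
  apply: filter_app; apply: filterS fg0 => h /= E; rewrite !fctE /= E; rewrite gx; done.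
have dE : 'd g x = 'd f x :> (V -> W) by apply: diff_unique.
split; last exact: dE.
by apply/diff_locallyP; rewrite dE; split; [exact: cf|exact: eg].
Qed.

Lemma Ck_eq (W : normedModType R) k (U : set V) (f g : V -> W) : open U ->
  (forall x, U x -> f x = g x) -> Ck_on k U f -> Ck_on k U g.
Proof.
move=> oU; elim: k f g => [|k IH] f g fg /=.
  move=> cf x Ux; have := cf x Ux; rewrite /prop_for /continuous_at (fg x Ux).
  apply: cvg_trans; apply: near_eq_cvg.
  have nU : nbhs x U by exact: open_nbhs_nbhs.
  by apply: filterS nU => y /fg.
move=> [df ddf].
have key x : U x -> differentiable g x /\ 'd g x = 'd f x :> (V -> W).
  move=> Ux; apply: near_eq_diff; last exact: df.
  have nU : nbhs x U by exact: open_nbhs_nbhs.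
  by apply: filterS nU => y /fg.
split; first by move=> x /key[].
by move=> v; apply: IH (ddf v) => x /key[_ ->].
Qed.

Lemma CkS (W : normedModType R) k (U : set V) (f : V -> W) : Ck_on k.+1 U f -> Ck_on k U f.
Proof.
elim: k f => [|k IH] f [df ddf] /=; first by move=> x /df /differentiable_continuous.
by split => // v; apply: IH; exact: ddf.
Qed.

Lemma CkC k (U : set V) (c : R) : open U -> Ck_on k U (fun=> c : R).
Proof.
move=> oU; elim: k c => [|k IH] c /=; first by move=> x _; exact: cvg_cst.
split=> [x _|v]; first exact: differentiable_cst.
by apply: (Ck_eq oU _ (IH 0)) => x _; rewrite (_ : (fun=> c) = cst c)// diff_cst.
Qed.

Lemma CkD k (U : set V) (f g : V -> R) : open U -> Ck_on k U f -> Ck_on k U g ->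
  Ck_on k U (fun x => f x + g x).
Proof.
move=> oU; elim: k f g => [|k IH] f g /=.
  by move=> cf cg x Ux; apply: cvgD; [exact: cf|exact: cg].
move=> [df ddf] [dg ddg]; split; first by move=> x Ux; apply: differentiableD; [exact: df|exact: dg].
move=> v; apply: (Ck_eq oU _ (IH _ _ (ddf v) (ddg v))) => x Ux.
by rewrite (_ : (fun x => f x + g x) = f + g)// diffD; [|exact: df|exact: dg].
Qed.

Lemma CkM k (U : set V) (f g : V -> R) : open U -> Ck_on k U f -> Ck_on k U g ->
  Ck_on k U (fun x => f x * g x).
Proof.
move=> oU; elim: k f g => [|k IH] f g.
  by move=> cf cg x Ux; apply: cvgM; [exact: cf|exact: cg].
move=> Cf Cg; have [df ddf] := Cf; have [dg ddg] := Cg.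
split; first by move=> x Ux; apply: differentiableM; [exact: df|exact: dg].
move=> v; apply: (Ck_eq oU _ (CkD oU (IH _ _ (CkS Cf) (ddg v)) (IH _ _ (CkS Cg) (ddf v)))) => x Ux.
by rewrite (_ : (fun x => f x * g x) = f * g)// diffM; [|exact: df|exact: dg].
Qed.

Lemma CkV k (U : set V) (f : V -> R) : open U -> (forall x, U x -> f x != 0) -> Ck_on k U f ->
  Ck_on k U (fun x => (f x)^-1).
Proof.
move=> oU f0; elim: k => [|k IH].
  by move=> cf x Ux; apply: cvgV; [exact: f0|exact: cf].
move=> Cf; have [df ddf] := Cf.
split; first by move=> x Ux; apply: differentiableV; [exact: df|exact: f0].
have Cv := IH (CkS Cf) => v.
apply: (Ck_eq oU _ (CkM oU (CkC k (-1) oU) (CkM oU (CkM oU Cv Cv) (ddf v)))) => x Ux.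
rewrite diffV; [|exact: df|exact: f0].
by rewrite /= expr2 invfM mulN1r scaleNr.
Qed.

End smooth_closure.

Section clairaut.
Variable R : realType.

(** The second difference of [f] over a square of side [h] equals [h * h] times [fxy] at one point
    and times [fyx] at another. If the two limits differed, continuity would separate these values
    on a small square. *)
Lemma clairaut (f fx fy fxy fyx : R -> R -> R) (x0 y0 r : R) : 0 < r ->
  (forall x y, `|x - x0| < r -> `|y - y0| < r ->
    [/\ der (f^~ y) x (fx x y), der (f x) y (fy x y), der (fx x) y (fxy x y) & der (fy^~ y) x (fyx x y)]) ->
  {for (x0, y0), continuous (fun z => fxy z.1 z.2)} -> {for (x0, y0), continuous (fun z => fyx z.1 z.2)} ->
  fxy x0 y0 = fyx x0 y0.
Proof.
move=> r0 H c1 c2; apply/eqP/negPn/negP => ne.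
pose d : R := `|fxy x0 y0 - fyx x0 y0| / 2.
have d0 : 0 < d by rewrite divr_gt0// normr_gt0 subr_eq0.
have /nbhs_ballP[e1 /= e10 B1] := c1 _ (nbhsx_ballx _ _ d0).
have /nbhs_ballP[e2 /= e20 B2] := c2 _ (nbhsx_ballx _ _ d0).
pose m : R := Num.min r (Num.min e1 e2).
have m0 : 0 < m by rewrite !lt_min r0 e10 e20.
have mr : m <= r by rewrite ge_min lexx.
have me1 : m <= e1 by rewrite !ge_min lexx orbT.
have me2 : m <= e2 by rewrite !ge_min lexx !orbT.
pose h : R := m / 2; have h0 : 0 < h by rewrite divr_gt0.
have hm : h < m by rewrite /h; lra.
have inr (b x : R) : b <= x <= b + h -> `|x - b| < m.
  by move=> /andP[a1 a2]; rewrite ger0_norm ?subr_ge0//; lra.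
have xx : x0 < x0 + h by rewrite ltrDl.
have ylt : y0 < y0 + h by rewrite ltrDl.
have bx : x0 <= x0 <= x0 + h by rewrite lexx ltW.
have bx' : x0 <= x0 + h <= x0 + h by rewrite lexx ltW.
have by0 : y0 <= y0 <= y0 + h by rewrite lexx ltW.
have by' : y0 <= y0 + h <= y0 + h by rewrite lexx ltW.
have P1 : exists x y, [/\ x0 <= x <= x0 + h, y0 <= y <= y0 + h &
    f (x0 + h) (y0 + h) - f (x0 + h) y0 - (f x0 (y0 + h) - f x0 y0) = fxy x y * h * h].
  have [|x xI E] := @dr_MVT _ (fun x => f x (y0 + h) - f x y0) (fun x => fx x (y0 + h) - fx x y0) x0 (x0 + h) xx.
    move=> x /inr xr; have xr' : `|x - x0| < r by apply: lt_le_trans mr.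
    have yr1 : `|y0 + h - y0| < r by apply: lt_le_trans (inr _ _ by') mr.
    have yr2 : `|y0 - y0| < r by apply: lt_le_trans (inr _ _ by0) mr.
    have [h1 _ _ _] := H _ _ xr' yr1; have [h2 _ _ _] := H _ _ xr' yr2; exact: dr_sub.
  have xI' : x0 <= x <= x0 + h by case/andP: xI => ? ?; rewrite !ltW.
  have [|y yI E'] := @dr_MVT _ (fx x) (fxy x) y0 (y0 + h) ylt.
    move=> y /inr yr; have xr' : `|x - x0| < r by apply: lt_le_trans mr; exact: inr.
    have yr' : `|y - y0| < r by apply: lt_le_trans mr.
    by have [] := H _ _ xr' yr'.
  exists x, y; split => //; first by case/andP: yI => ? ?; rewrite !ltW.
  by rewrite E E' !(addrC _ h) !addrK.
have P2 : exists x y, [/\ x0 <= x <= x0 + h, y0 <= y <= y0 + h &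
    f (x0 + h) (y0 + h) - f x0 (y0 + h) - (f (x0 + h) y0 - f x0 y0) = fyx x y * h * h].
  have [|y yI E] := @dr_MVT _ (fun y => f (x0 + h) y - f x0 y) (fun y => fy (x0 + h) y - fy x0 y) y0 (y0 + h) ylt.
    move=> y /inr yr; have yr' : `|y - y0| < r by apply: lt_le_trans mr.
    have xr1 : `|x0 + h - x0| < r by apply: lt_le_trans (inr _ _ bx') mr.
    have xr2 : `|x0 - x0| < r by apply: lt_le_trans (inr _ _ bx) mr.
    have [_ h1 _ _] := H _ _ xr1 yr'; have [_ h2 _ _] := H _ _ xr2 yr'; exact: dr_sub.
  have yI' : y0 <= y <= y0 + h by case/andP: yI => ? ?; rewrite !ltW.
  have [|x xI E'] := @dr_MVT _ (fy^~ y) (fyx^~ y) x0 (x0 + h) xx.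
    move=> x /inr xr; have yr' : `|y - y0| < r by apply: lt_le_trans mr; exact: inr.
    have xr' : `|x - x0| < r by apply: lt_le_trans mr.
    by have [] := H _ _ xr' yr'.
  exists x, y; split => //; first by case/andP: xI => ? ?; rewrite !ltW.
  by rewrite E E' !(addrC _ h) !addrK.
have [x [y [xI yI E]]] := P1; have [x' [y' [xI' yI' E']]] := P2.
have EE : fxy x y = fyx x' y'.
  apply: (mulIf (lt0r_neq0 h0)); apply: (mulIf (lt0r_neq0 h0)); rewrite -E -E'; ring.
have b1 : `|fxy x0 y0 - fxy x y| < d.
  apply: (B1 (x, y)); split; rewrite /ball /= distrC; apply: lt_le_trans me1; exact: inr.
have b2 : `|fyx x0 y0 - fyx x' y'| < d.
  apply: (B2 (x', y')); split; rewrite /ball /= distrC; apply: lt_le_trans me2; exact: inr.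
have := ler_distD (fxy x y) (fxy x0 y0) (fyx x0 y0).
rewrite {2}EE (distrC (fyx x' y')) => b3.
have : `|fxy x0 y0 - fyx x0 y0| = d + d by rewrite /d; lra.
lra.
Qed.

End clairaut.

Lemma diff_comp_near (R : realType) (U V W : normedModType R) (tau : U -> V) (f : V -> W) (f0 : U -> W) x y v :
  differentiable tau x -> differentiable f (tau x) -> y = tau x ->
  (\forall z \near x, (f \o tau) z = f0 z) -> 'd f0 x v = 'd f y ('d tau x v).
Proof.
move=> dt df -> E.
have [_ H] := near_eq_diff E (differentiable_comp dt df).
by rewrite (congr1 (fun k : U -> W => k v) H) diff_comp.
Qed.

(** * Functions on the surface read in charts *)

Section surface.
Variables (R : realType) (S : orientedSurface R).
Local Notation V := 'rV[R]_2.
Implicit Types (c : chart R S) (p q : S) (f g X Y : S -> R).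

Definition img c : set V := cmap c @` cdom c.
Definition loc c f : V -> R := f \o cinv c.
Definition J c f g p : R := jac (loc c f) (loc c g) (cmap c p).

Lemma open_img c : open (img c). Proof. exact: cimg_open. Qed.

Lemma img_cmap c p : cdom c p -> img c (cmap c p). Proof. by exists p. Qed.

Lemma cmap_cont c p : cdom c p -> {for p, continuous (cmap c)}.
Proof.
move=> pc; have := @cmap_continuous _ _ c; rewrite continuous_open_subspace; last exact: cdom_open.
by move=> h; apply: h; rewrite inE.
Qed.

Lemma cinv_cont c x : img c x -> {for x, continuous (cinv c)}.
Proof.
move=> pc; have := @cinv_continuous _ _ c; rewrite continuous_open_subspace; last exact: cimg_open.
by move=> h; apply: h; rewrite inE.
Qed.

Lemma near_cdom c p : cdom c p -> \forall q \near p, cdom c q.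
Proof. by move=> pc; apply: open_nbhs_nbhs; split => //; exact: cdom_open. Qed.

Lemma smooth_Ck k c f : smooth_map f -> atlas c -> Ck_on k (img c) (loc c f).
Proof. by move=> sf ac; exact: sf. Qed.

Lemma smooth_cont f p : smooth_map f -> {for p, continuous f}.
Proof.
move=> sf; set c := chart_at p.
have pc : cdom c p by exact: chart_at_dom.
have h1 := cmap_cont pc.
have h2 : {for cmap c p, continuous (loc c f)}.
  by have := smooth_Ck 0 sf (chart_at_atlas p); apply; exact: img_cmap.
have h3 : {for p, continuous (loc c f \o cmap c)} by exact: (@continuous_comp _ _ _ (cmap c) (loc c f) p h1 h2).
have E q : cdom c q -> (loc c f \o cmap c) q = f q by move=> qc; rewrite /loc /= cmapK.
move: h3; rewrite /prop_for /continuous_at E//; apply: cvg_trans; apply: near_eq_cvg.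
by apply: filterS (near_cdom pc) => q /E.
Qed.

Lemma loc_inverse c X Y p (N : set S) : atlas c -> cdom c p -> smooth_map X -> smooth_map Y ->
  J c X Y p != 0 -> nbhs p N ->
  exists (r : R) (P : R * R -> S), [/\ 0 < r,
    forall z, ball (X p, Y p) r z -> [/\ N (P z), X (P z) = z.1 & Y (P z) = z.2],
    forall z, ball (X p, Y p) r z -> {for z, continuous P},
    \forall q \near p, P (X q, Y q) = q &
    exists2 B : set S, nbhs p B & {in B &, forall q q', X q = X q' -> Y q = Y q' -> q = q'}].
Proof.
move=> ac pc sX sY J0 nN.
have Ux := img_cmap pc.
have nN' : nbhs (cmap c p) (cinv c @^-1` N).
  have := cinv_cont Ux; rewrite /prop_for /continuous_at cmapK// => h; exact: (h _ nN).
have XE q : cdom c q -> loc c X (cmap c q) = X q by move=> qc; rewrite /loc /= cmapK.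
have YE q : cdom c q -> loc c Y (cmap c q) = Y q by move=> qc; rewrite /loc /= cmapK.
have [r [P [r0 P1 P2 P3 [B nB Binj]]]] := local_inverse (@open_img c) Ux nN' (smooth_Ck 1 sX ac) (smooth_Ck 1 sY ac) J0.
rewrite XE// YE// in P1 P2.
exists r, (cinv c \o P); split => //.
- by move=> z /P1[? ? _ ? ?]; split.
- move=> z zB; have [Pi _ _ _ _] := P1 _ zB.
  exact: (@continuous_comp _ _ _ P (cinv c) z (P2 _ zB) (cinv_cont Pi)).
- have h : nbhs p (cmap c @^-1` [set x | P (loc c X x, loc c Y x) = x]) by exact: (cmap_cont pc P3).
  apply: (filter_app _ _ (near_cdom pc)); apply: filterS h => q /= E qc.
  by rewrite -(XE q)// -(YE q)// E cmapK.
- exists (cdom c `&` cmap c @^-1` B).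
    by apply: filterI; [exact: near_cdom|exact: (cmap_cont pc)].
  move=> q q'; rewrite !inE => -[qc qB] [qc' qB'] hX hY.
  rewrite -(cmapK qc) -(cmapK qc'); congr (cinv c _); apply: Binj; rewrite ?inE//.
    by rewrite !XE.
  by rewrite !YE.
Qed.

(** The function [fh] lives on the image of the chart, so that the lemma also covers the coordinates
    of the chart itself; this is how a lifted curve is seen to be C^1. *)
Lemma cur_der_chart c X Y (fh : V -> R) (g : R -> S) t a b : atlas c -> cdom c (g t) ->
  smooth_map X -> smooth_map Y -> Ck_on 1 (img c) fh -> J c X Y (g t) != 0 ->
  {for t, continuous g} -> der (X \o g) t a -> der (Y \o g) t b ->
  der (fh \o cmap c \o g) t
   ((a * jac fh (loc c Y) (cmap c (g t)) + b * jac (loc c X) fh (cmap c (g t))) / J c X Y (g t)).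
Proof.
move=> ac gc sX sY Cf J0 cg dX dY.
have cg' : {for t, continuous (cmap c \o g)} by exact: (@continuous_comp _ _ _ g (cmap c) t cg (cmap_cont gc)).
have nd : \forall s \near t, cdom c (g s) by exact: (cg _ (near_cdom gc)).
have near_loc (h : S -> R) d : der (h \o g) t d -> der (loc c h \o (cmap c \o g)) t d.
  apply: dr_near; apply: filterS nd => s sc; by rewrite /loc /= cmapK.
exact: (is_derive_cramer (@open_img c) (smooth_Ck 1 sX ac) (smooth_Ck 1 sY ac) Cf (img_cmap gc) cg' J0 (near_loc _ _ dX) (near_loc _ _ dY)).
Qed.

Lemma cur_der c X Y f (g : R -> S) t a b : atlas c -> cdom c (g t) ->
  smooth_map X -> smooth_map Y -> smooth_map f -> J c X Y (g t) != 0 ->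
  {for t, continuous g} -> der (X \o g) t a -> der (Y \o g) t b ->
  der (f \o g) t ((a * J c f Y (g t) + b * J c X f (g t)) / J c X Y (g t)).
Proof.
move=> ac gc sX sY sf J0 cg dX dY.
have := cur_der_chart ac gc sX sY (smooth_Ck 1 sf ac) J0 cg dX dY.
apply: dr_near.
have nd : \forall s \near t, cdom c (g s) by exact: (cg _ (near_cdom gc)).
by apply: filterS nd => s sc; rewrite /loc /= cmapK.
Qed.

(** By the chain rule the Jacobian in [chart_at p] is the one in [c] times the determinant of the
    transition map. *)
Lemma J_chart c X Y p : atlas c -> cdom c p -> smooth_map X -> smooth_map Y ->
  J (chart_at p) X Y p != 0 -> J c X Y p != 0.
Proof.
move=> ac pc sX sY; apply: contra_neq => J0.
set c0 := chart_at p; have ac0 : atlas c0 by exact: chart_at_atlas.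
have pc0 : cdom c0 p by exact: chart_at_dom.
set x0 := cmap c0 p.
have ov : overlap c0 c x0 by exists p.
have dtau : differentiable (transition c0 c) x0 by have [h _] := atlas_smooth ac0 ac 1; exact: h.
have tx : transition c0 c x0 = cmap c p by rewrite /transition /= cmapK.
have nov : \forall x \near x0, img c0 x /\ cdom c (cinv c0 x).
  apply: filterI; first by apply: open_nbhs_nbhs; split; [exact: open_img|exact: img_cmap].
  have h := cinv_cont (img_cmap pc0); rewrite /prop_for /continuous_at cmapK// in h.
  exact: (h _ (near_cdom pc)).
have key (f : S -> R) v : smooth_map f -> 'd (loc c0 f) x0 v = 'd (loc c f) (cmap c p) ('d (transition c0 c) x0 v).
  move=> sf; have df : differentiable (loc c f) (transition c0 c x0).
    by rewrite tx; apply: (C1_diff (smooth_Ck 1 sf ac)); exact: img_cmap.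
  have E : \forall x \near x0, (loc c f \o transition c0 c) x = loc c0 f x.
    by apply: filterS nov => x [xi xc]; rewrite /loc /transition /= cmapK.
  have Q := diff_comp_near v dtau df (esym tx) E.
  exact Q.
set u := 'd (transition c0 c) x0 (ev R 0); set w := 'd (transition c0 c) x0 (ev R 1).
have e k (f : S -> R) : smooth_map f -> pd k (loc c0 f) x0 = 'd (loc c f) (cmap c p) (if k then w else u).
  move=> sf; case: k.
    exact (etrans (pdE true _ _) (key f (ev R 1) sf)).
  exact (etrans (pdE false _ _) (key f (ev R 0) sf)).
rewrite /J /jac /jac2 !e// !diffE2.
move: J0; rewrite /J /jac /jac2.
move: (u 0 0) (u 0 1) (w 0 0) (w 0 1) => u0 u1 w0 w1.
move: (pd false (loc c X) (cmap c p)) (pd true (loc c X) (cmap c p)) (pd false (loc c Y) (cmap c p)) (pd true (loc c Y) (cmap c p)) => X0 X1 Y0 Y1 J0.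
transitivity ((X0 * Y1 - X1 * Y0) * (u0 * w1 - u1 * w0)); first by ring.
by rewrite J0 mul0r.
Qed.

End surface.

(** * Partial derivatives with respect to a pair of local coordinates *)

Section frame.
Variables (R : realType) (S : orientedSurface R) (X Y : S -> R).
Hypotheses (sX : smooth_map X) (sY : smooth_map Y).
Hypothesis et : forall p, J (chart_at p) X Y p != 0.
Implicit Types (c : chart R S) (p q : S) (f g : S -> R).

(** Cramer's rule for the partial derivatives along [X] and [Y] in the local coordinates [(X, Y)].
    They are global operators on functions, since [(X, Y)] is a local coordinate system around every
    point. *)
Definition D1 f p := J (chart_at p) f Y p / J (chart_at p) X Y p.
Definition D2 f p := J (chart_at p) X f p / J (chart_at p) X Y p.

Lemma cur_D f (g : R -> S) t a b : smooth_map f -> {for t, continuous g} ->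
  der (X \o g) t a -> der (Y \o g) t b -> der (f \o g) t (a * D1 f (g t) + b * D2 f (g t)).
Proof.
move=> sf cg dX dY.
have := cur_der (chart_at_atlas (g t)) (chart_at_dom (g t)) sX sY sf (et _) cg dX dY.
by move/dr_eq; apply; rewrite mulrDl !mulrA.
Qed.

Lemma branch_der (P : R * R -> S) (A B : S -> R) (u v : R -> R) t a b :
  {for (u t, v t), continuous P} ->
  (\forall z \near (u t, v t), A (P z) = z.1 /\ B (P z) = z.2) ->
  der u t a -> der v t b ->
  [/\ {for t, continuous (fun s => P (u s, v s))},
     der (A \o (fun s => P (u s, v s))) t a & der (B \o (fun s => P (u s, v s))) t b].
Proof.
move=> cP nP du dv.
have cuv : (u s, v s) @[s --> t] --> (u t, v t).
  move=> Q [[A' B'] [/= nA nB] AB].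
  have n1 : \forall s \near t, A' (u s) by exact: (dr_cont du nA).
  have n2 : \forall s \near t, B' (v s) by exact: (dr_cont dv nB).
  by apply: (filter_app _ _ n2); apply: filterS n1 => s h1 h2; apply: AB; split.
have n : \forall s \near t, A (P (u s, v s)) = u s /\ B (P (u s, v s)) = v s by exact: (cuv _ nP).
split.
- exact: (@cvg_comp _ _ _ (fun s => (u s, v s)) P _ _ _ cuv cP).
- by apply: dr_near du; apply: filterS n => s /= [-> _].
- by apply: dr_near dv; apply: filterS n => s /= [_ ->].
Qed.

Lemma branch p (N : set S) : nbhs p N ->
  exists (r : R) (P : R * R -> S), [/\ 0 < r, P (X p, Y p) = p,
    forall z, ball (X p, Y p) r z -> [/\ N (P z), X (P z) = z.1 & Y (P z) = z.2],
    forall z, ball (X p, Y p) r z -> {for z, continuous P} &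
    \forall q \near p, P (X q, Y q) = q].
Proof.
move=> nN; have [r [P [h1 h2 h3 h4 _]]] := loc_inverse (chart_at_atlas p) (chart_at_dom p) sX sY (et p) nN.
by exists r, P; split => //; exact: nbhs_singleton h4.
Qed.

Lemma branch_near (P : R * R -> S) (A B : S -> R) (z0 : R * R) (r : R) z :
  (forall z, ball z0 r z -> A (P z) = z.1 /\ B (P z) = z.2) -> ball z0 r z ->
  \forall z' \near z, A (P z') = z'.1 /\ B (P z') = z'.2.
Proof.
move=> h zB; have : nbhs z (ball z0 r) by apply: open_nbhs_nbhs; split => //; exact: ball_open.
by apply: filterS => z' /h.
Qed.

Lemma lines p : exists g1 g2 : R -> S, [/\ g1 0 = p, {for 0, continuous g1}, der (X \o g1) 0 1 & der (Y \o g1) 0 0] /\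
  [/\ g2 0 = p, {for 0, continuous g2}, der (X \o g2) 0 0 & der (Y \o g2) 0 1].
Proof.
have [r [P [r0 Pp P1 P2 _]]] := @branch p setT filterT.
have P1' z : ball (X p, Y p) r z -> X (P z) = z.1 /\ Y (P z) = z.2 by move=> /P1[].
have b0 : ball (X p, Y p) r (X p, Y p) by exact: ballxx.
have i1 : der (fun s : R => X p + s) 0 1.
  by apply: (dr_eq (dr_add (dr_cst (X p) 0) (dr_id 0))); rewrite add0r.
have i2 : der (fun s : R => Y p + s) 0 1.
  by apply: (dr_eq (dr_add (dr_cst (Y p) 0) (dr_id 0))); rewrite add0r.
exists (fun s => P (X p + s, Y p)), (fun s => P (X p, Y p + s)); split.
  have := @branch_der P X Y (fun s => X p + s) (fun=> Y p) 0 1 0.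
  rewrite addr0 => /(_ (P2 _ b0) (branch_near P1' b0) i1 (dr_cst _ _))[? ? ?]; split => //.
have := @branch_der P X Y (fun=> X p) (fun s => Y p + s) 0 0 1.
rewrite addr0 => /(_ (P2 _ b0) (branch_near P1' b0) (dr_cst _ _) i2)[? ? ?]; split => //.
Qed.

(** Both quotients are the derivative of [f] along the same coordinate line, so they do not depend
    on the chart. Smoothness in a chart can then be checked with the Jacobians of that chart. *)
Lemma D_chart c f p : atlas c -> cdom c p -> smooth_map f ->
  D1 f p = J c f Y p / J c X Y p /\ D2 f p = J c X f p / J c X Y p.
Proof.
move=> ac pc sf; have J0 : J c X Y p != 0 by exact: J_chart.
have [g1 [g2 [[e1 c1 a1 b1] [e2 c2 a2 b2]]]] := lines p; split.
  have d1 := cur_D sf c1 a1 b1; rewrite e1 in d1.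
  have pc1 : cdom c (g1 0) by rewrite e1.
  have J1 : J c X Y (g1 0) != 0 by rewrite e1.
  have := dr_uniq d1 (cur_der ac pc1 sX sY sf J1 c1 a1 b1).
  by rewrite !mul1r !mul0r !addr0 e1.
have d1 := cur_D sf c2 a2 b2; rewrite e2 in d1.
have pc1 : cdom c (g2 0) by rewrite e2.
have J1 : J c X Y (g2 0) != 0 by rewrite e2.
have := dr_uniq d1 (cur_der ac pc1 sX sY sf J1 c2 a2 b2).
by rewrite !mul1r !mul0r !add0r e2.
Qed.

Lemma Ck_pd k c f b : atlas c -> smooth_map f -> Ck_on k (img c) (pd b (loc c f)).
Proof.
move=> ac sf; have [_ h] := smooth_Ck k.+1 sf ac.
apply: (Ck_eq (@open_img _ _ c) _ (h (ev R (if b then 1 else 0)))) => x _.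
by rewrite pdE.
Qed.

Lemma Ck_jac k c f g : atlas c -> smooth_map f -> smooth_map g ->
  Ck_on k (img c) (jac (loc c f) (loc c g)).
Proof.
move=> ac sf sg; have oc := @open_img _ _ c.
have := CkD oc (CkM oc (Ck_pd k false ac sf) (Ck_pd k true ac sg))
   (CkM oc (CkC k (-1) oc) (CkM oc (Ck_pd k true ac sf) (Ck_pd k false ac sg))).
by apply: Ck_eq => // x _; rewrite mulN1r.
Qed.

Lemma smooth_D f : smooth_map f -> smooth_map (D1 f) /\ smooth_map (D2 f).
Proof.
move=> sf; split=> c ac k; have oc := @open_img _ _ c.
  have J0 x : img c x -> jac (loc c X) (loc c Y) x != 0.
    by move=> [p pc <-]; exact: (J_chart ac pc sX sY (et p)).
  apply: (Ck_eq oc _ (CkM oc (Ck_jac k ac sf sY) (CkV oc J0 (Ck_jac k ac sX sY)))) => x [p pc <-].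
  by rewrite /= cmapK// (D_chart ac pc sf).1.
have J0 x : img c x -> jac (loc c X) (loc c Y) x != 0.
  by move=> [p pc <-]; exact: (J_chart ac pc sX sY (et p)).
apply: (Ck_eq oc _ (CkM oc (Ck_jac k ac sX sf) (CkV oc J0 (Ck_jac k ac sX sY)))) => x [p pc <-].
by rewrite /= cmapK// (D_chart ac pc sf).2.
Qed.

(** Clairaut's theorem for [f] composed with a local inverse of [(X, Y)]. *)
Lemma D_comm f p : smooth_map f -> D1 (D2 f) p = D2 (D1 f) p.
Proof.
move=> sf; have [s1 s2] := smooth_D sf.
have [s21 _] := smooth_D s2; have [_ s12] := smooth_D s1.
have [r [P [r0 Pp P1 P2 _]]] := @branch p setT filterT.
have P1' z : ball (X p, Y p) r z -> X (P z) = z.1 /\ Y (P z) = z.2 by move=> /P1[].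
have b0 : ball (X p, Y p) r (X p, Y p) by exact: ballxx.
have bb x y : `|x - X p| < r -> `|y - Y p| < r -> ball (X p, Y p) r (x, y).
  by move=> h1 h2; split; rewrite /ball /= distrC.
have dx h x y : smooth_map h -> ball (X p, Y p) r (x, y) -> der (fun x => h (P (x, y))) x (D1 h (P (x, y))).
  move=> sh zB.
  have [cc a1 a2] := @branch_der P X Y (fun s => s) (fun=> y) x 1 0 (P2 _ zB) (branch_near P1' zB) (dr_id _) (dr_cst _ _).
  by have := cur_D sh cc a1 a2; rewrite mul1r mul0r addr0.
have dy h x y : smooth_map h -> ball (X p, Y p) r (x, y) -> der (fun y => h (P (x, y))) y (D2 h (P (x, y))).
  move=> sh zB.
  have [cc a1 a2] := @branch_der P X Y (fun=> x) (fun s => s) y 0 1 (P2 _ zB) (branch_near P1' zB) (dr_cst _ _) (dr_id _).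
  by have := cur_D sh cc a1 a2; rewrite mul1r mul0r add0r.
have cont (h : S -> R) : smooth_map h -> {for (X p, Y p), continuous (fun z => h (P (z.1, z.2)))}.
  move=> sh; rewrite (_ : (fun z => h (P (z.1, z.2))) = h \o P); last by apply/funext => -[].
  apply: continuous_comp; first exact: P2.
  exact: smooth_cont.
have := @clairaut R (fun x y => f (P (x, y))) (fun x y => D1 f (P (x, y))) (fun x y => D2 f (P (x, y)))
   (fun x y => D2 (D1 f) (P (x, y))) (fun x y => D1 (D2 f) (P (x, y))) (X p) (Y p) r r0.
rewrite Pp => -> //; last 2 first.
- exact: cont.
- exact: cont.
move=> x y hx hy; have zB := bb _ _ hx hy.
by split; [exact: dx|exact: dy|exact: dy|exact: dx].
Qed.

Lemma D_opp f p : smooth_map f -> smooth_map (fun q => - f q) ->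
  D1 (fun q => - f q) p = - D1 f p /\ D2 (fun q => - f q) p = - D2 f p.
Proof.
move=> sf sf'; have [g1 [g2 [[e1 c1 a1 b1] [e2 c2 a2 b2]]]] := lines p; split.
  have := dr_uniq (cur_D sf' c1 a1 b1) (dr_opp (cur_D sf c1 a1 b1)).
  by rewrite !mul1r !mul0r !addr0 e1.
have := dr_uniq (cur_D sf' c2 a2 b2) (dr_opp (cur_D sf c2 a2 b2)).
by rewrite !mul1r !mul0r !add0r e2.
Qed.

End frame.

Local Open Scope complex_scope.

(** * Complex-valued functions of a real variable *)

Section cder.
Variable R : realType.
Implicit Types (f g : R -> R[i]) (t : R) (a b : R[i]).

Definition cder f t a := der (reC f) t (cRe a) /\ der (imC f) t (cIm a).

Lemma Re_mul a b : cRe (a * b) = cRe a * cRe b - cIm a * cIm b.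
Proof. by case: a b => [? ?] [? ?]. Qed.
Lemma Im_mul a b : cIm (a * b) = cRe a * cIm b + cIm a * cRe b.
Proof. by case: a b => [? ?] [? ?]. Qed.
Lemma Re_add a b : cRe (a + b) = cRe a + cRe b.
Proof. by case: a b => [? ?] [? ?]. Qed.
Lemma Im_add a b : cIm (a + b) = cIm a + cIm b.
Proof. by case: a b => [? ?] [? ?]. Qed.
Lemma Re_opp a : cRe (- a) = - cRe a.
Proof. by case: a => [? ?]. Qed.
Lemma Im_opp a : cIm (- a) = - cIm a.
Proof. by case: a => [? ?]. Qed.

Definition nsq a : R := cRe a ^+ 2 + cIm a ^+ 2.

Lemma nsq_ge0 a : 0 <= nsq a.
Proof. by rewrite addr_ge0 ?sqr_ge0. Qed.

Lemma nsq_eq0 a : (nsq a == 0) = (a == 0).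
Proof. by rewrite paddr_eq0 ?sqr_ge0// !sqrf_eq0 [RHS]eq_complex /=. Qed.

Lemma nsq_gt0 a : (0 < nsq a) = (a != 0).
Proof. by rewrite lt_def nsq_ge0 andbT nsq_eq0. Qed.

Lemma nsqM a b : nsq (a * b) = nsq a * nsq b.
Proof. rewrite /nsq Re_mul Im_mul; ring. Qed.

Lemma nsqV a : nsq a^-1 = (nsq a)^-1.
Proof.
have [->|a0] := eqVneq a 0; first by rewrite invr0 (eqP (_ : nsq 0 == 0)) ?invr0 ?nsq_eq0.
have n0 : nsq a != 0 by rewrite nsq_eq0.
apply: (mulfI n0); rewrite mulfV// -nsqM mulfV// /nsq /=; ring.
Qed.

Lemma Re_inv a : cRe a^-1 = cRe a / nsq a.
Proof. by case: a => [x y]; rewrite /GRing.inv /=. Qed.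
Lemma Im_inv a : cIm a^-1 = - cIm a / nsq a.
Proof. by case: a => [x y]; rewrite /GRing.inv /= mulNr. Qed.

Lemma complex_eq a b : cRe a = cRe b -> cIm a = cIm b -> a = b.
Proof. by case: a b => [? ?] [? ?] /= -> ->. Qed.

Lemma cdr_eq f t a b : cder f t a -> a = b -> cder f t b.
Proof. by move=> h <-. Qed.

Lemma cdr_uniq f t a b : cder f t a -> cder f t b -> a = b.
Proof. by move=> [h1 h2] [h3 h4]; apply: complex_eq; [exact: dr_uniq h1 h3|exact: dr_uniq h2 h4]. Qed.

Lemma cdr_cst a t : cder (fun=> a) t 0.
Proof. by split; exact: dr_cst. Qed.

Lemma cdr_add f g t a b : cder f t a -> cder g t b -> cder (fun s => f s + g s) t (a + b).
Proof.
move=> [h1 h2] [h3 h4]; split; rewrite ?Re_add ?Im_add.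
  by under [fun _ => _]funext do rewrite Re_add; exact: dr_add.
by under [fun _ => _]funext do rewrite Im_add; exact: dr_add.
Qed.

Lemma cdr_mul f g t a b : cder f t a -> cder g t b -> cder (fun s => f s * g s) t (a * g t + f t * b).
Proof.
move=> [h1 h2] [h3 h4]; split.
  under [fun _ => _]funext do rewrite Re_mul.
  apply: (dr_eq (dr_sub (dr_mul h1 h3) (dr_mul h2 h4))); rewrite Re_add !Re_mul; ring.
under [fun _ => _]funext do rewrite Im_mul.
apply: (dr_eq (dr_add (dr_mul h1 h4) (dr_mul h2 h3))); rewrite Im_add !Im_mul; ring.
Qed.

Lemma cdr_scale c f t a : cder f t a -> cder (fun s => c * f s) t (c * a).
Proof. by move=> h; apply: (cdr_eq (cdr_mul (cdr_cst c t) h)); rewrite mul0r add0r. Qed.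

Lemma cdr_inv f t a : f t != 0 -> cder f t a -> cder (fun s => (f s)^-1) t (- a / f t ^+ 2).
Proof.
move=> f0 [h1 h2]; have N0 : nsq (f t) != 0 by rewrite nsq_eq0.
have dN : der (fun s => nsq (f s)) t (2 * (cRe (f t) * cRe a + cIm (f t) * cIm a)).
  have := dr_add (dr_mul h1 h1) (dr_mul h2 h2).
  by rewrite /nsq => /dr_eq; apply; ring.
have e : nsq (f t) = cRe (f t) ^+ 2 + cIm (f t) ^+ 2 by [].
have N1 : cRe (f t) ^+ 2 + cIm (f t) ^+ 2 != 0 by [].
split.
  under [fun _ => _]funext do rewrite Re_inv.
  apply: (dr_eq (dr_mul h1 (@dr_inv _ (fun s => nsq (f s)) t _ N0 dN))).
  rewrite Re_mul Re_opp Im_opp Re_inv Im_inv expr2 nsqM Re_mul Im_mul e.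
  move: (cRe a) (cIm a) (cRe (f t)) (cIm (f t)) N1 => x y u v N1.
  by field.
under [fun _ => _]funext do rewrite Im_inv.
apply: (dr_eq (dr_mul (dr_opp h2) (@dr_inv _ (fun s => nsq (f s)) t _ N0 dN))).
rewrite Im_mul Re_opp Im_opp Re_inv Im_inv expr2 nsqM Re_mul Im_mul e.
move: (cRe a) (cIm a) (cRe (f t)) (cIm (f t)) N1 => x y u v N1.
by field.
Qed.

End cder.

(** * Holomorphic functions of the coordinate [G] *)

Section hol.
Variables (R : realType) (S : orientedSurface R) (G : S -> R[i]).
Let X p := cRe (G p).
Let Y p := cIm (G p).
Hypotheses (sX : smooth_map X) (sY : smooth_map Y).
Hypothesis et : forall p, J (chart_at p) X Y p != 0.
Implicit Types (p q : S) (h k : S -> R[i]).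

Definition csmooth h := smooth_map (reC h) /\ smooth_map (imC h).

(** For [h] satisfying the Cauchy-Riemann equations of [hol], this is the complex derivative of [h]
    with respect to the local coordinate [G]. *)
Definition dG h p : R[i] := D1 X Y (reC h) p +i* D1 X Y (imC h) p.

Definition hol h := [/\ csmooth h,
  forall p, D2 X Y (reC h) p = - D1 X Y (imC h) p &
  forall p, D2 X Y (imC h) p = D1 X Y (reC h) p].

Lemma hol_cder h (g : R -> S) t a : hol h -> {for t, continuous g} ->
  cder (G \o g) t a -> cder (h \o g) t (a * dG h (g t)).
Proof.
move=> [[s1 s2] e1 e2] cg [d1 d2]; split.
  have := cur_D sX sY et s1 cg d1 d2; move/dr_eq; apply.
  by rewrite e1 Re_mul /= mulrN.
have := cur_D sX sY et s2 cg d1 d2; move/dr_eq; apply.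
by rewrite e2 Im_mul /=.
Qed.

(** Testing the chain rule on the two coordinate lines, where [G] moves with velocity 1 and i, gives
    the Cauchy-Riemann equations. Sums and constants then inherit holomorphy from the rules for
    [cder]. *)
Lemma hol_intro h (d : S -> R[i]) : csmooth h ->
  (forall (g : R -> S) t a, {for t, continuous g} -> cder (G \o g) t a -> cder (h \o g) t (a * d (g t))) ->
  hol h /\ forall p, dG h p = d p.
Proof.
move=> [s1 s2] H.
have key p : [/\ D1 X Y (reC h) p = cRe (d p),
   D1 X Y (imC h) p = cIm (d p),
   D2 X Y (reC h) p = - cIm (d p) &
   D2 X Y (imC h) p = cRe (d p)].
  have [g1 [g2 [[e1 c1 a1 b1] [e2 c2 a2 b2]]]] := lines sX sY et p.
  have [A1 B1] := H g1 0 (1 +i* 0) c1 (conj a1 b1).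
  have [A2 B2] := H g2 0 (0 +i* 1) c2 (conj a2 b2).
  have := dr_uniq (cur_D sX sY et s1 c1 a1 b1) A1.
  have := dr_uniq (cur_D sX sY et s2 c1 a1 b1) B1.
  have := dr_uniq (cur_D sX sY et s1 c2 a2 b2) A2.
  have := dr_uniq (cur_D sX sY et s2 c2 a2 b2) B2.
  rewrite !Re_mul !Im_mul /= e1 e2 => h1 h2 h3 h4; split; lra.
split; first by split => // p; have [E1 E2 E3 E4] := key p; rewrite ?E1 ?E2 ?E3 ?E4.
by move=> p; apply: complex_eq; rewrite /dG /=; have [] := key p.
Qed.

(** The Cauchy-Riemann equations of the derivative are those of [h] differentiated along [X], once
    [D1] and [D2] commute. *)
Lemma hol_dG h : hol h -> hol (dG h).
Proof.
move=> [[s1 s2] e1 e2]; have [s11 s12] := smooth_D sX sY et s1; have [s21 s22] := smooth_D sX sY et s2.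
have f1 : D2 X Y (reC h) = (fun p => - D1 X Y (imC h) p) by apply/funext.
have f2 : D2 X Y (imC h) = D1 X Y (reC h) by apply/funext.
split; first by split.
  move=> p /=; rewrite -(D_comm sX sY et p s1) f1.
  apply: (D_opp sX sY et p s21 _).1.
  by rewrite f1 in s12.
by move=> p /=; rewrite -(D_comm sX sY et p s2) f2.
Qed.

Lemma smooth_lin (a b : R) (f g : S -> R) : smooth_map f -> smooth_map g -> smooth_map (fun p => a * f p + b * g p).
Proof.
move=> sf sg c ac k; have oc := @open_img _ _ c.
exact: (CkD oc (CkM oc (CkC k a oc) (smooth_Ck k sf ac)) (CkM oc (CkC k b oc) (smooth_Ck k sg ac))).
Qed.

Lemma smooth_cst (a : R) : smooth_map (fun _ : S => a).
Proof. by move=> c ac k; have oc := @open_img _ _ c; exact: (CkC k a oc). Qed.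

Lemma csmooth_cst (a : R[i]) : csmooth (fun=> a).
Proof. by split; exact: smooth_cst. Qed.

Lemma csmooth_lin (a b : R[i]) h k : csmooth h -> csmooth k -> csmooth (fun p => a * h p + b * k p).
Proof.
move=> [h1 h2] [k1 k2]; split.
  have := smooth_lin 1 1 (smooth_lin (cRe a) (- cIm a) h1 h2) (smooth_lin (cRe b) (- cIm b) k1 k2).
  by congr smooth_map; apply/funext => p; rewrite Re_add !Re_mul !mul1r !mulNr.
have := smooth_lin 1 1 (smooth_lin (cRe a) (cIm a) h2 h1) (smooth_lin (cRe b) (cIm b) k2 k1).
by congr smooth_map; apply/funext => p; rewrite Im_add !Im_mul !mul1r.
Qed.

Lemma hol_lin (a b : R[i]) h k : hol h -> hol k ->
  hol (fun p => a * h p + b * k p) /\ forall p, dG (fun p => a * h p + b * k p) p = a * dG h p + b * dG k p.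
Proof.
move=> hh hk; apply: (@hol_intro _ (fun p => a * dG h p + b * dG k p)).
  by case: hh => + _ _; case: hk => + _ _; move=> ? ?; exact: csmooth_lin.
move=> g t d cg dg; apply: (cdr_eq (cdr_add (cdr_scale a (hol_cder hh cg dg)) (cdr_scale b (hol_cder hk cg dg)))).
by rewrite /=; ring.
Qed.

Lemma hol_cst (a : R[i]) : hol (fun=> a) /\ forall p, dG (fun=> a) p = 0.
Proof.
apply: (@hol_intro _ (fun=> 0)); first exact: csmooth_cst.
by move=> g t d cg dg; rewrite mulr0; exact: cdr_cst.
Qed.

Lemma hol_G : hol G /\ forall p, dG G p = 1.
Proof.
apply: (@hol_intro _ (fun=> 1)); first by split.
by move=> g t d cg dg; rewrite mulr1.
Qed.

End hol.

(** * Laplacians and the maximum principle *)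

Section jets.
Variable R : realType.
Implicit Types (f g : R -> R).

Definition jet2 f (a b c : R) := exists2 df : R -> R,
  (\forall s \near (0 : R), der f s (df s)) & [/\ f 0 = a, df 0 = b & der df 0 c].

Lemma jet2_cst (k : R) : jet2 (fun=> k) k 0 0.
Proof. exists (fun=> 0); first by apply: filterE => s; exact: dr_cst. by split => //; exact: dr_cst. Qed.

Lemma jet2_add f g a b c a' b' c' : jet2 f a b c -> jet2 g a' b' c' ->
  jet2 (fun s => f s + g s) (a + a') (b + b') (c + c').
Proof.
move=> [df n1 [e1 e2 d1]] [dg n2 [e3 e4 d2]]; exists (fun s => df s + dg s).
  by apply: (filter_app _ _ n2); apply: filterS n1 => s h1 h2; exact: dr_add.
by split; rewrite ?e1 ?e2 ?e3 ?e4//; exact: dr_add.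
Qed.

Lemma jet2_mul f g a b c a' b' c' : jet2 f a b c -> jet2 g a' b' c' ->
  jet2 (fun s => f s * g s) (a * a') (b * a' + a * b') (c * a' + 2 * (b * b') + a * c').
Proof.
move=> [df n1 [e1 e2 d1]] [dg n2 [e3 e4 d2]]; exists (fun s => df s * g s + f s * dg s).
  by apply: (filter_app _ _ n2); apply: filterS n1 => s h1 h2; exact: dr_mul.
have df0 := nbhs_singleton n1; have dg0 := nbhs_singleton n2.
split; rewrite ?e1 ?e2 ?e3 ?e4//.
apply: (dr_eq (dr_add (dr_mul d1 dg0) (dr_mul df0 d2))); rewrite e1 e2 e3 e4; ring.
Qed.

Lemma jet2_ln f a b c : 0 < a -> jet2 f a b c ->
  jet2 (fun s => ln (f s)) (ln a) (b / a) (c / a - (b / a) ^+ 2).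
Proof.
move=> a0 [df n1 [e1 e2 d1]]; exists (fun s => df s / f s).
  have n2 : \forall s \near (0 : R), 0 < f s.
    by apply: (cvgr_gt _ (dr_cont (nbhs_singleton n1))); rewrite e1.
  by apply: (filter_app _ _ n2); apply: filterS n1 => s h1 h2; exact: dr_ln.
have df0 := nbhs_singleton n1.
split; rewrite ?e1 ?e2//.
have f0 : f 0 != 0 by rewrite e1 lt0r_neq0.
apply: (dr_eq (dr_mul d1 (dr_inv f0 df0))); rewrite e1 e2; field; exact: lt0r_neq0.
Qed.

Lemma jet2_exp f a b c : jet2 f a b c ->
  jet2 (fun s => expR (f s)) (expR a) (expR a * b) (expR a * (c + b ^+ 2)).
Proof.
move=> [df n1 [e1 e2 d1]]; exists (fun s => expR (f s) * df s).
  by apply: filterS n1 => s h1; exact: dr_exp.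
have df0 := nbhs_singleton n1.
split; rewrite ?e1 ?e2//.
apply: (dr_eq (dr_mul (dr_exp df0) d1)); rewrite e1 e2; ring.
Qed.

Lemma jet2_max f a b c : jet2 f a b c -> (\forall s \near (0 : R), f s <= f 0) -> c <= 0.
Proof. by move=> [df n1 [e1 e2 d1]] fm; exact: (dr2_max n1 d1 fm). Qed.

Variables (T : Type) (g1 g2 : R -> T) (q : T).
Implicit Types U W : T -> R.

(* [lap U b1 b2 l]: along the coordinate lines [g1], [g2] through [q], the gradient
   of [U] is [(b1, b2)] and its Laplacian is [l]. *)
Definition lap U (b1 b2 l : R) := exists c1 c2,
  [/\ jet2 (U \o g1) (U q) b1 c1, jet2 (U \o g2) (U q) b2 c2 & l = c1 + c2].

Lemma lap_eq U b1 b2 l b1' b2' l' : lap U b1 b2 l -> b1 = b1' -> b2 = b2' -> l = l' -> lap U b1' b2' l'.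
Proof. by move=> h <- <- <-. Qed.

Lemma lap_cst k : lap (fun=> k) 0 0 0.
Proof. by exists 0, 0; split; rewrite ?addr0//; exact: jet2_cst. Qed.

Lemma lap_add U W b1 b2 l b1' b2' l' : lap U b1 b2 l -> lap W b1' b2' l' ->
  lap (fun x => U x + W x) (b1 + b1') (b2 + b2') (l + l').
Proof.
move=> [c1 [c2 [h1 h2 ->]]] [c1' [c2' [h1' h2' ->]]].
by exists (c1 + c1'), (c2 + c2'); split; [exact: jet2_add|exact: jet2_add|ring].
Qed.

Lemma lap_mul U W b1 b2 l b1' b2' l' : lap U b1 b2 l -> lap W b1' b2' l' ->
  lap (fun x => U x * W x) (b1 * W q + U q * b1') (b2 * W q + U q * b2')
    (l * W q + 2 * (b1 * b1' + b2 * b2') + U q * l').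
Proof.
move=> [c1 [c2 [h1 h2 ->]]] [c1' [c2' [h1' h2' ->]]].
by do 2 eexists; split; [exact: jet2_mul h1 h1'|exact: jet2_mul h2 h2'|ring].
Qed.

Lemma lap_scale k U b1 b2 l : lap U b1 b2 l -> lap (fun x => k * U x) (k * b1) (k * b2) (k * l).
Proof. by move=> h; apply: (lap_eq (lap_mul (lap_cst k) h)); ring. Qed.

Lemma lap_ln U b1 b2 l : 0 < U q -> lap U b1 b2 l ->
  lap (fun x => ln (U x)) (b1 / U q) (b2 / U q) (l / U q - (b1 ^+ 2 + b2 ^+ 2) / U q ^+ 2).
Proof.
move=> U0 [c1 [c2 [h1 h2 ->]]]; do 2 eexists; split; [exact: jet2_ln h1|exact: jet2_ln h2|].
by field; exact: lt0r_neq0.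
Qed.

Lemma lap_exp U b1 b2 l : lap U b1 b2 l ->
  lap (fun x => expR (U x)) (expR (U q) * b1) (expR (U q) * b2) (expR (U q) * (l + (b1 ^+ 2 + b2 ^+ 2))).
Proof.
move=> [c1 [c2 [h1 h2 ->]]]; do 2 eexists; split; [exact: jet2_exp h1|exact: jet2_exp h2|].
by ring.
Qed.

Lemma lap_max U b1 b2 l : g1 0 = q -> g2 0 = q -> lap U b1 b2 l ->
  (\forall s \near (0 : R), U (g1 s) <= U q) -> (\forall s \near (0 : R), U (g2 s) <= U q) -> l <= 0.
Proof.
move=> e1 e2 [c1 [c2 [h1 h2 ->]]] n1 n2.
have k1 : c1 <= 0 by apply: (jet2_max h1); rewrite /= e1.
have k2 : c2 <= 0 by apply: (jet2_max h2); rewrite /= e2.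
lra.
Qed.

End jets.

Section lap_hol.
Variables (R : realType) (S : orientedSurface R) (G : S -> R[i]).
Let X p := cRe (G p).
Let Y p := cIm (G p).
Hypotheses (sX : smooth_map X) (sY : smooth_map Y).
Hypothesis et : forall p, J (chart_at p) X Y p != 0.
Variables (g1 g2 : R -> S) (q : S).
Hypotheses (g1q : g1 0 = q) (g2q : g2 0 = q).
Hypothesis g1P : \forall s \near (0 : R), {for s, continuous g1} /\ cder (G \o g1) s 1.
Hypothesis g2P : \forall s \near (0 : R), {for s, continuous g2} /\ cder (G \o g2) s (0 +i* 1).
Local Notation dG := (dG G).

(** Moving in the direction i multiplies derivatives by i, so the second derivatives along the two
    lines are opposite and both parts are harmonic. *)
Lemma lap_Re_Im h : hol G h ->
  lap g1 g2 q (reC h) (cRe (dG h q)) (- cIm (dG h q)) 0 /\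
  lap g1 g2 q (imC h) (cIm (dG h q)) (cRe (dG h q)) 0.
Proof.
move=> hh; have hd := hol_dG sX sY et hh.
have [c1 a1] := nbhs_singleton g1P; have [c2 a2] := nbhs_singleton g2P.
have [A1 B1] := hol_cder sX sY et hd c1 a1; have [A2 B2] := hol_cder sX sY et hd c2 a2.
rewrite g1q mul1r in A1 B1; rewrite g2q in A2 B2.
rewrite Re_mul /= in A2; rewrite Im_mul /= in B2.
split.
  exists (cRe (dG (dG h) q)), (- cRe (dG (dG h) q)); split; last by rewrite subrr.
    exists (fun s => cRe (dG h (g1 s))); last by split; rewrite /= ?g1q.
    apply: filterS g1P => s [cs ds]; have [A _] := hol_cder sX sY et hh cs ds.
    by move: A; rewrite mul1r.
  exists (fun s => - cIm (dG h (g2 s))).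
    apply: filterS g2P => s [cs ds]; have [A _] := hol_cder sX sY et hh cs ds.
    by move: A => /dr_eq; apply; rewrite Re_mul /=; ring.
  split; rewrite /= ?g2q//; apply: (dr_eq (dr_opp B2)); ring.
exists (cIm (dG (dG h) q)), (- cIm (dG (dG h) q)); split; last by rewrite subrr.
  exists (fun s => cIm (dG h (g1 s))); last by split; rewrite /= ?g1q.
  apply: filterS g1P => s [cs ds]; have [_ B] := hol_cder sX sY et hh cs ds.
  by move: B; rewrite mul1r.
exists (fun s => cRe (dG h (g2 s))).
  apply: filterS g2P => s [cs ds]; have [_ B] := hol_cder sX sY et hh cs ds.
  by move: B => /dr_eq; apply; rewrite Im_mul /=; ring.
split; rewrite /= ?g2q//; apply: (dr_eq A2); ring.
Qed.

(** The squared length of the gradient is recorded because it is the correction term in the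
    Laplacian of a logarithm or an exponential. *)
Lemma lap_nsq h : hol G h -> exists b1 b2,
  lap g1 g2 q (fun p => nsq (h p)) b1 b2 (4 * nsq (dG h q)) /\ b1 ^+ 2 + b2 ^+ 2 = 4 * nsq (h q) * nsq (dG h q).
Proof.
move=> hh; have [l1 l2] := lap_Re_Im hh.
do 2 eexists; split.
  have Q := lap_add (lap_mul l1 l1) (lap_mul l2 l2).
  by apply: (lap_eq Q); [reflexivity|reflexivity|rewrite /nsq; ring].
rewrite /nsq; ring.
Qed.

Lemma lap_ln_nsq h : hol G h -> h q != 0 -> exists b1 b2,
  lap g1 g2 q (fun p => ln (nsq (h p))) b1 b2 0 /\ b1 ^+ 2 + b2 ^+ 2 = 4 * nsq (dG h q) / nsq (h q).
Proof.
move=> hh h0; have [b1 [b2 [l E]]] := lap_nsq hh.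
have n0 : 0 < nsq (h q) by rewrite nsq_gt0.
have n1 := lt0r_neq0 n0.
exists (b1 / nsq (h q)), (b2 / nsq (h q)); split.
  by apply: (lap_eq (lap_ln n0 l)) => //; rewrite E; field.
by rewrite !expr_div_n -mulrDl E; field.
Qed.

(* [(1 + |h|^(1/4)) / |h|^(7/4)] is the density of a negatively curved metric with
   a puncture at the zero of [h]; this is the Laplacian of its logarithm. *)
Lemma lap_theta h : hol G h -> h q != 0 -> exists b1 b2,
  lap g1 g2 q (fun p => ln (1 + expR (8^-1 * ln (nsq (h p)))) + (- (7 / 8)) * ln (nsq (h p))) b1 b2
   (nsq (dG h q) / 16 * (expR (8^-1 * ln (nsq (h q))) / nsq (h q) / (1 + expR (8^-1 * ln (nsq (h q)))) ^+ 2)).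
Proof.
move=> hh h0; have [b1 [b2 [l E]]] := lap_ln_nsq hh h0.
have n0 : 0 < nsq (h q) by rewrite nsq_gt0.
have n1 := lt0r_neq0 n0.
(* The function [ln |h|^2] is harmonic, so the term with factor [- (7 / 8)] adds nothing and the
   Laplacian of [|h|^(1/4)] comes from the gradient term alone. The factor [8^-1] is 1/4 halved,
   [nsq] being a squared modulus. *)
have le := lap_exp (lap_scale 8^-1 l).
set e := expR _ in le *; have e0 : 0 < e by exact: expR_gt0.
have e1 : 0 < 1 + e by rewrite addr_gt0.
have lln := @lap_ln _ _ g1 g2 q (fun p => 1 + expR (8^-1 * ln (nsq (h p)))) _ _ _ e1 (lap_add (lap_cst g1 g2 q 1) le).
have Q := lap_add lln (lap_scale (- (7 / 8)) l).
do 2 eexists; apply: (lap_eq Q); [reflexivity|reflexivity|].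
rewrite -/e; have -> : (8^-1 * b1) ^+ 2 + (8^-1 * b2) ^+ 2 = nsq (dG h q) / 16 / nsq (h q).
  by rewrite !exprMn -mulrDr E; field.
have -> : (0 + e * (8^-1 * b1)) ^+ 2 + (0 + e * (8^-1 * b2)) ^+ 2 = e ^+ 2 * (nsq (dG h q) / 16 / nsq (h q)).
  rewrite !add0r !exprMn -!mulrDr E; field; exact: n1.
have e2 := lt0r_neq0 e1; field; by rewrite n1 e2.
Qed.

End lap_hol.

(** * A C^1 step function for reparametrizing curves *)

Section step.
Variable R : realType.

Lemma dr_quad (f : R -> R) t d : (forall h, `|f (t + h) - f t - d * h| <= h ^+ 2) -> der f t d.
Proof.
move=> H; apply/der_cvgP; apply/cvgrPdist_le => e e0.
have : \forall h \near (0 : R)^', `|h| < e /\ h != 0.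
  by exists e => //= h; rewrite /ball_ /= sub0r normrN => he h0; split.
apply: filterS => h [he h0].
have -> : d - h^-1 * (f (t + h) - f t) = - (h^-1 * (f (t + h) - f t - d * h)) by field.
rewrite normrN normrM normfV ler_pdivrMl ?normr_gt0//.
apply: (le_trans (H h)); rewrite -real_normK ?num_real// expr2 ler_pM2l ?normr_gt0//; exact: ltW.
Qed.

Definition pos2 (u : R) : R := Num.max 0 u ^+ 2.

Lemma dr_pos2 u : der pos2 u (2 * Num.max 0 u).
Proof.
apply: dr_quad => h; rewrite /pos2 ler_norml.
have mx (x : R) : (0 <= x /\ Num.max 0 x = x) \/ (x < 0 /\ Num.max 0 x = 0).
  have [x0|x0] := leP 0 x; [left|right]; split => //.
by case: (mx u) => -[u0 ->]; case: (mx (u + h)) => -[v0 ->]; apply/andP; split; nra.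
Qed.

(** A second difference of the C^1 function [pos2]: the piecewise quadratic transition from 0 to 1
    on the unit interval, with zero slope at both ends. *)
Definition step (u : R) : R := 2 * (pos2 u - 2 * pos2 (u - 2^-1) + pos2 (u - 1)).
Definition dstep (u : R) : R := 2 * (2 * Num.max 0 u - 2 * (2 * Num.max 0 (u - 2^-1)) + 2 * Num.max 0 (u - 1)).

Lemma dr_step u : der step u (dstep u).
Proof.
have sh (a : R) : der (fun u => pos2 (u - a)) u (2 * Num.max 0 (u - a)).
  have := dr_comp (dr_sub (dr_id u) (dr_cst a u)) (dr_pos2 (u - a)).
  by move/dr_eq; apply; rewrite subr0 mulr1.
exact: (dr_scale 2 (dr_add (dr_sub (dr_pos2 u) (dr_scale 2 (sh 2^-1))) (sh 1))).
Qed.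

Lemma max0P (x : R) : (0 <= x /\ Num.max 0 x = x) \/ (x < 0 /\ Num.max 0 x = 0).
Proof. by have [x0|x0] := leP 0 x; [left|right]; split. Qed.

Lemma step0 u : u <= 0 -> step u = 0.
Proof.
rewrite /step /pos2; case: (max0P u) => -[? ->]; case: (max0P (u - 2^-1)) => -[? ->];
  case: (max0P (u - 1)) => -[? ->]; nra.
Qed.

Lemma step1 u : 1 <= u -> step u = 1.
Proof.
rewrite /step /pos2; case: (max0P u) => -[? ->]; case: (max0P (u - 2^-1)) => -[? ->];
  case: (max0P (u - 1)) => -[? ->]; nra.
Qed.

Lemma step_itv u : 0 <= step u <= 1.
Proof.
rewrite /step /pos2; case: (max0P u) => -[? ->]; case: (max0P (u - 2^-1)) => -[? ->];
  case: (max0P (u - 1)) => -[? ->]; apply/andP; split; nra.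
Qed.

Lemma dstep_ge0 u : 0 <= dstep u.
Proof.
rewrite /dstep; case: (max0P u) => -[? ->]; case: (max0P (u - 2^-1)) => -[? ->];
  case: (max0P (u - 1)) => -[? ->]; lra.
Qed.

Lemma dstep_cont : continuous dstep.
Proof.
have mc (a : R) : continuous (fun u : R => Num.max 0 (u - a)).
  move=> u; apply: (@continuous_max _ _ (fun=> 0) (fun u => u - a)); first exact: cvg_cst.
  by apply: cvgB; [exact: cvg_id|exact: cvg_cst].
have mc0 : continuous (fun u : R => Num.max 0 u).
  by move=> u; have := mc 0 u; under [X in {for _, continuous X} -> _]funext do rewrite subr0.
move=> u.
have c2 (f : R -> R) : {for u, continuous f} -> {for u, continuous (fun x => 2 * f x)}.
  by move=> cf; exact: (cvgM (cvg_cst (2 : R)) cf).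
apply: (c2); apply: cvgD; last by apply: c2; exact: mc.
apply: cvgB; first by apply: c2; exact: mc0.
by apply: (c2); apply: c2; exact: mc.
Qed.

End step.

(** * C^1 curves on the surface and their velocities *)

Section curves.
Variables (R : realType) (S : orientedSurface R).
Local Notation V := 'rV[R]_2.
Implicit Types (g : R -> S).

(** A pointwise form of [C1_curve] that depends only on the germ of [g] at [t], so that it can be
    checked piece by piece on a glued curve. Continuity of the derivatives is asked at [t] only, and
    holds everywhere once the condition does. *)
Definition C1at g (t : R) := {for t, continuous g} /\
  forall c, atlas c -> cdom c (g t) -> exists d0 d1 : R -> R,
   [/\ \forall s \near t, der (fun u => cmap c (g u) 0 0) s (d0 s) /\ der (fun u => cmap c (g u) 0 1) s (d1 s),
    {for t, continuous d0} & {for t, continuous d1}].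

Lemma near_near (P : R -> Prop) (t : R) : (\forall s \near t, P s) -> \forall s \near t, \forall u \near s, P u.
Proof.
move=> h; have : nbhs t ([set x | P x]^°) by exact: nbhs_interior.
by apply: filterS => s; rewrite /interior.
Qed.

Lemma cont_near (T U : topologicalType) (f h : T -> U) (t : T) : (\forall s \near t, f s = h s) ->
  {for t, continuous f} -> {for t, continuous h}.
Proof.
move=> E cf; have Et := nbhs_singleton E.
by move: cf; rewrite /prop_for /continuous_at Et; apply: cvg_trans; exact: near_eq_cvg.
Qed.

Lemma C1at_near g g' t : (\forall s \near t, g s = g' s) -> C1at g t -> C1at g' t.
Proof.
move=> E [cg H]; have Et := nbhs_singleton E; split.
  move: cg; rewrite /prop_for /continuous_at Et; apply: cvg_trans; exact: near_eq_cvg.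
move=> c ac gc; rewrite -Et in gc; have [d0 [d1 [n c0 c1]]] := H c ac gc.
exists d0, d1; split => //.
apply: (filter_app _ _ n); apply: filterS (near_near E) => s Es [h1 h2].
by split; [apply: dr_near h1|apply: dr_near h2]; apply: filterS Es => u ->.
Qed.

Lemma der_row (ga : R -> V) s (d0 d1 : R) : der (fun u => ga u 0 0) s d0 -> der (fun u => ga u 0 1) s d1 ->
  is_derive s (1 : R) ga (d0 *: ev R 0 + d1 *: ev R 1).
Proof.
move=> h0 h1.
have E : ga = (fun u => ga u 0 0 *: ev R 0) + (fun u => ga u 0 1 *: ev R 1).
  by apply/funext => u; rewrite /= {1}[ga u]rV2_ev.
have k (f : R -> R) (d : R) (v : V) : der f s d -> is_derive s (1 : R) (fun u => f u *: v) (d *: v).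
  move=> [df <-].
  have df' : differentiable f s by exact/derivable1_diffP.
  apply: DeriveDef; first exact/derivable1_diffP/differentiableZl.
  rewrite deriveE; last exact: differentiableZl.
  by rewrite diffZl//= -deriveE.
rewrite E; apply: is_deriveD; exact: k.
Qed.

Lemma C1at_curve g : (forall t, C1at g t) -> C1_curve g.
Proof.
move=> H; split; first by move=> t; have [] := H t.
move=> c ac; split.
  move=> t gc; have [_ h] := H t; have [d0 [d1 [n _ _]]] := h c ac gc.
  have [h0 h1] := nbhs_singleton n.
  by apply/derivable1_diffP; have [] := @der_row (cmap c \o g) t _ _ h0 h1.
move=> v t gc; have [_ h] := H t; have [d0 [d1 [n c0 c1]]] := h c ac gc.
have E : \forall s \near t, v *: (d0 s *: ev R 0 + d1 s *: ev R 1) = 'd (cmap c \o g) s v.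
  apply: filterS n => s [h0 h1]; have [hd hv] := @der_row (cmap c \o g) s _ _ h0 h1.
  have hd' : differentiable (cmap c \o g) s by exact/derivable1_diffP.
  by rewrite diff1E// derive1E hv.
have Q : {for t, continuous (fun s => v *: (d0 s *: ev R 0 + d1 s *: ev R 1) : V)}.
  by apply: cvgZr; apply: cvgD; apply: cvgZl.
exact (cont_near E Q).
Qed.

Lemma vel_der (f : S -> R) g t : smooth_map f -> C1_curve g -> der (f \o g) t (tdiff f (g t) (velocity g t)).
Proof.
move=> sf [cg H]; set c := chart_at (g t).
have gc : cdom c (g t) by exact: chart_at_dom.
have [h _] := H c (chart_at_atlas _).
have dg : differentiable (cmap c \o g) t by exact: h.
have dg' : is_derive t (1 : R) (cmap c \o g) (velocity g t).
  by apply: DeriveDef; [exact/derivable1_diffP|rewrite /velocity derive1E].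
have df : differentiable (loc c f) ((cmap c \o g) t).
  by apply: (C1_diff (smooth_Ck 1 sf (chart_at_atlas _))); exact: img_cmap.
have Q := is_derive_comp_diff df dg'.
have nd : \forall s \near t, cdom c (g s) by exact: (cg t _ (near_cdom gc)).
apply: (@dr_near _ (loc c f \o (cmap c \o g))).
  by apply: filterS nd => s sc; rewrite /loc /= cmapK.
exact Q.
Qed.

(** The chart in which [velocity g s] is written changes with [s]. The value of the differential of
    [f] on it is the derivative of [f \o g], whatever the chart, so it can be computed near [t] in
    the single chart [chart_at (g t)]. *)
Lemma vel_cont (f : S -> R) g : smooth_map f -> C1_curve g ->
  continuous (fun t => tdiff f (g t) (velocity g t)).
Proof.
move=> sf Cg t; have [cg H] := Cg; set c := chart_at (g t).
have gc : cdom c (g t) by exact: chart_at_dom.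
have [h1 h2] := H c (chart_at_atlas _).
have nd : \forall s \near t, cdom c (g s) by exact: (cg t _ (near_cdom gc)).
pose w s : V := 'd (cmap c \o g) s 1.
have cw : {for t, continuous w} by exact: (h2 1 t gc).
have cgc : {for t, continuous (cmap c \o g)} by exact: (@continuous_comp _ _ _ g (cmap c) t (cg t) (cmap_cont gc)).
have E : \forall s \near t, pd false (loc c f) (cmap c (g s)) * w s 0 0 + pd true (loc c f) (cmap c (g s)) * w s 0 1
    = tdiff f (g s) (velocity g s).
  have nn := near_near nd.
  apply: (filter_app _ _ nn); apply: filterS nd => s sc ns.
  apply: (dr_uniq _ (vel_der s sf Cg)).
  have dg : differentiable (cmap c \o g) s by exact: h1.
  have dg' : is_derive s (1 : R) (cmap c \o g) (w s).
    by apply: DeriveDef; [exact/derivable1_diffP|rewrite deriveE].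
  have df : differentiable (loc c f) ((cmap c \o g) s).
    by apply: (C1_diff (smooth_Ck 1 sf (chart_at_atlas _))); exact: img_cmap.
  have Q := is_derive_comp_diff df dg'; rewrite diffE2 in Q.
  apply: (@dr_near _ (loc c f \o (cmap c \o g))); last exact Q.
  by apply: filterS ns => u uc; rewrite /loc /= cmapK.
have Et := nbhs_singleton E.
rewrite /continuous_at -Et; apply: cvg_trans; first exact: (near_eq_cvg E).
have cp b : pd b (loc c f) (cmap c (g s)) @[s --> t] --> pd b (loc c f) (cmap c (g t)).
  apply: (@cvg_comp _ _ _ (cmap c \o g) (pd b (loc c f)) _ _ _ cgc).
  by apply: (C1_pd_cont (smooth_Ck 1 sf (chart_at_atlas _))); exact: img_cmap.
have cw' k : w s 0 k @[s --> t] --> w t 0 k.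
  exact: (@cvg_comp _ _ _ w (fun x : V => x 0 k) _ _ _ cw (@coord_continuous _ _ _ 0 k (w t))).
exact: (cvgD (cvgM (cp false) (cw' 0)) (cvgM (cp true) (cw' 1))).
Qed.

End curves.

(** * Bounds on integrals of speeds *)

Section integrals.
Variable R : realType.
Local Notation mu := (@lebesgue_measure R).

Lemma FTC_der (F f : R -> R) (a b : R) : a < b -> (forall t, der F t (f t)) -> continuous f ->
  (\int[mu]_(x in `[a, b]) (f x)%:E = (F b - F a)%:E)%E.
Proof.
move=> ab dF cf; rewrite EFinB; apply: continuous_FTC2 => //.
- exact: continuous_subspaceT.
- have cF : continuous F by move=> t; exact: dr_cont (dF t).
  split; first by move=> t _; exact: dr_derivable (dF t).
    exact: (cvg_at_right_filter (cF a)).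
  exact: (cvg_at_left_filter (cF b)).
- by move=> t _; rewrite derive1E; have [_ ->] := dF t.
Qed.

Lemma len_upper (s L ds : R -> R) : (forall t, der L t (ds t)) -> continuous ds -> continuous s ->
  (forall t, 0 <= s t <= ds t) -> (\int[mu]_(x in `[0%R, 1%R]) (s x)%:E <= (L 1 - L 0)%:E)%E.
Proof.
move=> dL cds cs h; rewrite -(FTC_der ltr01 dL cds).
apply: ge0_le_integral => //=.
- by move=> x _; rewrite lee_fin; case/andP: (h x).
- by apply/measurable_EFinP; apply: measurable_funTS; exact: continuous_measurable_fun.
- by apply/measurable_EFinP; apply: measurable_funTS; exact: continuous_measurable_fun.
- by move=> x _; rewrite lee_fin; case/andP: (h x).
Qed.

Lemma len_lower (s F f : R -> R) (r : R) : (forall t, der F t (f t)) -> continuous f -> continuous s ->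
  (forall t, `|f t| <= s t) -> (\int[mu]_(x in `[0%R, 1%R]) (s x)%:E < r%:E)%E ->
  forall t, 0 <= t <= 1 -> `|F t - F 1| < r.
Proof.
move=> dF cf cs fs lr t /andP[t0 t1].
have s0 x : 0 <= s x by apply: le_trans (fs x).
have r0 : 0 < r.
  rewrite -lte_fin; apply: le_lt_trans lr; apply: integral_ge0 => x _; rewrite lee_fin//.
move: t1; rewrite le_eqVlt => /orP[/eqP ->|t1]; first by rewrite subrr normr0.
rewrite -lte_fin; apply: le_lt_trans lr.
rewrite distrC -abse_EFin -(FTC_der t1 dF cf).
have mt : measurable (`[t, 1] : set R) by [].
apply: (@le_trans _ _ (\int[mu]_(x in `[t, 1%R]) `|(f x)%:E|)%E).
  apply: le_abse_integral => //; by apply/measurable_EFinP; apply: measurable_funTS; exact: continuous_measurable_fun.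
apply: (@le_trans _ _ (\int[mu]_(x in `[t, 1%R]) (s x)%:E)%E).
  apply: ge0_le_integral => //=.
  - apply/measurable_EFinP; apply: measurable_funTS; apply: continuous_measurable_fun.
    by move=> x; exact: (cvg_norm (cf x)).
  - by apply/measurable_EFinP; apply: measurable_funTS; exact: continuous_measurable_fun.
  - by move=> x _; rewrite lee_fin.
apply: ge0_subset_integral => //=.
- by apply/measurable_EFinP; apply: measurable_funTS; exact: continuous_measurable_fun.
- by move=> x _; rewrite lee_fin.
- by move=> x /=; rewrite !in_itv /= => /andP[h1 h2]; rewrite h2 (le_trans t0 h1).
Qed.

End integrals.

(** * Uniqueness of lifts of curves *)

Section lift_uniq.
Variables (R : realType) (S : orientedSurface R).
Implicit Types (X Y : S -> R) (g : R -> S).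

(** The set where the two lifts agree is open by local injectivity of [(X, Y)] along [g1], closed
    because the surface is Hausdorff, and contains 0. *)
Lemma lift_uniq X Y g1 g2 : smooth_map X -> smooth_map Y -> continuous g1 -> continuous g2 ->
  (forall t, J (chart_at (g1 t)) X Y (g1 t) != 0) ->
  (forall t, X (g1 t) = X (g2 t)) -> (forall t, Y (g1 t) = Y (g2 t)) ->
  g1 0 = g2 0 -> forall t, g1 t = g2 t.
Proof.
move=> sX sY c1 c2 et eX eY e0.
suff : [set t | g1 t = g2 t] = setT by move=> E t; have : [set t | g1 t = g2 t] t by rewrite E.
have cR : connected [set: R] by apply/connected_intervalP.
apply: cR; first by exists 0.
- exists [set t | g1 t = g2 t]; last by rewrite setTI.
  rewrite openE => t /= E.
  have [_ [_ [_ _ _ _ [B nB Binj]]]] := loc_inverse (chart_at_atlas _) (chart_at_dom (g1 t)) sX sY (et t) filterT.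
  have n1 : \forall s \near t, B (g1 s) by exact: (c1 t _ nB).
  have n2 : \forall s \near t, B (g2 s) by rewrite E in nB; exact: (c2 t _ nB).
  apply: (filter_app _ _ n2); apply: filterS n1 => s b1 b2; apply: Binj => //; by rewrite inE.
- exists [set t | g1 t = g2 t]; last by rewrite setTI.
  move=> t /= tcl; apply: (@surface_hausdorff _ S) => A B nA nB.
  have [s [/= Es [As Bs]]] : [set t | g1 t = g2 t] `&` (g1 @^-1` A `&` g2 @^-1` B) !=set0.
    by apply: tcl; apply: filterI; [exact: (c1 t _ nA)|exact: (c2 t _ nB)].
  by exists (g1 s); split => //; rewrite Es.
Qed.

(** The retraction of the line onto [0, 1]; composing with it turns data known only on [0, 1] into
    curves on the whole line. *)
Definition clamp (t : R) : R := Num.max 0 (Num.min 1 t).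

Lemma clamp_itv t : 0 <= clamp t <= 1.
Proof. by rewrite /clamp le_max lexx /= ge_max ler01 ge_min lexx. Qed.

Lemma clampE t : 0 <= t <= 1 -> clamp t = t.
Proof. by move=> /andP[h0 h1]; rewrite /clamp (min_idPr h1) (max_idPr h0). Qed.

Lemma clamp_cont : continuous clamp.
Proof.
move=> t.
have h : {for t, continuous (fun s : R => Num.min 1 s)}.
  by apply: (@continuous_min _ _ (fun _ : R => 1 : R) (fun s : R => s)); [exact: cvg_cst|exact: cvg_id].
have k : {for t, continuous (fun s : R => Num.max 0 (Num.min 1 s))}.
  by apply: (@continuous_max _ _ (fun _ : R => 0 : R) (fun s : R => Num.min 1 s)); [exact: cvg_cst|].
exact: k.
Qed.

Lemma lift_uniq01 X Y g1 g2 : smooth_map X -> smooth_map Y ->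
  (forall t, 0 <= t <= 1 -> [/\ {for t, continuous g1}, {for t, continuous g2},
     J (chart_at (g1 t)) X Y (g1 t) != 0, X (g1 t) = X (g2 t) & Y (g1 t) = Y (g2 t)]) ->
  g1 0 = g2 0 -> g1 1 = g2 1.
Proof.
move=> sX sY H e0; have ci := clamp_itv.
have cc g : (forall t, 0 <= t <= 1 -> {for t, continuous g}) -> continuous (g \o clamp).
  move=> h t; exact: (@continuous_comp _ _ _ clamp g t (@clamp_cont t) (h _ (ci t))).
have := @lift_uniq X Y (g1 \o clamp) (g2 \o clamp) sX sY.
have [c0 c1] : clamp 0 = 0 /\ clamp 1 = 1 by rewrite !clampE ?lexx ?ler01.
move=> /(_ _ _ _ _ _ _ 1) /=; rewrite c0 c1; apply => //.
- by apply: cc => t /H[].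
- by apply: cc => t /H[].
- by move=> t; have [] := H _ (ci t).
- by move=> t; have [] := H _ (ci t).
- by move=> t; have [] := H _ (ci t).
Qed.

End lift_uniq.

(** * Lengths and completeness *)

Section metric.
Variables (R : realType) (S : orientedSurface R) (psi : improperAffineFront S).
Variables (F G : S -> R[i]).
Hypotheses (sF : csmooth F) (sG : csmooth G).
Hypothesis metricE : forall p v, dtau2 psi p v = 2 * (nsq (cdiff F p v) + nsq (cdiff G p v)).
Local Notation V := 'rV[R]_2.

Lemma cdiff_der h (g : R -> S) t : csmooth h -> C1_curve g -> cder (h \o g) t (cdiff h (g t) (velocity g t)).
Proof. by move=> [s1 s2] Cg; split; exact: vel_der. Qed.

Lemma nsq_cdiff_cont h (g : R -> S) : csmooth h -> C1_curve g ->
  continuous (fun t => nsq (cdiff h (g t) (velocity g t))).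
Proof.
move=> [s1 s2] Cg t; have c1 := vel_cont s1 Cg (x := t); have c2 := vel_cont s2 Cg (x := t).
exact: (cvgD (cvgM c1 c1) (cvgM c2 c2)).
Qed.

Lemma speed_cont g : C1_curve g -> continuous (fun t => Num.sqrt (dtau2 psi (g t) (velocity g t))).
Proof.
move=> Cg t; have c1 := nsq_cdiff_cont sF Cg (x := t); have c2 := nsq_cdiff_cont sG Cg (x := t).
have c3 : {for t, continuous (fun t => 2 * (nsq (cdiff F (g t) (velocity g t)) + nsq (cdiff G (g t) (velocity g t))))}.
  exact: (cvgM (cvg_cst (2 : R)) (cvgD c1 c2)).
under [fun _ => _]funext do rewrite metricE.
exact: (@continuous_comp _ _ _ _ (@Num.sqrt R) t c3 (@sqrt_continuous R _)).
Qed.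

(** The infimum provides a curve of length below [r]. The derivatives of both coordinates of [G]
    along it are bounded by its speed, hence the coordinates stay within [r] of their final
    values. *)
Lemma dist_curve p q (r : R) : (riemannian_dist psi p q < r%:E)%E -> exists g : R -> S,
  [/\ C1_curve g, g 0 = p, g 1 = q & forall t, 0 <= t <= 1 ->
    `|cRe (G (g t)) - cRe (G q)| < r /\ `|cIm (G (g t)) - cIm (G q)| < r].
Proof.
move=> /ereal_inf_lt[_ [g /= [Cg g0 g1] <-] lr]; exists g; split => //.
have [s1 s2] := sG; have cs := speed_cont Cg.
have le1 (a b c : R) : 0 <= c -> a ^+ 2 <= 2 * (c + (a ^+ 2 + b ^+ 2)).
  by move=> c0; have := sqr_ge0 a; have := sqr_ge0 b; lra.
have k1 t : `|tdiff (reC G) (g t) (velocity g t)| <= Num.sqrt (dtau2 psi (g t) (velocity g t)).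
  rewrite -sqrtr_sqr; apply: ler_wsqrtr; rewrite metricE {2}/nsq /=.
  by apply: le1; exact: nsq_ge0.
have k2 t : `|tdiff (imC G) (g t) (velocity g t)| <= Num.sqrt (dtau2 psi (g t) (velocity g t)).
  rewrite -sqrtr_sqr; apply: ler_wsqrtr; rewrite metricE {2}/nsq /= [X in _ + X]addrC.
  by apply: le1; exact: nsq_ge0.
move=> t t01; rewrite -g1; split.
  exact: (@len_lower R _ (fun t => cRe (G (g t))) _ r (fun t => vel_der t s1 Cg) (vel_cont s1 Cg) cs k1 lr t t01).
exact: (@len_lower R _ (fun t => cIm (G (g t))) _ r (fun t => vel_der t s2 Cg) (vel_cont s2 Cg) cs k2 lr t t01).
Qed.

(* A curve constant near both ends, so that curves can be concatenated and remain
   C^1; [L] is a primitive of a bound [dL] of its speed. *)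
Definition joined p q (l : R) := exists (g : R -> S) (L dL : R -> R) (e : R),
  [/\ 0 < e, forall t, t <= e -> g t = p /\ L t = 0,
    forall t, 1 - e <= t -> g t = q /\ L t = L 1, forall t, C1at g t &
  [/\ forall t, der L t (dL t), continuous dL, forall t, 0 <= dL t, L 1 <= l &
    forall t, exists a b, [/\ cder (F \o g) t a, cder (G \o g) t b & 2 * (nsq a + nsq b) <= dL t ^+ 2]]].

Lemma joined_weaken p q l l' : joined p q l -> l <= l' -> joined p q l'.
Proof.
move=> [g [L [dL [e [h1 h2 h3 h4 [h5 h6 h7 h8 h9]]]]]] ll.
by exists g, L, dL, e; split => //; split => //; exact: le_trans ll.
Qed.

Lemma joined_dist p q l : joined p q l -> (riemannian_dist psi p q <= l%:E)%E.
Proof.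
move=> [g [L [dL [e [e0 gp gq Cg [dLP cL pL Ll bnd]]]]]].
have Cg' := C1at_curve Cg.
have [g0 L0] := gp 0 (ltW e0).
have [g1 _] : g 1 = q /\ L 1 = L 1 by apply: gq; lra.
apply: (@le_trans _ _ (curve_length psi g)).
  by apply: ereal_inf_lbound; exists g.
rewrite /curve_length; apply: (@le_trans _ _ (L 1 - L 0)%:E); last by rewrite lee_fin L0 subr0.
apply: (len_upper dLP cL (speed_cont Cg')) => t; rewrite sqrtr_ge0 /=.
have [a [b [ca cb le]]] := bnd t.
have -> : dL t = Num.sqrt (dL t ^+ 2) by rewrite sqrtr_sqr ger0_norm.
apply: ler_wsqrtr; rewrite metricE.
by rewrite -(cdr_uniq ca (cdiff_der t sF Cg')) -(cdr_uniq cb (cdiff_der t sG Cg')).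
Qed.

Lemma dr_aff (f : R -> R) t a b d : der f (a * t + b) d -> der (fun s => f (a * s + b)) t (d * a).
Proof.
move=> h; have := dr_comp (dr_add (dr_scale a (dr_id t)) (dr_cst b t)) h.
by move/dr_eq; apply; rewrite mulr1 addr0.
Qed.

Lemma aff_cont (T : topologicalType) (f : R -> T) t a b : {for (a * t + b), continuous f} ->
  {for t, continuous (fun s => f (a * s + b))}.
Proof.
move=> cf; apply: (@continuous_comp _ _ _ (fun s : R => a * s + b) f t _ cf).
exact: (dr_cont (dr_add (dr_scale a (dr_id t)) (dr_cst b t))).
Qed.

Lemma aff_near (P : R -> Prop) (t a b : R) : (\forall s \near (a * t + b), P s) -> \forall s \near t, P (a * s + b).
Proof.
move=> h; have c := dr_cont (dr_add (dr_scale a (dr_id t)) (dr_cst b t)).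
exact: (c _ h).
Qed.

Lemma C1at_aff (g : R -> S) t a b : C1at g (a * t + b) -> C1at (fun s => g (a * s + b)) t.
Proof.
move=> [cg H]; split; first exact: aff_cont.
move=> c ac gc; have [d0 [d1 [n c0 c1]]] := H c ac gc.
exists (fun s => d0 (a * s + b) * a), (fun s => d1 (a * s + b) * a); split.
- by apply: filterS (aff_near n) => s [h0 h1]; split; [exact: (dr_aff h0)|exact: (dr_aff h1)].
- exact: (cvgM (aff_cont c0) (cvg_cst a)).
- exact: (cvgM (aff_cont c1) (cvg_cst a)).
Qed.

Lemma cdr_aff (f : R -> R[i]) t a b d : cder f (a * t + b) d -> cder (fun s => f (a * s + b)) t (a%:C * d).
Proof.
move=> [h1 h2]; split.
  by apply: (dr_eq (dr_aff h1)); rewrite Re_mul /=; ring.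
by apply: (dr_eq (dr_aff h2)); rewrite Im_mul /=; ring.
Qed.

Lemma nsq_real (a : R) (d : R[i]) : nsq (a%:C * d) = a ^+ 2 * nsq d.
Proof. by rewrite nsqM /nsq /= [0 ^+ 2]expr0n addr0. Qed.

Lemma joined_sym p q l : joined p q l -> joined q p l.
Proof.
move=> [g [L [dL [e [e0 gp gq Cg [dLP cL pL Ll bnd]]]]]].
exists (fun t : R => g (-1 * t + 1)), (fun t : R => L 1 - L (-1 * t + 1)), (fun t : R => dL (-1 * t + 1)), e.
have [_ L0] := gp 0 (ltW e0).
split => //.
- by move=> t te; have [-> ->] : g (-1 * t + 1) = q /\ L (-1 * t + 1) = L 1 by [apply: gq; lra]; rewrite subrr.
- move=> t te; have [-> ->] : g (-1 * t + 1) = p /\ L (-1 * t + 1) = 0 by apply: gp; lra.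
  by rewrite (_ : -1 * 1 + 1 = 0) ?L0//; ring.
- by move=> t; exact: C1at_aff.
split => //.
- by move=> t; apply: (dr_eq (dr_sub (dr_cst _ t) (dr_aff (dLP _)))); ring.
- by move=> t; exact: (aff_cont (cL _)).
- by rewrite (_ : -1 * 1 + 1 = 0) ?L0 ?subr0//; ring.
move=> t; have [a [b [ca cb le]]] := bnd (-1 * t + 1).
exists ((-1)%:C * a), ((-1)%:C * b); split; [exact: (cdr_aff ca)|exact: (cdr_aff cb)|].
by rewrite !nsq_real sqrrN expr1n !mul1r.
Qed.

Lemma cdr_near (f h : R -> R[i]) t a : (\forall s \near t, f s = h s) -> cder f t a -> cder h t a.
Proof. by move=> E [h1 h2]; split; [apply: dr_near h1|apply: dr_near h2]; apply: filterS E => s ->. Qed.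

(** The two curves are run at double speed one after the other. Both rest at [q] around the
    junction, so near each time one of the two formulas is valid on a whole neighbourhood. *)
Lemma joined_trans p q r l l' : joined p q l -> joined q r l' -> joined p r (l + l').
Proof.
move=> [g1 [L1 [d1 [e1 [e10 gp1 gq1 Cg1 [dL1 cL1 pL1 Ll1 bnd1]]]]]].
move=> [g2 [L2 [d2 [e2 [e20 gp2 gq2 Cg2 [dL2 cL2 pL2 Ll2 bnd2]]]]]].
pose g t := if t <= 2^-1 then g1 (2 * t + 0) else g2 (2 * t + (-1)).
pose L t := if t <= 2^-1 then L1 (2 * t + 0) else L1 1 + L2 (2 * t + (-1)).
pose dL t := if t <= 2^-1 then d1 (2 * t + 0) * 2 else d2 (2 * t + (-1)) * 2.
have nl (t : R) : t <= 2^-1 -> \forall s \near t, g1 (2 * s + 0) = g s /\ L1 (2 * s + 0) = L s.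
  move=> t2; apply/nbhs_ballP; exists (Num.min (e1 / 2) (e2 / 2)).
    by rewrite /= lt_min !divr_gt0.
  move=> s; rewrite /ball /= lt_min => /andP[]; rewrite !ltr_norml => /andP[a1 a2] /andP[b1 b2].
  rewrite /g /L; case: ifPn => //; rewrite -ltNge => s2.
  have [-> ->] : g1 (2 * s + 0) = q /\ L1 (2 * s + 0) = L1 1 by apply: gq1; lra.
  have [-> ->] : g2 (2 * s + (-1)) = q /\ L2 (2 * s + (-1)) = 0 by apply: gp2; lra.
  by rewrite addr0.
have nr (t : R) : 2^-1 < t -> \forall s \near t, g2 (2 * s + (-1)) = g s /\ L1 1 + L2 (2 * s + (-1)) = L s.
  move=> t2; have : \forall s \near t, 2^-1 < s by apply: (cvgr_gt _ (@cvg_id _ (nbhs t))).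
  by apply: filterS => s s2; rewrite /g /L leNgt s2.
(* Where the first curve has come to rest its length function is constant, so the speed bound [d1]
   vanishes, including at the junction itself. *)
have d1z (t : R) : 2^-1 <= t -> d1 (2 * t + 0) = 0.
  move=> t2; apply: (dr_uniq (dL1 _)); apply: (dr_near _ (dr_cst (L1 1) _)).
  apply/nbhs_ballP; exists e1 => // s; rewrite /ball /= ltr_norml => /andP[? ?].
  by have [_ ->] : g1 s = q /\ L1 s = L1 1 by apply: gq1; lra.
have d2z (t : R) : t <= 2^-1 -> d2 (2 * t + (-1)) = 0.
  move=> t2; apply: (dr_uniq (dL2 _)); apply: (dr_near _ (dr_cst 0 _)).
  apply/nbhs_ballP; exists e2 => // s; rewrite /ball /= ltr_norml => /andP[? ?].
  by have [_ ->] : g2 s = q /\ L2 s = 0 by apply: gp2; lra.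
(* Each speed bound is 0 on the half that belongs to the other curve; writing [dL] as a sum gives
   continuity without looking at the junction. *)
have dLE : dL = fun t => d1 (2 * t + 0) * 2 + d2 (2 * t + (-1)) * 2.
  apply/funext => t; rewrite /dL; case: ifPn => [t2|]; first by rewrite (d2z t t2) mul0r [RHS]addr0.
  by rewrite -ltNge => t2; rewrite (d1z t (ltW t2)) mul0r add0r.
pose e : R := Num.min (Num.min e1 e2) 1 / 4.
have me : 0 < Num.min (Num.min e1 e2) 1 by rewrite !lt_min e10 e20 ltr01.
have me1 : Num.min (Num.min e1 e2) 1 <= e1 by rewrite !ge_min lexx.
have me2 : Num.min (Num.min e1 e2) 1 <= e2 by rewrite !ge_min lexx orbT.
have me3 : Num.min (Num.min e1 e2) 1 <= 1 by rewrite !ge_min lexx orbT.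
have L1E : L 1 = L1 1 + L2 1.
  rewrite /L ifN; last by rewrite -ltNge; lra.
  by congr (_ + L2 _); ring.
exists g, L, dL, e; split.
- by rewrite /e; lra.
- move=> t; rewrite /e => te; have t2 : t <= 2^-1 by lra.
  rewrite /g /L t2.
  by apply: gp1; lra.
- move=> t; rewrite /e => te; have t2 : (t <= 2^-1) = false by apply/negbTE; rewrite -ltNge; lra.
  rewrite L1E /g /L t2.
  by have [-> ->] : g2 (2 * t + -1) = r /\ L2 (2 * t + -1) = L2 1 by apply: gq2; lra.
- move=> t; have [t2|t2] := leP t 2^-1.
    apply: (@C1at_near _ _ (fun s => g1 (2 * s + 0))); first by apply: filterS (nl t t2) => s [].
    exact: C1at_aff.
  apply: (@C1at_near _ _ (fun s => g2 (2 * s + (-1)))); first by apply: filterS (nr t t2) => s [].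
  exact: C1at_aff.
split.
- move=> t; rewrite /dL; case: ifPn => [t2|].
    apply: (@dr_near _ (fun s => L1 (2 * s + 0))); first by apply: filterS (nl t t2) => s [].
    exact: dr_aff.
  rewrite -ltNge => t2.
  apply: (@dr_near _ (fun s => L1 1 + L2 (2 * s + (-1)))); first by apply: filterS (nr t t2) => s [].
  by apply: (dr_eq (dr_add (dr_cst (L1 1) t) (dr_aff (dL2 _)))); rewrite add0r.
- move=> t; rewrite dLE.
  apply: (cvgD (cvgM (aff_cont _) (cvg_cst (2 : R))) (cvgM (aff_cont _) (cvg_cst (2 : R)))); [exact: cL1|exact: cL2].
- by move=> t; rewrite /dL; case: ifPn => _; rewrite mulr_ge0.
- by rewrite L1E lerD.
move=> t; have [t2|t2] := leP t 2^-1.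
  have [a [b [ca cb le]]] := bnd1 (2 * t + 0).
  exists (2%:C * a), (2%:C * b); split.
  - apply: (@cdr_near (fun s => F (g1 (2 * s + 0)))); first by apply: filterS (nl t t2) => s /= [-> _].
    exact: (cdr_aff ca).
  - apply: (@cdr_near (fun s => G (g1 (2 * s + 0)))); first by apply: filterS (nl t t2) => s /= [-> _].
    exact: (cdr_aff cb).
  - rewrite !nsq_real /dL t2 exprMn; lra.
have [a [b [ca cb le]]] := bnd2 (2 * t + (-1)).
exists (2%:C * a), (2%:C * b); split.
- apply: (@cdr_near (fun s => F (g2 (2 * s + (-1))))); first by apply: filterS (nr t t2) => s /= [-> _].
  exact: (cdr_aff ca).
- apply: (@cdr_near (fun s => G (g2 (2 * s + (-1))))); first by apply: filterS (nr t t2) => s /= [-> _].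
  exact: (cdr_aff cb).
- by rewrite !nsq_real /dL (lt_geF t2) exprMn; lra.
Qed.

End metric.

Section seg.
Variables (R : realType) (S : orientedSurface R) (F G : S -> R[i]).
Local Notation V := 'rV[R]_2.

Lemma diff_coord (x v : V) k : 'd (fun x : V => x 0 k) x v = v 0 k.
Proof.
have dT : differentiable (fun x : V => x 0 k) x by exact: differentiable_coord.
have Q := @is_derive_comp_diff R _ _ (fun x : V => x 0 k) (fun s : R => x + s *: v) 0 v.
rewrite /= scale0r addr0 in Q; have {}Q := Q dT (is_derive_line x v 0).
apply: (dr_uniq Q).
have := dr_add (dr_cst (x 0 k) 0) (dr_mul (dr_id 0) (dr_cst (v 0 k) 0)).
move=> /(@dr_near _ _ ((fun x : V => x 0 k) \o (fun s : R => x + s *: v))) h.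
apply: (dr_eq (h _)); last by rewrite mul1r mulr0 addr0 add0r.
by apply: filterE => s /=; rewrite !mxE.
Qed.

Lemma coord_Ck1 (U : set V) k : Ck_on 1 U (fun x : V => x 0 k).
Proof.
split=> [x _|v]; first exact: differentiable_coord.
have E : (fun y : V => 'd (fun x : V => x 0 k) y v) = (fun=> v 0 k).
  by apply/funext => y; rewrite diff_coord.
by rewrite E => x _; exact: cst_continuous.
Qed.

Lemma jac_cont (U : set V) (f g : V -> R) x : Ck_on 1 U f -> Ck_on 1 U g -> U x ->
  {for x, continuous (jac f g)}.
Proof.
move=> Cf Cg Ux; have c k h Ch := @C1_pd_cont _ U h k x Ch Ux.
exact: (cvgB (cvgM (c false _ Cf) (c true _ Cg)) (cvgM (c true _ Cf) (c false _ Cg))).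
Qed.

(** The curve is the lift by [P] of the straight segment from [z0] to [z0 + w], and [M] bounds the
    ratio of d tau to |dH| along it. The lift is C^1 because Cramer's rule expresses the derivatives
    of its chart coordinates continuously. *)
Lemma joined_seg (H : S -> R[i]) (P : R * R -> S) (z0 w : R * R) (M l : R) : csmooth H ->
  0 <= M -> 0 <= l -> w.1 ^+ 2 + w.2 ^+ 2 <= l ^+ 2 ->
  (forall t, 0 <= t <= 1 -> 
   [/\ {for (z0.1 + t * w.1, z0.2 + t * w.2), continuous P},
     \forall z' \near (z0.1 + t * w.1, z0.2 + t * w.2), cRe (H (P z')) = z'.1 /\ cIm (H (P z')) = z'.2,
     J (chart_at (P (z0.1 + t * w.1, z0.2 + t * w.2))) (reC H) (imC H) 
      (P (z0.1 + t * w.1, z0.2 + t * w.2)) != 0 &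
     forall (g : R -> S) s a, {for s, continuous g} -> g s = P (z0.1 + t * w.1, z0.2 + t * w.2) -> cder (H \o g) s a ->
      exists b c, [/\ cder (F \o g) s b, cder (G \o g) s c & 2 * (nsq b + nsq c) <= M ^+ 2 * nsq a]]) ->
  joined F G (P z0) (P (z0.1 + w.1, z0.2 + w.2)) (M * l).
Proof.
move=> [sX sY] M0 l0 wl HP.
(* With [3 * t - 1] as argument the motion takes place in the middle third of [0, 1], and the curve
   rests on the outer thirds as [joined] requires. *)
pose u (t : R) := z0.1 + step (3 * t + (-1)) * w.1.
pose v (t : R) := z0.2 + step (3 * t + (-1)) * w.2.
pose g (t : R) := P (u t, v t).
pose ds (t : R) := dstep (3 * t + (-1)) * 3.
have dst (t : R) : der (fun t => step (3 * t + (-1))) t (ds t) by exact: (dr_aff (dr_step _)).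
have cds : continuous ds by move=> t; exact: (cvgM (aff_cont (@dstep_cont R _)) (cvg_cst (3 : R))).
have du t : der u t (ds t * w.1).
  by apply: (dr_eq (dr_add (dr_cst _ t) (dr_mul (dst t) (dr_cst w.1 t)))); ring.
have dv t : der v t (ds t * w.2).
  by apply: (dr_eq (dr_add (dr_cst _ t) (dr_mul (dst t) (dr_cst w.2 t)))); ring.
have HP' t := HP _ (step_itv (3 * t + (-1))).
have bd t : [/\ {for t, continuous g}, der ((reC H) \o g) t (ds t * w.1) & der ((imC H) \o g) t (ds t * w.2)].
  have [h1 h2 _ _] := HP' t.
  exact: (@branch_der _ _ P (reC H) (imC H) u v t _ _ h1 h2 (du t) (dv t)).
have Cg t : C1at g t.
  have [cg _ _] := bd t; split => // c ac gc.
  have nd : \forall s \near t, cdom c (g s) by exact: (cg _ (near_cdom gc)).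
  have J0 s : cdom c (g s) -> J c (reC H) (imC H) (g s) != 0.
    by move=> sc; apply: J_chart => //; have [_ _ ? _] := HP' s.
  pose d k s := ((ds s * w.1) * jac (fun x : V => x 0 k) (loc c (imC H)) (cmap c (g s)) +
     (ds s * w.2) * jac (loc c (reC H)) (fun x : V => x 0 k) (cmap c (g s))) /
     J c (reC H) (imC H) (g s).
  have dd k s : cdom c (g s) -> der (fun u => cmap c (g u) 0 k) s (d k s).
    move=> sc; have [cs b1 b2] := bd s.
    exact: (cur_der_chart ac sc sX sY (@coord_Ck1 _ k) (J0 s sc) cs b1 b2).
  have cgc : {for t, continuous (cmap c \o g)} by exact: (@continuous_comp _ _ _ g (cmap c) t cg (cmap_cont gc)).
  have cj (f h : V -> R) : Ck_on 1 (img c) f -> Ck_on 1 (img c) h -> {for t, continuous (fun s => jac f h (cmap c (g s)))}.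
    move=> Cf Ch; exact: (@continuous_comp _ _ _ (cmap c \o g) (jac f h) t cgc (jac_cont Cf Ch (img_cmap gc))).
  have CX := smooth_Ck 1 sX ac; have CY := smooth_Ck 1 sY ac.
  have cd k : {for t, continuous (d k)}.
    have c1 : {for t, continuous (fun s => ds s * w.1)} by exact: (cvgM (cds t) (cvg_cst w.1)).
    have c2 : {for t, continuous (fun s => ds s * w.2)} by exact: (cvgM (cds t) (cvg_cst w.2)).
    have c3 := cj _ _ (@coord_Ck1 (img c) k) CY; have c4 := cj _ _ CX (@coord_Ck1 (img c) k).
    have c5 := cj _ _ CX CY.
    exact: (cvgM (cvgD (cvgM c1 c3) (cvgM c2 c4)) (cvgV (J0 t gc) c5)).
  exists (d 0), (d 1); split; [|exact: cd|exact: cd].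
  by apply: filterS nd => s sc; split; exact: dd.
have ds0 t : 0 <= ds t by rewrite mulr_ge0// dstep_ge0.
have s0 (t : R) : t <= 3^-1 -> step (3 * t + (-1)) = 0 by move=> te; apply: step0; lra.
have s1 (t : R) : 1 - 3^-1 <= t -> step (3 * t + (-1)) = 1 by move=> te; apply: step1; lra.
have s11 : step (3 * 1 + (-1)) = 1 :> R by apply: step1; lra.
have bnd t : exists a b, [/\ cder (F \o g) t a, cder (G \o g) t b & 2 * (nsq a + nsq b) <= (M * l * ds t) ^+ 2].
  have [cg b1 b2] := bd t; have [_ _ _ h] := HP' t.
  have [b [c [cb cc le]]] := h g t ((ds t * w.1) +i* (ds t * w.2)) cg erefl (conj b1 b2).
  exists b, c; split; [exact: cb|exact: cc|]; apply: (le_trans le).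
  have -> : nsq (ds t * w.1 +i* (ds t * w.2)) = ds t ^+ 2 * (w.1 ^+ 2 + w.2 ^+ 2) by rewrite /nsq /=; ring.
  have -> : (M * l * ds t) ^+ 2 = M ^+ 2 * (ds t ^+ 2 * l ^+ 2) by ring.
  apply: ler_wpM2l; first exact: sqr_ge0.
  apply: ler_wpM2l; [exact: sqr_ge0|exact: wl].
have g0 (t : R) : t <= 3^-1 -> g t = P z0.
  move=> te; rewrite /g /u /v (s0 _ te) !mul0r !addr0.
  by congr P; case: (z0).
have g1 (t : R) : 1 - 3^-1 <= t -> g t = P (z0.1 + w.1, z0.2 + w.2).
  by move=> te; rewrite /g /u /v (s1 _ te) !mul1r.
clear -s0 s1 s11 g0 g1 bnd Cg dst cds ds0 M0 l0.
exists g, (fun t => M * l * step (3 * t + (-1))), (fun t => M * l * ds t), 3^-1; split.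
- by rewrite invr_gt0.
- by move=> t te; rewrite (s0 _ te) mulr0; split; [exact: g0|].
- by move=> t te; rewrite (s1 _ te) s11; split; [exact: g1|].
- exact: Cg.
split.
- by move=> t; exact: (dr_scale _ (dst t)).
- by move=> t; exact: (cvgM (cvg_cst (M * l)) (cds t)).
- by move=> t; exact: (mulr_ge0 (mulr_ge0 M0 l0) (ds0 t)).
- by rewrite s11 mulr1.
exact: bnd.
Qed.

End seg.

Lemma smooth_comp_cont (R : realType) (S : orientedSurface R) (T : topologicalType) (g : T -> S) (f : S -> R) t :
  smooth_map f -> {for t, continuous g} -> {for t, continuous (fun s => f (g s))}.
Proof.
move=> sf cg; have c : {for g t, continuous f} by exact: smooth_cont.
exact (@continuous_comp _ _ _ g f t cg c).
Qed.

Lemma pair_comp_cont (R : realType) (T U : topologicalType) (x y : T -> R) (P : R * R -> U) t :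
  {for t, continuous x} -> {for t, continuous y} -> {for (x t, y t), continuous P} -> {for t, continuous (fun s => P (x s, y s))}.
Proof.
move=> cx cy cP; exact: (@continuous_comp _ _ _ (fun s => (x s, y s)) P t (cvg_pair cx cy) cP).
Qed.

Section completeness.
Variables (R : realType) (S : orientedSurface R) (psi : improperAffineFront S).
Variables (F G : S -> R[i]).
Hypotheses (sF : csmooth F) (sG : csmooth G).
Hypothesis metricE : forall p v, dtau2 psi p v = 2 * (nsq (cdiff F p v) + nsq (cdiff G p v)).
Hypothesis et : forall p, J (chart_at p) (reC G) (imC G) p != 0.
Hypothesis cpl : weakly_complete psi.

(** Small distance to [p] implies nearness in the topology: the coordinates of [G] along a short
    curve ending at [p] stay in the ball where the local inverse [P] lives, and by uniqueness of
    lifts the curve equals [P] of its coordinates, hence starts in [N]. *)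
Lemma dist_nbhs p (N : set S) : nbhs p N ->
  exists2 r : R, 0 < r & forall q, (riemannian_dist psi q p < r%:E)%E -> N q.
Proof.
move=> nN; have [sX sY] := sG.
have [r [P [r0 Pp P1 P2 _]]] := branch sX sY et nN.
exists r => // q /(dist_curve sF sG metricE)[g [[cg _] g0 g1 gB]].
have zB t : 0 <= t <= 1 -> ball (cRe (G p), cIm (G p)) r (cRe (G (g t)), cIm (G (g t))).
  by move=> /gB[h1 h2]; split; rewrite /ball /= distrC.
have t1 (t : R) : 0 <= t <= 1 -> 0 <= -1 * t + 1 <= 1 by move=> /andP[? ?]; apply/andP; split; lra.
(* The curve is run backwards, because its end [p] is the point where both lifts are known to
   agree. *)
have := @lift_uniq01 R S _ _ (fun t => g (-1 * t + 1)) (fun t => P (cRe (G (g (-1 * t + 1))), cIm (G (g (-1 * t + 1))))) sX sY.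
rewrite mulr0 add0r (_ : -1 * 1 + 1 = 0 :> R); last by ring.
rewrite g1 Pp g0 => -> //.
  have b0 : (0 <= (0 : R)) && ((0 : R) <= 1) by rewrite lexx ler01.
  by have [] := P1 _ (zB _ b0); rewrite g0.
move=> t /t1 t01; have zt := zB _ t01; have [_ e1 e2] := P1 _ zt; split => //.
- exact: (aff_cont (cg _)).
- apply: (@aff_cont _ _ (fun s => P (cRe (G (g s)), cIm (G (g s))))).
  have c := cg (-1 * t + 1 : R).
  exact: (pair_comp_cont (smooth_comp_cont sX c) (smooth_comp_cont sY c) (P2 _ zt)).
Qed.

(** Completeness speaks of distances, while later limits are taken of continuous functions;
    [dist_nbhs] passes from one kind of convergence to the other. *)
Lemma joined_complete (u : nat -> S) (eps : nat -> R) :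
  (forall m k : nat, (m <= k)%N -> joined F G (u m) (u k) (eps m)) ->
  (forall e : R, 0 < e -> exists N : nat, forall m : nat, (N <= m)%N -> eps m < e) ->
  exists p : S, forall N : set S, nbhs p N -> exists M : nat, forall m : nat, (M <= m)%N -> N (u m).
Proof.
move=> ju he; have [|p pP] := cpl (u := u).
  move=> e /he[N NP]; exists N => m k Nm Nk.
  have [mk|/ltnW km] := leqP m k.
    by apply: (le_lt_trans (joined_dist sF sG metricE (ju _ _ mk))); rewrite lte_fin NP.
  by apply: (le_lt_trans (joined_dist sF sG metricE (joined_sym (ju _ _ km)))); rewrite lte_fin NP.
exists p => N /dist_nbhs[r r0 rP]; have [M MP] := pP r r0.
by exists M => m /MP /rP.
Qed.

End completeness.

(** * Lifting a star-shaped domain *)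

Section starlift.
Variables (R : realType) (S : orientedSurface R) (X Y : S -> R) (q : S) (Good : set S).
Hypotheses (sX : smooth_map X) (sY : smooth_map Y) (Xq : X q = 0) (Yq : Y q = 0).
Hypotheses (GoodO : forall p, Good p -> nbhs p Good) (Goodq : Good q).
Hypothesis GoodJ : forall p, Good p -> J (chart_at p) X Y p != 0.
Implicit Types (O : set (R * R)) (P Q : R * R -> S) (w z : R * R).

Definition dil (t : R) w : R * R := (t * w.1, t * w.2).

Lemma dil0 w : dil 0 w = (0, 0). Proof. by rewrite /dil !mul0r. Qed.
Lemma dil1 w : dil 1 w = w. Proof. by rewrite /dil !mul1r; case: w. Qed.
Lemma dilM s t w : dil s (dil t w) = dil (s * t) w. Proof. by rewrite /dil /= !mulrA. Qed.

Lemma dil_cont t w : {for w, continuous (dil t)}.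
Proof.
have c1 : {for w, continuous (fun z : R * R => t * z.1)} by exact: (cvgM (cvg_cst t) cvg_fst).
have c2 : {for w, continuous (fun z : R * R => t * z.2)} by exact: (cvgM (cvg_cst t) cvg_snd).
exact: (cvg_pair c1 c2).
Qed.

Lemma dil_cont_aff (U : topologicalType) (P : R * R -> U) (a b : R) w (t : R) :
  {for dil (a * t + b) w, continuous P} -> {for t, continuous (fun s => P (dil (a * s + b) w))}.
Proof.
move=> cP.
have c (d : R) : {for t, continuous (fun s : R => (a * s + b) * d)}.
  exact: (cvgM (aff_cont (@cvg_id _ (nbhs (a * t + b)))) (cvg_cst d)).
exact: (@pair_comp_cont R R U (fun s => (a * s + b) * w.1) (fun s => (a * s + b) * w.2) P t (c w.1) (c w.2) cP).
Qed.

Lemma seg_uniq P Q w (a b : R) :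
  (forall t : R, 0 <= t <= 1 -> [/\ {for dil (a * t + b) w, continuous P}, {for dil (a * t + b) w, continuous Q},
    Good (P (dil (a * t + b) w)), X (P (dil (a * t + b) w)) = X (Q (dil (a * t + b) w)) &
    Y (P (dil (a * t + b) w)) = Y (Q (dil (a * t + b) w))]) ->
  P (dil b w) = Q (dil b w) -> P (dil (a + b) w) = Q (dil (a + b) w).
Proof.
move=> H e0.
have := @lift_uniq01 R S X Y (fun t => P (dil (a * t + b) w)) (fun t => Q (dil (a * t + b) w)) sX sY.
rewrite mulr0 add0r mulr1 => -> // t t01; have [h1 h2 h3 h4 h5] := H t t01.
split; [exact: (dil_cont_aff h1)|exact: (dil_cont_aff h2)|exact: GoodJ|exact: h4|exact: h5].
Qed.

(* A branch of the inverse of [(X, Y)] on a star-shaped open set.  All such branches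
   agree along rays, so their union is again one. *)
Definition star_lift O P := [/\ O (0, 0), P (0, 0) = q, forall w, O w -> nbhs w O,
  forall w t, O w -> 0 <= t <= 1 -> O (dil t w) &
  forall w, O w -> [/\ {for w, continuous P}, X (P w) = w.1, Y (P w) = w.2 & Good (P w)]].

Lemma star_lift_uniq O O' P P' w : star_lift O P -> star_lift O' P' -> O w -> O' w -> P w = P' w.
Proof.
move=> [_ e _ st H] [_ e' _ st' H'] Ow O'w; rewrite -(dil1 w) -[1]addr0.
apply: seg_uniq; last by rewrite dil0 e e'.
move=> t t01; rewrite mul1r addr0.
have [c1 x1 y1 g1] := H _ (st _ _ Ow t01); have [c2 x2 y2 _] := H' _ (st' _ _ O'w t01).
by split; rewrite ?x1 ?x2 ?y1 ?y2.
Qed.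

Lemma star_lift_init : exists O P, star_lift O P.
Proof.
have [r [P [r0 P1 P2 nP _]]] := loc_inverse (chart_at_atlas q) (chart_at_dom q) sX sY (GoodJ Goodq) (GoodO Goodq).
rewrite Xq Yq in P1 P2.
exists (ball ((0 : R), (0 : R)) r), P; split.
- exact: ballxx.
- by have := nbhs_singleton nP; rewrite Xq Yq.
- by move=> w wB; apply: open_nbhs_nbhs; split => //; exact: ball_open.
- move=> w t [/= h1 h2] /andP[t0 t1].
  have le (x : R) : `|t * x| <= `|x| by rewrite normrM ger0_norm// ler_piMl.
  move: h1 h2; rewrite /ball /= !sub0r !normrN => h1 h2.
  by split; rewrite /ball /= sub0r normrN; [exact: le_lt_trans h1|exact: le_lt_trans h2].
- by move=> w wB; have [? ? ?] := P1 _ wB; split => //; exact: P2.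
Qed.

Definition star_dom w := exists O P, star_lift O P /\ O w.

Lemma star_lift_max : exists P, star_lift star_dom P.
Proof.
have ex w : exists p, forall O P, star_lift O P -> O w -> P w = p.
  have [[Om [P [h Ow]]]|no] := pselect (star_dom w).
    by exists (P w) => O' P' h' O'w; exact: star_lift_uniq h' h O'w Ow.
  by exists q => O P h Ow; case: no; exists O, P.
have [P PP] := choice ex; exists P; have [U0 [P0 h0]] := star_lift_init.
have [z0 e0 _ _ _] := h0.
split.
- by exists U0, P0.
- by rewrite -(PP _ _ _ h0 z0).
- move=> w [Om [Q [h Ow]]]; have [_ _ nO _ _] := h.
  by apply: filterS (nO _ Ow) => z Oz; exists Om, Q.
- move=> w t [Om [Q [h Ow]]] t01; exists Om, Q; split => //.
  by have [_ _ _ st _] := h; exact: st.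
- move=> w [Om [Q [h Ow]]]; have [_ _ nO _ H] := h; have [c x y g] := H _ Ow.
  have E : P w = Q w by rewrite (PP _ _ _ h Ow).
  rewrite E; split => //; apply: (cont_near _ c).
  by apply: filterS (nO _ Ow) => z Oz; rewrite (PP _ _ _ h Oz).
Qed.

Lemma ball_conv (x r : R) (u v t : R) : `|x - u| < r -> `|x - v| < r -> 0 <= t <= 1 ->
  `|x - ((1 - t) * u + t * v)| < r.
Proof.
rewrite !ltr_norml => /andP[a1 a2] /andP[b1 b2] /andP[t0 t1].
have [t5|t5] := leP t 2^-1; apply/andP; split; nra.
Qed.

Lemma ball_conv2 (w z z' : R * R) (r t : R) : ball w r z -> ball w r z' -> 0 <= t <= 1 ->
  ball w r ((1 - t) * z.1 + t * z'.1, (1 - t) * z.2 + t * z'.2).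
Proof. by move=> [h1 h2] [h3 h4] t01; split; exact: ball_conv. Qed.

Lemma harmonic_itv (m : nat) : 0 <= (1 - m.+1%:R^-1 : R) < 1.
Proof.
have h : 0 < m.+1%:R^-1 :> R by rewrite invr_gt0 ltr0n.
have h' : m.+1%:R^-1 <= 1 :> R by rewrite invf_le1 ?ltr0n// ler1n.
by rewrite subr_ge0 h' /= ltrBlDr ltrDl.
Qed.

(** The local inverse [Q] of [(X, Y)] at the limit point [p] is glued to [P]. The two agree near a
    point of the ray close to [w], and then by uniqueness of lifts on the rays through that
    neighbourhood, so the union is again a star-shaped branch and contains [w]. *)
Lemma star_lift_extend P w p : star_lift star_dom P ->
  (forall t, 0 <= t < 1 -> star_dom (dil t w)) -> Good p ->
  (forall N : set S, nbhs p N -> exists M : nat, forall m : nat, (M <= m)%N -> N (P (dil (1 - m.+1%:R^-1) w))) ->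
  star_dom w.
Proof.
move=> hP ray gp lim; have [d0 P0 nD st HP] := hP.
have cv : (fun m : nat => P (dil (1 - m.+1%:R^-1) w)) @ \oo --> p.
  by move=> N /lim[M HM]; exists M.
have ct : (fun m : nat => 1 - m.+1%:R^-1 : R) @ \oo --> (1 : R).
  by have := cvgB (cvg_cst (1 : R)) (@cvg_harmonic R); rewrite subr0; exact.
have t01 := harmonic_itv.
have Pm m := HP _ (ray _ (t01 m)).
have cx (x : R) : (fun m : nat => (1 - m.+1%:R^-1) * x) @ \oo --> x.
  by have := cvgM ct (cvg_cst x); rewrite mul1r; exact.
have csm : (fun m : nat => dil (1 - m.+1%:R^-1) w) @ \oo --> w.
  have cp : (fun m : nat => dil (1 - m.+1%:R^-1) w) @ \oo --> (w.1, w.2) by exact: (cvg_pair (cx w.1) (cx w.2)).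
  have ww : (w.1, w.2) = w by case: (w).
  by rewrite ww in cp.
have lim_eq (Z : S -> R) (z : R) : smooth_map Z ->
    (forall m : nat, Z (P (dil (1 - m.+1%:R^-1) w)) = (1 - m.+1%:R^-1) * z) -> Z p = z.
  move=> sZ E; have c1 : (fun m : nat => Z (P (dil (1 - m.+1%:R^-1) w))) @ \oo --> Z p.
    exact: (cvg_comp _ _ cv (smooth_cont sZ)).
  by rewrite (funext E) in c1; exact: (cvg_unique (@Rhausdorff R) c1 (cx z)).
have Xp : X p = w.1 by apply: lim_eq => // m; have [_ -> _ _] := Pm m.
have Yp : Y p = w.2 by apply: lim_eq => // m; have [_ _ -> _] := Pm m.
have [r [Q [r0 Q1 Q2 nQ _]]] := loc_inverse (chart_at_atlas p) (chart_at_dom p) sX sY (GoodJ gp) (GoodO gp).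
have ew : (X p, Y p) = w by rewrite Xp Yp; case: (w).
rewrite ew in Q1 Q2.
have nB z : ball w r z -> nbhs z (ball w r).
  by move=> zB; apply: open_nbhs_nbhs; split => //; exact: ball_open.
(* A point of the ray so far out that it lies in the ball of [Q] and that its lift lies where [Q] is
   also a left inverse; there [P] and [Q] coincide. *)
have [M [M1 [M2 M3]]] : exists m : nat, 0 < 1 - m.+1%:R^-1 :> R /\ ball w r (dil (1 - m.+1%:R^-1) w) /\
    interior [set p' | Q (X p', Y p') = p'] (P (dil (1 - m.+1%:R^-1) w)).
  have n1 : \forall m \near \oo, interior [set p' | Q (X p', Y p') = p'] (P (dil (1 - m.+1%:R^-1) w)).
    by apply: cv; exact: nbhs_interior.
  have n2 : \forall m \near \oo, ball w r (dil (1 - m.+1%:R^-1) w).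
    by apply: csm; apply: nB; exact: ballxx.
  have n3 : \forall m \near \oo, 0 < 1 - m.+1%:R^-1 :> R by apply: (cvgr_gt _ ct).
  by have [m [h1 [h2 h3]]] := filter_ex (filterI n1 (filterI n2 n3)); exists m.
set tau := 1 - M.+1%:R^-1 in M1 M2 M3.
have tau1 : tau <= 1 by have /andP[_ /ltW] := t01 M.
have Db : star_dom (dil tau w) by apply: ray; exact: t01.
pose B := [set b | [/\ star_dom b, ball w r b & P b = Q b]].
have nBb : nbhs (dil tau w) B.
  have [cP _ _ _] := HP _ Db.
  have n1 : \forall b \near dil tau w, Q (X (P b), Y (P b)) = P b by exact: (cP _ M3).
  apply: (filter_app _ _ n1); apply: (filter_app _ _ (nB _ M2)); apply: filterS (nD _ Db) => b Db' Bb h.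
  split => //; rewrite -h; have [_ -> -> _] := HP _ Db'; by case: (b).
(* Points of the ball whose segment to the origin meets the interior of the agreement set. Between
   that meeting point and [z] the segment stays in the ball by convexity, which gives both the
   agreement of [P] and [Q] and the star shape of the union. *)
pose E := [set z | ball w r z /\ exists2 mu : R, 0 < mu <= 1 & B^° (dil mu z)].
have EQ z : E z -> star_dom z -> P z = Q z.
  move=> [zB [mu /andP[mu0 mu1] /nbhs_singleton[Db' bB PQ]]] Dz.
  rewrite -(dil1 z) -(subrK mu 1); apply: seg_uniq => // t /andP[t0 t1].
  have t01' : 0 <= t <= 1 by rewrite t0.
  have D' : star_dom (dil ((1 - mu) * t + mu) z).
    by apply: st => //; apply/andP; split; nra.
  have B' : ball w r (dil ((1 - mu) * t + mu) z).
    have := ball_conv2 bB zB t01'.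
    by congr (ball w r _); rewrite /dil /=; congr pair; ring.
  have [c1 x1 y1 g1] := HP _ D'; have [g2 x2 y2] := Q1 _ B'.
  by split; rewrite ?x1 ?x2 ?y1 ?y2//; exact: Q2.
have nE z : E z -> nbhs z E.
  move=> [zB [mu mu01 Bm]].
  have n1 : \forall z' \near z, B^° (dil mu z').
    by apply: (@dil_cont mu z); exact: nbhs_interior.
  by apply: (filter_app _ _ n1); apply: filterS (nB _ zB) => z' h1 h2; split => //; exists mu.
pose P' z := if `[< star_dom z >] then P z else Q z.
have PE z : star_dom z -> P' z = P z by move=> Dz; rewrite /P'; case: asboolP.
have QE z : E z -> P' z = Q z by move=> Ez; rewrite /P'; case: asboolP => // Dz; exact: EQ.
exists [set z | star_dom z \/ E z], P'; split; last first.
  right; split; first exact: ballxx.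
  by exists tau; rewrite ?M1.
split.
- by left.
- by rewrite PE.
- move=> z [Dz|Ez]; first by apply: filterS (nD _ Dz) => z' ?; left.
  by apply: filterS (nE _ Ez) => z' ?; right.
- move=> z t [Dz|[zB [mu /andP[mu0 mu1] Bm]]] /andP[t0 t1]; first by left; apply: st => //; rewrite t0.
  have [Db' bB _] := nbhs_singleton Bm.
  have [tm|tm] := leP t mu.
    left; rewrite (_ : dil t z = dil (t / mu) (dil mu z)); last by rewrite dilM divfK// gt_eqF.
    apply: st => //; apply/andP; split; first by rewrite divr_ge0// ltW.
    by rewrite ler_pdivrMr// mul1r.
  right; have tp : 0 < t by exact: lt_trans mu0 tm.
  split; last first.
    exists (mu / t); first by apply/andP; split; [rewrite divr_gt0|rewrite ler_pdivrMr// mul1r ltW].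
    by rewrite dilM divfK// gt_eqF.
  have m1 : mu < 1 by exact: lt_le_trans tm t1.
  have d0' : 0 < 1 - mu by rewrite subr_gt0.
  have s01 : 0 <= (t - mu) / (1 - mu) <= 1.
    by apply/andP; split; [rewrite divr_ge0 ?ltW// subr_gt0|rewrite ler_pdivrMr// mul1r lerB].
  have := ball_conv2 bB zB s01.
  by congr (ball w r _); rewrite /dil /=; congr pair; field; rewrite gt_eqF.
move=> z [Dz|Ez].
  have [c x y g] := HP _ Dz; rewrite PE//; split => //.
  by apply: (cont_near _ c); apply: filterS (nD _ Dz) => z' Dz'; rewrite PE.
have [zB _] := Ez; have [g x y] := Q1 _ zB; rewrite QE//; split => //.
by apply: (cont_near _ (Q2 _ zB)); apply: filterS (nE _ Ez) => z' Ez'; rewrite QE.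
Qed.

(** A continuity argument on each ray: the supremum of the times reached by the maximal branch is
    itself reached by [star_lift_extend], and openness of the domain excludes that it is below 1. *)
Lemma star_lift_cover (D : set (R * R)) : (forall w t, D w -> 0 <= t <= 1 -> D (dil t w)) ->
  (forall O P w, star_lift O P -> D w -> (forall t, 0 <= t < 1 -> O (dil t w)) -> exists2 p, Good p &
    forall N : set S, nbhs p N -> exists M : nat, forall m : nat, (M <= m)%N -> N (P (dil (1 - m.+1%:R^-1) w))) ->
  exists O P, star_lift O P /\ D `<=` O.
Proof.
move=> stD lim; have [P hP] := star_lift_max; have [d0 P0 nD st HP] := hP.
exists star_dom, P; split => // w Dw.
pose A := [set t : R | 0 <= t <= 1 /\ star_dom (dil t w)].
have A0 : A 0 by split; [rewrite lexx ler01|rewrite dil0].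
have hA : has_sup A by split; [exists 0|exists 1 => t [/andP[]]].
have T0 : 0 <= sup A by apply: ub_le_sup => //; exact: hA.2.
have T1 : sup A <= 1 by apply: ge_sup => [|t [/andP[]] //]; exists 0.
have ltT t : 0 <= t < sup A -> star_dom (dil t w).
  move=> /andP[t0 /(sup_gt _)]; case; first by exists 0.
  move=> s [/andP[s0 s1] Ds] ts.
  have sp : 0 < s by exact: le_lt_trans t0 ts.
  rewrite (_ : dil t w = dil (t / s) (dil s w)); last by rewrite dilM divfK// gt_eqF.
  apply: st => //; apply/andP; split; first by rewrite divr_ge0.
  by rewrite ler_pdivrMr// mul1r ltW.
have DT : star_dom (dil (sup A) w).
  have ray t : 0 <= t < 1 -> star_dom (dil t (dil (sup A) w)).
    move=> /andP[t0 t1]; rewrite dilM; have [->|Tn] := eqVneq (sup A) 0; first by rewrite mulr0 dil0.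
    apply: ltT; rewrite mulr_ge0//= gtr_pMl// lt_def Tn//.
  have DDT : D (dil (sup A) w) by apply: stD => //; rewrite T0.
  have [p gp pl] := lim _ _ _ hP DDT ray.
  exact: star_lift_extend hP ray gp pl.
move: T1; rewrite le_eqVlt => /orP[/eqP E|Tlt]; first by move: DT; rewrite E dil1.
have n1 : \forall t \near sup A, star_dom (dil (1 * t + 0) w).
  have c := @dil_cont_aff _ (fun z => z) 1 0 w (sup A) (@cvg_id _ _).
  by apply: c; rewrite mul1r addr0; exact: nD.
have /nbhs_ballP[e /= e0 eP] := n1.
pose t := sup A + Num.min (e / 2) (1 - sup A).
have m0 : 0 < Num.min (e / 2) (1 - sup A) by rewrite lt_min divr_gt0//= subr_gt0.
have m1 : Num.min (e / 2) (1 - sup A) <= e / 2 by rewrite ge_min lexx.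
have m2 : Num.min (e / 2) (1 - sup A) <= 1 - sup A by rewrite ge_min lexx orbT.
have : A t.
  split; first by rewrite /t; apply/andP; split; lra.
  have := eP t; rewrite mul1r addr0; apply.
  rewrite /ball /= /t opprD addNKr normrN gtr0_norm//; lra.
move=> /(ub_le_sup hA.2); rewrite /t; lra.
Qed.

End starlift.

(** * A mean value bound for complex-valued curves *)

Section ode.
Variable R : realType.

(** The mean value theorem fails for complex values, so it is applied to the real inner product of
    [g] with the fixed vector [g t], followed by Cauchy-Schwarz. *)
Lemma cder_bound (g : R -> R[i]) (d : R -> R[i]) (K t : R) : 0 <= t <= 1 ->
  (forall s, 0 <= s <= t -> cder g s (d s) /\ nsq (d s) <= K) -> g 0 = 0 -> nsq (g t) <= K.
Proof.
move=> /andP[t0 t1] H g0.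
have K0 : 0 <= K.
  have [|_ h] := H 0; first by rewrite lexx.
  by apply: le_trans h; exact: nsq_ge0.
move: t0; rewrite le_eqVlt => /orP[/eqP <-|t0].
  by rewrite g0 /nsq /= !expr0n /= addr0.
pose x := cRe (g t); pose y := cIm (g t).
have [c /andP[c0 ct]] := @dr_MVT R (fun s => x * cRe (g s) + y * cIm (g s))
   (fun s => x * cRe (d s) + y * cIm (d s)) 0 t t0 (fun s hs => let: conj (conj h1 h2) _ := H s hs in dr_add (dr_scale x h1) (dr_scale y h2)).
have [|_ Kc] := H c; first by rewrite !ltW.
rewrite g0 /= !mulr0 !addr0 !subr0 -/x -/y => E.
have : (x * x + y * y) ^+ 2 <= (x * x + y * y) * K.
  rewrite E exprMn.
  have cs : (x * cRe (d c) + y * cIm (d c)) ^+ 2 <= (x * x + y * y) * nsq (d c).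
    rewrite /nsq -subr_ge0.
    have -> : (x * x + y * y) * (cRe (d c) ^+ 2 + cIm (d c) ^+ 2) - (x * cRe (d c) + y * cIm (d c)) ^+ 2 =
      (x * cIm (d c) - y * cRe (d c)) ^+ 2 by ring.
    exact: sqr_ge0.
  have s0 := sqr_ge0 (x * cRe (d c) + y * cIm (d c)).
  apply: (@le_trans _ _ ((x * cRe (d c) + y * cIm (d c)) ^+ 2)).
    by rewrite ler_piMr// expr_le1// ltW.
  rewrite -E; apply: (le_trans cs); apply: ler_wpM2l => //.
  by rewrite -!expr2 addr_ge0 ?sqr_ge0.
have -> : nsq (g t) = x * x + y * y by rewrite /nsq -!expr2.
have : 0 <= x * x + y * y by rewrite -!expr2 addr_ge0 ?sqr_ge0.
rewrite le_eqVlt => /orP[/eqP <- //|p0].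
by rewrite expr2 ler_pM2l.
Qed.

End ode.

(** * The rotated coordinate adapted to a point *)

Section rotation.
Variables (R : realType) (S : orientedSurface R) (F G : S -> R[i]).
Hypothesis sG : csmooth G.
Let sX := sG.1.
Let sY := sG.2.
Hypothesis et : forall p, J (chart_at p) (reC G) (imC G) p != 0.
Hypothesis hF : hol G F.
Local Notation dG := (dG G).

(** The chain rule for determinants: by the Cauchy-Riemann equations the Jacobian of [h] in the
    coordinate [G] is |dh/dG|^2. *)
Lemma J_hol h p : hol G h ->
  J (chart_at p) (reC h) (imC h) p =
  J (chart_at p) (reC G) (imC G) p * nsq (dG h p).
Proof.
move=> [_ e1 e2]; have := e1 p; have := e2 p; have := et p.
rewrite /dG /nsq /= /D1 /D2 /J /jac /jac2.
set a := pd _ _ _; set b := pd _ _ _; set c := pd _ _ _; set d := pd _ _ _.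
set x := pd _ _ _; set y := pd _ _ _; set z := pd _ _ _; set w := pd _ _ _.
clearbody a b c d x y z w => j0 E2 E1.
transitivity ((a * b - c * d) * ((z * b - w * d) / (a * b - c * d) * ((a * x - c * y) / (a * b - c * d)) -
   (a * w - c * z) / (a * b - c * d) * ((y * b - x * d) / (a * b - c * d)))).
  by field.
by rewrite E1 E2; congr (_ * _); ring.
Qed.

(** Differentiability of [G \o g] is part of the conclusion: it comes from Cramer's rule in the
    local coordinate [h]. The value then follows from the chain rule. *)
Lemma hol_comp_cder h (g : R -> S) s e : hol G h -> {for s, continuous g} -> dG h (g s) != 0 ->
  cder (h \o g) s e -> cder (G \o g) s (e / dG h (g s)).
Proof.
move=> hh cg m0 ch; have [[s1 s2] _ _] := hh; have [c1 c2] := ch.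
have J0 : J (chart_at (g s)) (reC h) (imC h) (g s) != 0.
  by rewrite J_hol// mulf_neq0 ?et// nsq_eq0.
have d1 := cur_der (chart_at_atlas (g s)) (chart_at_dom (g s)) s1 s2 sX J0 cg c1 c2.
have d2 := cur_der (chart_at_atlas (g s)) (chart_at_dom (g s)) s1 s2 sY J0 cg c1 c2.
have xc (a b : R) : der (fun s => cRe (G (g s))) s a -> der (fun s => cIm (G (g s))) s b ->
  exists c, cder (G \o g) s c by move=> k1 k2; exists (a +i* b).
have [c cG] := xc _ _ d1 d2.
apply: (cdr_eq cG); have E := cdr_uniq ch (hol_cder sX sY et hh cg cG).
by rewrite E mulfK.
Qed.

Lemma lines_near q : exists g1 g2 : R -> S, [/\ g1 0 = q, g2 0 = q,
  \forall s \near (0 : R), {for s, continuous g1} /\ cder (G \o g1) s 1 &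
  \forall s \near (0 : R), {for s, continuous g2} /\ cder (G \o g2) s (0 +i* 1)].
Proof.
have [r [P [r0 Pp P1 P2 _]]] := branch sX sY et (@filterT _ (nbhs q) _).
have P1' z : ball (cRe (G q), cIm (G q)) r z -> cRe (G (P z)) = z.1 /\ cIm (G (P z)) = z.2 by move=> /P1[].
have i1 (x s : R) : der (fun s : R => x + s) s 1.
  by apply: (dr_eq (dr_add (dr_cst x s) (dr_id s))); rewrite add0r.
exists (fun s => P (cRe (G q) + s, cIm (G q))), (fun s => P (cRe (G q), cIm (G q) + s)).
have n0 : \forall s \near (0 : R), `|s| < r.
  by apply/nbhs_ballP; exists r => // s; rewrite /ball /= sub0r normrN.
split.
- by rewrite addr0.
- by rewrite addr0.
- apply: filterS n0 => s sr.
  have zB : ball (cRe (G q), cIm (G q)) r (cRe (G q) + s, cIm (G q)).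
    by split; rewrite /ball /= ?subrr ?normr0// opprD addNKr normrN.
  have [c a b] := @branch_der _ _ P (reC G) (imC G) (fun s => cRe (G q) + s) (fun=> cIm (G q)) s _ _
    (P2 _ zB) (branch_near P1' zB) (i1 _ s) (dr_cst _ s).
  by split; [exact: c|split].
- apply: filterS n0 => s sr.
  have zB : ball (cRe (G q), cIm (G q)) r (cRe (G q), cIm (G q) + s).
    by split; rewrite /ball /= ?subrr ?normr0// opprD addNKr normrN.
  have [c a b] := @branch_der _ _ P (reC G) (imC G) (fun=> cRe (G q)) (fun s => cIm (G q) + s) s _ _
    (P2 _ zB) (branch_near P1' zB) (dr_cst _ s) (i1 _ s).
  by split; [exact: c|split].
Qed.

Variable q : S.

(* [rot_H] is the primitive vanishing at [q] of the form [rot_m dG], where the unitary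
   rotation sends [dF/dG] to [rot_g = rot_n / rot_m], which vanishes at [q]. *)
Definition rot_a : R[i] := ((Num.sqrt (1 + nsq (dG F q)))^-1)%:C.
Definition rot_b : R[i] := dG F q * rot_a.
Definition rot_m p : R[i] := rot_a + conjc rot_b * dG F p.
Definition rot_n p : R[i] := rot_a * dG F p - rot_b.
Definition rot_H p : R[i] := 1 * (rot_a * G p + conjc rot_b * F p) + 1 * - (rot_a * G q + conjc rot_b * F q).
Definition rot_g p : R[i] := rot_n p / rot_m p.
(** The condition |rot_g| < 1 written without division, so that it contains [rot_m p != 0]. With
    [rot_mn] it makes |rot_m|^2 at least half of 1 + |nu|^2. *)
Definition rot_good p := nsq (rot_n p) < nsq (rot_m p).

Lemma rot_ab : nsq rot_a + nsq rot_b = 1.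
Proof.
have h : 0 <= nsq (dG F q) by exact: nsq_ge0.
have p0 : 0 < 1 + nsq (dG F q) by lra.
have -> : nsq rot_a = (1 + nsq (dG F q))^-1.
  by rewrite /nsq /rot_a /= [0 ^+ 2]expr0n /= addr0 exprVn sqr_sqrtr// ltW.
rewrite /rot_b nsqM.
have -> : nsq rot_a = (1 + nsq (dG F q))^-1.
  by rewrite /nsq /rot_a /= [0 ^+ 2]expr0n /= addr0 exprVn sqr_sqrtr// ltW.
by field; exact: lt0r_neq0.
Qed.

(** The pair [(rot_m, rot_n)] is the image of (1, nu) under a unitary matrix. *)
Lemma rot_mn p : nsq (rot_m p) + nsq (rot_n p) = 1 + nsq (dG F p).
Proof.
have -> : 1 + nsq (dG F p) = (nsq rot_a + nsq rot_b) * (1 + nsq (dG F p)) by rewrite rot_ab mul1r.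
rewrite /rot_m /rot_n /rot_a; move: (Num.sqrt _)^-1 (dG F p) (rot_b) => a [x y] [u v].
rewrite /nsq /=; ring.
Qed.

Lemma rot_hol : hol G rot_H /\ forall p, dG rot_H p = rot_m p.
Proof.
have [hG dGG] := hol_G sX sY et.
have [h1 d1] := hol_lin sX sY et rot_a (conjc rot_b) hG hF.
have [h0 d0] := hol_cst sX sY et (- (rot_a * G q + conjc rot_b * F q)).
have [h2 d2] := hol_lin sX sY et 1 1 h1 h0.
by split => // p; rewrite d2 d1 d0 dGG mulr0 addr0 mul1r mulr1.
Qed.

Lemma rot_Hq : rot_H q = 0.
Proof. by rewrite /rot_H !mul1r subrr. Qed.

Lemma rot_nq : rot_n q = 0.
Proof. by rewrite /rot_n /rot_b mulrC subrr. Qed.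

Lemma rot_good_m p : rot_good p -> rot_m p != 0.
Proof. by rewrite -nsq_gt0 => /(le_lt_trans (nsq_ge0 _)). Qed.

Lemma rot_goodq : rot_good q.
Proof.
rewrite /rot_good; have := rot_mn q; rewrite rot_nq.
have -> : nsq (0 : R[i]) = 0 by apply/eqP; rewrite nsq_eq0.
by have := nsq_ge0 (dG F q); lra.
Qed.

Lemma rot_good_le p : rot_good p -> 1 + nsq (dG F p) <= 2 * nsq (rot_m p).
Proof. by rewrite /rot_good -rot_mn; lra. Qed.

Lemma nsq_smooth_cont (h : S -> R[i]) p : csmooth h -> {for p, continuous (fun p => nsq (h p))}.
Proof.
move=> [s1 s2]; have c1 : {for p, continuous (reC h)} by exact: smooth_cont.
have c2 : {for p, continuous (imC h)} by exact: smooth_cont.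
exact: (cvgD (cvgM c1 c1) (cvgM c2 c2)).
Qed.

Lemma rot_m_cont p : {for p, continuous (fun p => nsq (rot_m p))}.
Proof.
have [h d] := rot_hol; have [s _ _] := hol_dG sX sY et h.
have -> : (fun p => nsq (rot_m p)) = (fun p => nsq (dG rot_H p)) by apply/funext => x; rewrite d.
exact: nsq_smooth_cont.
Qed.

Lemma rot_n_cont p : {for p, continuous (fun p => nsq (rot_n p))}.
Proof.
have [s _ _] := hol_dG sX sY et hF.
have -> : (fun p => nsq (rot_n p)) = (fun p => nsq (rot_a * dG F p + (- 1) * rot_b)).
  by apply/funext => x; rewrite mulN1r.
apply: (@nsq_smooth_cont (fun p => rot_a * dG F p + (- 1) * rot_b)).
exact: csmooth_lin s (csmooth_cst _ _).
Qed.

Lemma rot_good_open p : rot_good p -> nbhs p rot_good.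
Proof.
move=> gp.
have c : {for p, continuous (fun p => nsq (rot_m p) - nsq (rot_n p))} by exact: (cvgB (@rot_m_cont p) (@rot_n_cont p)).
have : \forall x \near p, 0 < nsq (rot_m x) - nsq (rot_n x) by apply: (cvgr_gt _ c); rewrite subr_gt0.
by apply: filterS => x; rewrite subr_gt0.
Qed.

Lemma rot_good_J p : rot_good p -> J (chart_at p) (reC rot_H) (imC rot_H) p != 0.
Proof. by move=> /rot_good_m gp; have [h d] := rot_hol; rewrite J_hol// d mulf_neq0 ?et// nsq_eq0. Qed.

(** The rotation has determinant 1, so d(rot_g)/dG = nu' / rot_m^2, and dividing by dH/dG = rot_m
    gives the third power. *)
Lemma rot_curve (g : R -> S) s e : {for s, continuous g} -> rot_good (g s) -> cder (rot_H \o g) s e ->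
  [/\ cder (G \o g) s (e / rot_m (g s)), cder (F \o g) s (e / rot_m (g s) * dG F (g s)) &
   cder (rot_g \o g) s (e * (dG (dG F) (g s) / rot_m (g s) ^+ 3))].
Proof.
move=> cg gd ce; have [h d] := rot_hol; have m0 := rot_good_m gd.
have cG : cder (G \o g) s (e / rot_m (g s)) by rewrite -d; apply: hol_comp_cder => //; rewrite d.
split; [exact: cG|exact: (hol_cder sX sY et hF cg cG)|].
have cn := hol_cder sX sY et (hol_dG sX sY et hF) cg cG.
have c1 := cdr_add (cdr_scale rot_a cn) (cdr_cst (- rot_b) s).
have c2 := cdr_add (cdr_cst rot_a s) (cdr_scale (conjc rot_b) cn).
have c3 := @cdr_mul _ _ _ _ _ _ c1 (@cdr_inv _ (fun s => rot_m (g s)) s _ m0 c2).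
apply: (cdr_eq c3).
have ab : rot_a * rot_m (g s) - conjc rot_b * rot_n (g s) = 1.
  have <- : rot_a ^+ 2 + conjc rot_b * rot_b = 1.
    have := rot_ab; rewrite /rot_a; move: (Num.sqrt _)^-1 (rot_b) => a [u v] /= E.
    by apply: complex_eq; rewrite /= -?E /nsq /=; ring.
  by rewrite /rot_m /rot_n; ring.
have -> : rot_a * (dG F \o g) s - rot_b = rot_n (g s) by [].
transitivity (e * (dG (dG F) (g s) / rot_m (g s) ^+ 3) * (rot_a * rot_m (g s) - conjc rot_b * rot_n (g s))); last by rewrite ab mulr1.
move: m0; move: (rot_m (g s)) (rot_n (g s)) (dG (dG F) (g s)) (conjc rot_b) rot_a => m n N b a m0.
by field.
Qed.

End rotation.

(** * Growth of a density satisfying a curvature inequality *)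

Section growth.
Variables (R : realType) (S : orientedSurface R) (psi : improperAffineFront S).
Variables (F G : S -> R[i]).
Hypotheses (sF : csmooth F) (sG : csmooth G).
Hypothesis metricE : forall p v, dtau2 psi p v = 2 * (nsq (cdiff F p v) + nsq (cdiff G p v)).
Hypothesis et : forall p, J (chart_at p) (reC G) (imC G) p != 0.
Hypothesis cpl : weakly_complete psi.
Hypothesis hF : hol G F.
Local Notation nu := (dG G F).
Local Notation nu1 := (dG G (dG G F)).
Variables (f u : S -> R) (C c0 : R).
Hypotheses (C0 : 0 < C) (c00 : 0 < c0).
Hypotheses (fC : forall p, {for p, continuous f}) (f0 : forall p, 0 <= f p).
Hypothesis fu : forall p, 0 < f p -> f p = expR (u p).
Hypothesis HK : forall p, nsq (nu1 p) <= C * f p * (1 + nsq (nu p)) ^+ 3.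
Hypothesis HL : forall (g1 g2 : R -> S) p, 0 < f p -> g1 0 = p -> g2 0 = p ->
  (\forall s \near (0 : R), {for s, continuous g1} /\ cder (G \o g1) s 1) ->
  (\forall s \near (0 : R), {for s, continuous g2} /\ cder (G \o g2) s (0 +i* 1)) ->
  exists b1 b2 l, lap g1 g2 p u b1 b2 l /\ c0 * f p * (1 + nsq (nu p)) <= l.

Section box.
Variables (q : S) (eps B : R).
Hypotheses (eps0 : 0 < eps) (epsB : 32 * eps ^+ 2 * C * B <= 1) (fq : 0 < f q).
Hypothesis fB : forall q', joined F G q q' (3 * eps) -> f q' <= B.
Local Notation H := (rot_H F G q).
Local Notation mq := (rot_m F G q).
Local Notation nq := (rot_n F G q).
Local Notation good := (rot_good F G q).
Local Notation SL := (star_lift (reC H) (imC H) q (good)).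
Definition box (e : R) : set (R * R) := [set w | `|w.1| <= e /\ `|w.2| <= e].

Lemma box_sq e w : box e w -> w.1 ^+ 2 + w.2 ^+ 2 <= 2 * e ^+ 2.
Proof.
move=> [h1 h2]; have e0 : 0 <= e by exact: le_trans h1.
have k (x : R) : `|x| <= e -> x ^+ 2 <= e ^+ 2 by move=> h; rewrite -real_normK ?num_real// ler_sqr ?nnegrE.
by have := k _ h1; have := k _ h2; lra.
Qed.

Lemma box_dil e w t : box e w -> 0 <= t <= 1 -> box e (dil t w).
Proof.
move=> [h1 h2] /andP[t0 t1].
by split; rewrite /= normrM (ger0_norm t0); [apply: le_trans h1|apply: le_trans h2]; rewrite ler_piMl.
Qed.

Lemma dom_dil O P (w : R * R) (r t : R) : SL O P -> 0 <= r <= t -> O (dil t w) -> O (dil r w).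
Proof.
move=> [z0 _ _ st _] /andP[r0 rt] Ot; have [t0|tn] := eqVneq t 0.
  by move: r0 rt Ot; rewrite t0 => r0 rt; have -> : r = 0 by apply/eqP; rewrite eq_le r0 rt.
have tp : 0 < t by rewrite lt_def tn (le_trans r0 rt).
rewrite (_ : dil r w = dil (r / t) (dil t w)); last by rewrite dilM divfK.
by apply: st => //; rewrite divr_ge0 ?(ltW tp)//= ler_pdivrMr// mul1r.
Qed.

(** Here d tau^2 = 2 (1 + |nu|^2) |dG|^2 and |dH|^2 = |rot_m|^2 |dG|^2, so [rot_good_le] gives d tau
    <= 2 |dH|. *)
Lemma rot_curve_joined (g : R -> S) s a : {for s, continuous g} -> good (g s) -> cder (H \o g) s a ->
  exists b c, [/\ cder (F \o g) s b, cder (G \o g) s c & 2 * (nsq b + nsq c) <= 2 ^+ 2 * nsq a].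
Proof.
move=> cg gd ca; have [cG cF _] := rot_curve sG et hF cg gd ca.
exists (a / mq (g s) * nu (g s)), (a / mq (g s)); split; [exact: cF|exact: cG|].
rewrite !nsqM nsqV.
have m0 : 0 < nsq (mq (g s)) by rewrite nsq_gt0; exact: rot_good_m.
have le := rot_good_le gd.
have -> : 2 * (nsq a / nsq (mq (g s)) * nsq (nu (g s)) + nsq a / nsq (mq (g s))) =
   nsq a * (2 * (1 + nsq (nu (g s))) / nsq (mq (g s))) by ring.
rewrite mulrC; apply: ler_wpM2r; first exact: nsq_ge0.
by rewrite ler_pdivrMr// expr2; lra.
Qed.

Lemma lift_joined O P (w : R * R) (s t : R) : SL O P -> box eps w -> 0 <= s <= t -> O (dil t w) ->
  joined F G (P (dil s w)) (P (dil t w)) (3 * eps * (t - s)).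
Proof.
move=> hP wb /andP[s0 st] Ot; have [_ _ nO _ HP] := hP.
have [hH _] := rot_hol sG et hF q; have [sH _ _] := hH.
have ts0 : 0 <= t - s by rewrite subr_ge0.
(* A point of the square has modulus at most sqrt 2 times [eps], and [3 / 2] exceeds sqrt 2. The
   factor 2 between d tau and |dH| then yields [3 * eps]. *)
have l0 : 0 <= 3 / 2 * eps * (t - s) by rewrite mulr_ge0// mulr_ge0 ?ltW// divr_ge0.
have sq : (dil (t - s) w).1 ^+ 2 + (dil (t - s) w).2 ^+ 2 <= (3 / 2 * eps * (t - s)) ^+ 2.
  rewrite /= !exprMn -mulrDr mulrC; apply: ler_wpM2r; first exact: sqr_ge0.
  apply: (le_trans (box_sq wb)); have := sqr_ge0 eps; rewrite -exprMn; nra.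
have Q := @joined_seg R S F G H P (dil s w) (dil (t - s) w) 2 _ sH (ler0n R 2) l0 sq.
have -> : P (dil t w) = P ((dil s w).1 + (dil (t - s) w).1, (dil s w).2 + (dil (t - s) w).2).
  by congr P; rewrite /dil /=; congr pair; ring.
apply: (joined_weaken (Q _)); last by lra.
move=> r /andP[r0 r1].
have -> : ((dil s w).1 + r * (dil (t - s) w).1, (dil s w).2 + r * (dil (t - s) w).2) = dil (s + r * (t - s)) w.
  by rewrite /dil /=; congr pair; ring.
have Or : O (dil (s + r * (t - s)) w) by apply: (dom_dil hP _ Ot); apply/andP; split; nra.
have [c x y gd] := HP _ Or; split.
- exact: c.
- by apply: filterS (nO _ Or) => z /HP[_ -> ->].
- exact: (rot_good_J sG et hF gd).
- move=> g s' a cg E ca; apply: (rot_curve_joined cg _ ca); rewrite E; exact: gd.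
Qed.

(** The rotated Gauss map vanishes at [q], and its squared derivative with respect to H is |nu'|^2 /
    |rot_m|^6, at most [8 * C * B] by the curvature bound and [rot_good_le]. The conclusion
    |rot_g|^2 <= 1/2 leaves a margin below 1 that survives passage to a limit. *)
Lemma lift_ray O P (w : R * R) (t : R) : SL O P -> box eps w -> 0 <= t <= 1 -> O (dil t w) ->
  2 * nsq (nq (P (dil t w))) <= nsq (mq (P (dil t w))).
Proof.
move=> hP wb /andP[t0 t1] Ot; have [_ P0 nO st HP] := hP.
have gd : good (P (dil t w)) by have [] := HP _ Ot.
have m0 : 0 < nsq (mq (P (dil t w))) by rewrite nsq_gt0; exact: rot_good_m.
have cb := @cder_bound R (fun s => rot_g F G q (P (dil s w)))
  (fun s => (w.1 +i* w.2) * (nu1 (P (dil s w)) / mq (P (dil s w)) ^+ 3)) (1 / 2) t.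
suff : nsq (rot_g F G q (P (dil t w))) <= 1 / 2.
  by rewrite /rot_g nsqM nsqV ler_pdivrMr//; lra.
apply: cb; [by rewrite t0 t1| |]; last first.
  by rewrite dil0 P0 /rot_g rot_nq mul0r.
move=> s /andP[s0 stt].
have Os : O (dil s w) by apply: (dom_dil hP _ Ot); rewrite s0 stt.
have [c x y gs] := HP _ Os.
(* The part of the ray up to [s] has length at most [3 * eps], so its end is a point to which the
   bound [B] applies. *)
have ls : f (P (dil s w)) <= B.
  apply: fB; rewrite -P0 -(dil0 w).
  apply: (joined_weaken (lift_joined hP wb _ Os)); first by rewrite lexx s0.
  by rewrite subr0 ler_piMr ?mulr_ge0 ?(ltW eps0)// (le_trans stt t1).
have du (d : R) : der (fun s : R => s * d) s d.
  by apply: (dr_eq (dr_mul (dr_id s) (dr_cst d s))); ring.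
have nP : \forall z \near (s * w.1, s * w.2), cRe (H (P z)) = z.1 /\ cIm (H (P z)) = z.2.
  by apply: filterS (nO _ Os) => z /HP[_ -> ->].
have [cg a b] := @branch_der _ _ P (reC H) (imC H)
  (fun s => s * w.1) (fun s => s * w.2) s _ _ c nP (du w.1) (du w.2).
have [_ _ cr] := @rot_curve _ _ F G sG et hF q (fun s => P (dil s w)) s (w.1 +i* w.2) cg gs (conj a b).
split; first exact: cr.
rewrite nsqM nsqM nsqV.
have m3 : nsq (mq (P (dil s w)) ^+ 3) = nsq (mq (P (dil s w))) ^+ 3.
  by rewrite !exprS !expr0 !mulr1 !nsqM.
rewrite m3.
have ms : 0 < nsq (mq (P (dil s w))) by rewrite nsq_gt0; exact: rot_good_m.
have ww : nsq (w.1 +i* w.2) <= 2 * eps ^+ 2 by rewrite /nsq /=; exact: box_sq.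
have B0 : 0 <= B by apply: le_trans ls; exact: f0.
have kk : nsq (nu1 (P (dil s w))) / nsq (mq (P (dil s w))) ^+ 3 <= 8 * C * B.
  rewrite ler_pdivrMr ?exprn_gt0//.
  apply: (le_trans (HK _)).
  have h1 : (1 + nsq (nu (P (dil s w)))) ^+ 3 <= (2 * nsq (mq (P (dil s w)))) ^+ 3.
    rewrite lerXn2r// ?nnegrE; [|by rewrite mulr_ge0// ltW|exact: rot_good_le].
    by have := nsq_ge0 (nu (P (dil s w))); lra.
  have h2 : C * f (P (dil s w)) <= C * B by rewrite ler_pM2l.
  have h3 : 0 <= C * f (P (dil s w)) by rewrite mulr_ge0 ?(ltW C0).
  apply: (le_trans (ler_pM h3 _ h2 h1)).
    by apply: exprn_ge0; have := nsq_ge0 (nu (P (dil s w))); lra.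
  rewrite exprMn; have -> : C * B * (2 ^+ 3 * nsq (mq (P (dil s w))) ^+ 3) = 8 * C * B * nsq (mq (P (dil s w))) ^+ 3 by ring.
  exact: lexx.
apply: (le_trans (ler_pM (nsq_ge0 _) _ ww kk)).
  by rewrite divr_ge0 ?nsq_ge0// exprn_ge0// nsq_ge0.
(* The squared velocity of the ray is at most [2 * eps ^+ 2]; the constant 32 in [epsB] is chosen to
   turn this product into 1/2. *)
have -> : 2 * eps ^+ 2 * (8 * C * B) = (32 * eps ^+ 2 * C * B) / 2 by field.
by rewrite ler_pM2r ?invr_gt0//; exact: epsB.
Qed.

(** The lifted ray has finite length, so completeness gives an end point. The closed inequality of
    [lift_ray] holds there too, and implies the open condition [good] because [rot_m] and [rot_n] do
    not vanish together. *)
Lemma lift_limit O P (w : R * R) : SL O P -> box eps w -> (forall t, 0 <= t < 1 -> O (dil t w)) ->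
  exists2 p, good p & forall N : set S, nbhs p N ->
   exists M : nat, forall m : nat, (M <= m)%N -> N (P (dil (1 - m.+1%:R^-1) w)).
Proof.
move=> hP wb ray; have [_ P0 nO st HP] := hP.
have t01 := @harmonic_itv R.
have [||p pP] := @joined_complete R S psi F G sF sG metricE et cpl (fun m => P (dil (1 - m.+1%:R^-1) w)) (fun m => 3 * eps * m.+1%:R^-1).
- move=> m k mk; have le : k.+1%:R^-1 <= m.+1%:R^-1 :> R by rewrite lef_pV2 ?posrE ?ltr0n// ler_nat.
  have k0 : 0 <= k.+1%:R^-1 :> R by rewrite invr_ge0 ler0n.
  apply: (joined_weaken (lift_joined hP wb _ (ray _ (t01 k)))).
    by have /andP[-> _] := t01 m; rewrite /= lerB.
  rewrite ler_pM2l ?mulr_gt0//; move: le k0; move: (k.+1%:R^-1) (m.+1%:R^-1) => x y; lra.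
- move=> e e0; have e3 : 0 < 3 * eps by rewrite mulr_gt0.
  have : \forall m \near \oo, (harmonic m : R) < e / (3 * eps).
    by apply: (cvgr_lt _ (@cvg_harmonic R)); rewrite divr_gt0.
  move=> [N _ NP]; exists N => m /NP /=; rewrite /harmonic /= => h.
  by rewrite mulrC -ltr_pdivlMr.
exists p; last exact: pP.
have cv : (fun m : nat => P (dil (1 - m.+1%:R^-1) w)) @ \oo --> p by move=> N /pP[M HM]; exists M.
have c : {for p, continuous (fun p => nsq (mq p) - 2 * nsq (nq p))}.
  exact: (cvgB (@rot_m_cont _ _ F G sG et hF q p) (cvgM (cvg_cst (2 : R)) (@rot_n_cont _ _ F G sG et hF q p))).
have cc : (fun m : nat => nsq (mq (P (dil (1 - m.+1%:R^-1) w))) - 2 * nsq (nq (P (dil (1 - m.+1%:R^-1) w)))) @ \oo -->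
   (nsq (mq p) - 2 * nsq (nq p)).
  exact: (cvg_comp _ _ cv c).
have ge : 0 <= nsq (mq p) - 2 * nsq (nq p).
  apply: (cvgr_to_ge cc); apply: filterE => m; rewrite subr_ge0; apply: lift_ray hP wb _ (ray _ (t01 m)).
  by have /andP[-> /ltW ->] := t01 m.
have := rot_mn F G q p; have := nsq_ge0 (nu p); have := nsq_ge0 (nq p); rewrite /rot_good; lra.
Qed.

Lemma lift_box : exists O P, SL O P /\ box eps `<=` O.
Proof.
have [hH _] := rot_hol sG et hF q; have [[s1 s2] _ _] := hH.
apply: star_lift_cover => //.
- by rewrite rot_Hq.
- by rewrite rot_Hq.
- by move=> p; exact: rot_good_open.
- exact: rot_goodq.
- by move=> p; exact: rot_good_J.
- by move=> w t; exact: box_dil.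
- exact: lift_limit.
Qed.

(** Both sides are near [P w] and have the same value of H, which is injective there. It carries a
    maximum found on the square over to the coordinate lines of [G] on the surface. *)
Lemma lift_near_id O P (w : R * R) (g : R -> S) : SL O P -> O w -> g 0 = P w -> {for 0, continuous g} ->
  \forall s \near (0 : R), P (cRe (H (g s)), cIm (H (g s))) = g s.
Proof.
move=> hP Ow g0 cg; have [_ _ nO _ HP] := hP; have [cP x y gd] := HP _ Ow.
have [hH _] := rot_hol sG et hF q; have [[s1 s2] _ _] := hH.
have [_ [_ [_ _ _ _ [N nN Ninj]]]] := loc_inverse (chart_at_atlas _) (chart_at_dom (P w)) s1 s2 (rot_good_J sG et hF gd) filterT.
have c1 := smooth_comp_cont s1 cg; have c2 := smooth_comp_cont s2 cg.
have e0 : (cRe (H (g 0)), cIm (H (g 0))) = w by rewrite g0 x y; case: (w).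
have cP' : {for (cRe (H (g 0)), cIm (H (g 0))), continuous P} by rewrite e0.
have cc := pair_comp_cont c1 c2 cP'.
have n1 : \forall s \near (0 : R), N (P (cRe (H (g s)), cIm (H (g s)))) by apply: cc; rewrite e0.
have n2 : \forall s \near (0 : R), N (g s) by apply: cg; rewrite g0.
have n3 : \forall s \near (0 : R), O (cRe (H (g s)), cIm (H (g s))).
  apply: (@pair_comp_cont R R _ (fun s => cRe (H (g s))) (fun s => cIm (H (g s))) (fun z => z) 0 c1 c2 cvg_id).
  by rewrite e0; exact: nO.
apply: (filter_app _ _ n3); apply: (filter_app _ _ n2); apply: filterS n1 => s h1 h2 h3.
by have [_ x' y' _] := HP _ h3; apply: Ninj; rewrite ?inE.
Qed.

(** At such a maximum the Laplacian of [u - a |H|^2] would be at most 0. It is at least c0 f (1 +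
    |nu|^2) - 4 a |rot_m|^2, which is positive because |rot_m|^2 <= 1 + |nu|^2. *)
Lemma no_interior_max O P (w : R * R) (a : R) : SL O P -> O w -> 0 < a -> 0 < f (P w) -> 4 * a < c0 * f (P w) ->
  (\forall z \near w, f (P z) * expR (- a * (z.1 ^+ 2 + z.2 ^+ 2)) <= f (P w) * expR (- a * (w.1 ^+ 2 + w.2 ^+ 2))) -> False.
Proof.
move=> hP Ow a0 fw aw.
pose Q (z : R * R) := f (P z) * expR (- a * (z.1 ^+ 2 + z.2 ^+ 2)) <= f (P w) * expR (- a * (w.1 ^+ 2 + w.2 ^+ 2)).
move=> mx; have [_ _ nO _ HP] := hP; have [cP x y gd] := HP _ Ow.
have [hH dH] := rot_hol sG et hF q; have [[s1 s2] _ _] := hH.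
have [g1 [g2 [g10 g20 g1P g2P]]] := lines_near sG et (P w).
have nearU (g : R -> S) : g 0 = P w -> {for 0, continuous g} ->
    \forall s \near (0 : R), u (g s) + (- a) * nsq (H (g s)) <= u (P w) + (- a) * nsq (H (P w)).
  move=> g0 cg; have n1 := lift_near_id hP Ow g0 cg.
  have c1 := smooth_comp_cont s1 cg; have c2 := smooth_comp_cont s2 cg.
  have e0 : (cRe (H (g 0)), cIm (H (g 0))) = w by rewrite g0 x y; case: (w).
  have cz := @pair_comp_cont R R _ (fun s => cRe (H (g s))) (fun s => cIm (H (g s))) (fun z => z) 0 c1 c2 cvg_id.
  have n2 : \forall s \near (0 : R), Q (cRe (H (g s)), cIm (H (g s))) 
    by apply: (cz Q); rewrite /= e0; exact: mx.
  have cf : {for 0, continuous (f \o g)} by apply: continuous_comp => //; exact: fC.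
  have n3 : \forall s \near (0 : R), 0 < f (g s) by apply: (cvgr_gt _ cf); rewrite /= g0.
  apply: (filter_app _ _ n3); apply: (filter_app _ _ n2); apply: filterS n1 => s h1 h2 h3.
  move: h2; rewrite /Q /= h1 (fu h3) (fu fw) -!expRD ler_expR.
  by rewrite /nsq x y.
have [b1 [b2 [l [lu lb]]]] := HL fw g10 g20 g1P g2P.
have [d1 [d2 [ln _]]] := lap_nsq sG.1 sG.2 et g10 g20 g1P g2P hH.
have lU := lap_add lu (lap_scale (- a) ln).
have := lap_max g10 g20 lU (nearU g1 g10 (nbhs_singleton g1P).1) (nearU g2 g20 (nbhs_singleton g2P).1).
rewrite dH; have := rot_mn F G q (P w); have := nsq_ge0 (nq (P w)); have := nsq_ge0 (nu (P w)).
move: lb aw; move: (c0 * _) (nsq (nu _)) (nsq (rot_n _ _ _ _)) (nsq (rot_m _ _ _ _)) => A X N M lb aw X0 N0 E le.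
have M1 : M <= 1 + X by lra.
nra.
Qed.

(** The maximum of [phi] over the closed square is at least its value [f q] at the centre and cannot
    be attained inside, so it is attained where |H| >= eps. Undoing the exponential weight there
    gives the gain. *)
Lemma growth_step : exists2 q', joined F G q q' (3 * eps) & f q * (1 + c0 * f q * eps ^+ 2 / 5) <= f q'.
Proof.
have [Om [P [hP bO]]] := lift_box; have [_ P0 nO _ HP] := hP.
(* A constant below [c0 * f q / 4], so that [4 * a < c0 * f (P w)] as soon as [f (P w) >= f q]. *)
pose a := c0 * f q / 5; have a0 : 0 < a by rewrite divr_gt0 ?mulr_gt0.
pose phi (w : R * R) := f (P w) * expR (- a * (w.1 ^+ 2 + w.2 ^+ 2)).
pose K : set (R * R) := `[- eps, eps]%classic `*` `[- eps, eps]%classic.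
have KE w : K w <-> box eps w by rewrite /K /box /= !in_itv /= !ler_norml.
have b0 : box eps (0, 0) by split; rewrite /= normr0 ltW.
have cphi (w : R * R) : w \in K -> {for w, continuous phi}.
  rewrite inE => /KE /bO /HP[cP _ _ _].
  have cf : {for w, continuous (fun z => f (P z))} by exact: (@continuous_comp _ _ _ P f w cP (@fC (P w))).
  have c1 : {for w, continuous (fun z : R * R => z.1)} by exact: cvg_fst.
  have c2 : {for w, continuous (fun z : R * R => z.2)} by exact: cvg_snd.
  have ce : {for w, continuous (fun z : R * R => - a * (z.1 ^+ 2 + z.2 ^+ 2))}.
    exact: (cvgM (cvg_cst (- a)) (cvgD (cvgM c1 c1) (cvgM c2 c2))).
  have cx : {for w, continuous (fun z : R * R => expR (- a * (z.1 ^+ 2 + z.2 ^+ 2)))}.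
    exact: (@continuous_comp _ _ _ _ (@expR R) w ce (@continuous_expR R _)).
  exact: (cvgM cf cx).
have [||| w Kw mx] := @compact_EVT_max _ R phi K.
- by exists (0, 0); apply/KE.
- by apply: compact_setX; exact: segment_compact.
- exact: continuous_in_subspaceT.
have wb : box eps w by apply/KE; rewrite inE in Kw.
have Ow := bO _ wb.
have E0 : phi (0, 0) = f q by rewrite /phi P0 /= expr0n /= addr0 mulr0 expR0 mulr1.
have fqw : f q <= phi w by rewrite -E0; apply: mx; rewrite inE; apply/KE.
have ex1 : expR (- a * (w.1 ^+ 2 + w.2 ^+ 2)) <= 1.
  by rewrite -expR0 ler_expR mulNr oppr_le0 mulr_ge0 ?(ltW a0)// addr_ge0 ?sqr_ge0.
have fw : f q <= f (P w) by apply: (le_trans fqw); rewrite /phi ler_piMr.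
have fw0 : 0 < f (P w) by exact: lt_le_trans fq fw.
exists (P w).
  have := @lift_joined Om P w 0 1 hP wb; rewrite dil0 dil1 P0 subr0 mulr1; apply => //.
  by rewrite lexx ler01.
(* It is enough to exclude the open disc inscribed in the square, all of whose points are interior
   to it. *)
have bd : eps ^+ 2 <= w.1 ^+ 2 + w.2 ^+ 2.
  rewrite leNgt; apply/negP => lt.
  apply: (no_interior_max hP Ow a0 fw0).
    rewrite /a; have := ler_pM2l c00 (f q) (f (P w)); rewrite fw => cf.
    have : 0 < c0 * f q by rewrite mulr_gt0.
    by move: cf; move: (c0 * f q) (c0 * f (P w)) => A A'; lra.
  have k (x y : R) : x ^+ 2 + y ^+ 2 < eps ^+ 2 -> `|x| < eps.
    move=> h; rewrite ltNge; apply/negP => hx.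
    have := ler_pM (ltW eps0) (ltW eps0) hx hx; rewrite -!expr2 real_normK ?num_real//.
    by have := sqr_ge0 y; lra.
  have w1 := k _ _ lt; have w2 : `|w.2| < eps by apply: (k _ w.1); rewrite addrC.
  have c1 : {for w, continuous (fun z : R * R => `|z.1|)} by exact: (cvg_norm cvg_fst).
  have c2 : {for w, continuous (fun z : R * R => `|z.2|)} by exact: (cvg_norm cvg_snd).
  have n1 : \forall z \near w, `|z.1| < eps by exact: (cvgr_lt _ c1).
  have n2 : \forall z \near w, `|z.2| < eps by exact: (cvgr_lt _ c2).
  apply: (filter_app _ _ n2); apply: filterS n1 => z h1 h2.
  by apply: mx; rewrite inE; apply/KE; split; rewrite ltW.
have le : f q * expR (a * (w.1 ^+ 2 + w.2 ^+ 2)) <= f (P w).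
  have := ler_wpM2r (expR_ge0 (a * (w.1 ^+ 2 + w.2 ^+ 2))) fqw.
  have -> // : phi w * expR (a * (w.1 ^+ 2 + w.2 ^+ 2)) = f (P w).
  by rewrite /phi -[LHS]mulrA -expRD mulNr addNr expR0 mulr1.
apply: (le_trans _ le); rewrite ler_pM2l//.
apply: (@le_trans _ _ (1 + a * eps ^+ 2)).
  by rewrite /a lerD2l [c0 * f q / 5 * _]mulrAC.
apply: (le_trans (expR_ge1Dx _)); rewrite ler_expR ler_pM2l//.
Qed.

End box.

(** If [f] stayed below [4 * f p] within the given distance, that value could serve as [B] in every
    growth step. The steps would then have the same size and multiply [f] each time by at least 1 +
    d, where d is independent of [p], and after finitely many of them the factor would exceed 4. *)
Lemma doubling : exists2 A : R, 0 < A & forall p, 0 < f p ->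
  exists2 q, joined F G p q (A / Num.sqrt (f p)) & 4 * f p <= f q.
Proof.
(* With eps^2 = 1 / (K C f(p)) and B = 4 f(p), the condition [epsB] reads 32 * 4 / K <= 1. *)
have [K K0 K128] : exists2 K : R, 0 < K & 32 * 4 / K <= 1.
  by exists (32 * 4); [lra|rewrite divff//; lra].
have KC : 0 < K * C by exact: mulr_gt0.
have KC5 : 0 < 5 * (K * C) by apply: mulr_gt0; [lra|exact: KC].
pose d := c0 / (5 * (K * C)).
have d0 : 0 < d by exact: (divr_gt0 c00 KC5).
have Kn : K != 0 by exact: lt0r_neq0.
have Cn : C != 0 by exact: lt0r_neq0.
have [N NP] : exists N : nat, 4 < (1 + d) ^+ N.+1.
  exists (Num.bound (4 / d)).
  have h : 4 / d < (Num.bound (4 / d))%:R.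
    by apply: le_lt_trans (archi_boundP _); rewrite ?ler_norm// divr_ge0// ltW.
  rewrite ltr_pdivrMr// in h.
  have bern (n : nat) : n%:R * d < (1 + d) ^+ n.+1.
    elim: n => [|n IH]; first by rewrite mul0r expr1; lra.
    rewrite exprS -natr1.
    have e1 : 1 <= (1 + d) ^+ n.+1 by apply: exprn_ege1; lra.
    move: IH e1; move: ((1 + d) ^+ n.+1) (n%:R) => x y IH e1; nra.
  exact: lt_trans (bern _).
have sC : 0 < Num.sqrt (K * C) by rewrite sqrtr_gt0.
have sCn : Num.sqrt (K * C) != 0 by exact: lt0r_neq0.
have N0 : 0 < N.+1%:R :> R by rewrite ltr0n.
have N3 : 0 < 3 * N.+1%:R :> R by apply: mulr_gt0; [lra|exact: N0].
(* The total length of [N.+1] growth steps of length [3 * eps], with the factor [f(p)^(-1/2)] of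
   [eps] taken out. *)
exists (3 * N.+1%:R / Num.sqrt (K * C)); first exact: (divr_gt0 N3 sC).
move=> p fp; apply: contrapT => no.
have fn : f p != 0 by exact: lt0r_neq0.
have sf : 0 < Num.sqrt (f p) by rewrite sqrtr_gt0.
have sfn : Num.sqrt (f p) != 0 by exact: lt0r_neq0.
pose eps := (Num.sqrt (K * C) * Num.sqrt (f p))^-1.
have eps0 : 0 < eps by rewrite invr_gt0; exact: mulr_gt0.
have eps2 : eps ^+ 2 = (K * C * f p)^-1.
  by rewrite /eps exprVn exprMn !sqr_sqrtr ?(ltW fp) ?(ltW KC).
have epsB : 32 * eps ^+ 2 * C * (4 * f p) <= 1.
  rewrite eps2 (_ : _ * _ = 32 * 4 / K)//; field.
  by rewrite Kn Cn fn.
have le4 q : joined F G p q (3 * eps * N.+1%:R) -> f q < 4 * f p.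
  move=> jq; rewrite ltNge; apply/negP => h; apply: no; exists q; last exact: h.
  apply: (joined_weaken jq); rewrite /eps; apply: eq_ler; field.
  by rewrite sCn sfn.
have e3 : 0 < 3 * eps by apply: mulr_gt0; [lra|exact: eps0].
(* Since [f q >= f p] the gain at [q] is at least the one at [p]. Everything within the next
   [3 * eps] of [q] is still within reach of [le4], which supplies the bound [4 * f p]. *)
have step n : (n <= N)%N -> exists2 q, joined F G p q (3 * eps * n.+1%:R) & f p * (1 + d) ^+ n.+1 <= f q.
  elim: n => [|n IH] nN.
    have fB q' : joined F G p q' (3 * eps) -> f q' <= 4 * f p.
      move=> j; apply: ltW; apply: le4; apply: (joined_weaken j).
      by rewrite ler_peMr ?ler1n// ltW.
    have [q jq le] := growth_step eps0 epsB fp fB.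
    exists q; first by rewrite mulr1.
    apply: le_trans le; rewrite expr1 ler_pM2l// lerD2l eps2 /d; apply: eq_ler; field.
    by rewrite Kn Cn fn.
  have [q jq fq] := IH (ltnW nN).
  have pw : 1 <= (1 + d) ^+ n.+1 by apply: exprn_ege1; lra.
  have fpq : f p <= f q by apply: le_trans fq; rewrite ler_peMr// ltW.
  have fq0 : 0 < f q by exact: lt_le_trans fpq.
  have jq' q' : joined F G q q' (3 * eps) -> joined F G p q' (3 * eps * n.+2%:R).
    by move=> j; apply: (joined_weaken (joined_trans jq j)); rewrite -[n.+2%:R]natr1 mulrDr mulr1.
  have fB q' : joined F G q q' (3 * eps) -> f q' <= 4 * f p.
    move=> /jq' j; apply: ltW; apply: le4; apply: (joined_weaken j).
    by rewrite (ler_pM2l e3) ler_nat.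
  have [r jr le] := growth_step eps0 epsB fq0 fB.
  exists r; first exact: jq'.
  apply: le_trans le; rewrite exprSr mulrA; apply: ler_pM => //.
  - by rewrite mulr_ge0 ?(ltW fp)// exprn_ge0//; lra.
  - by lra.
  rewrite lerD2l.
  have -> : d = c0 * f p * eps ^+ 2 / 5 by rewrite eps2 /d; field; rewrite Kn Cn fn.
  by rewrite ler_pM2r ?invr_gt0// ler_wpM2r ?sqr_ge0// ler_pM2l.
have [q jq fq] := step N (leqnn N).
have := le4 _ jq; rewrite ltNge => /negP; apply; apply: le_trans fq.
by rewrite mulrC ler_pM2l// ltW.
Qed.

Lemma density_eq0 p : f p = 0.
Proof.
apply/eqP; apply: contrapT => fn; have fp : 0 < f p by rewrite lt_def f0 andbT; apply/negP.
have [A A0 dbl] := doubling.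
have ex (q : S) : exists r, 0 < f q -> joined F G q r (A / Num.sqrt (f q)) /\ 4 * f q <= f r.
  have [h|_] := boolP (0 < f q); last by exists q.
  by have [r ? ?] := dbl _ h; exists r.
have [nx nxP] := choice ex.
pose v (n : nat) := iter n nx p.
have vP n : 4 ^+ n * f p <= f (v n).
  elim: n => [|n IH]; first by rewrite expr0 mul1r.
  have vn : 0 < f (v n) by apply: lt_le_trans IH; rewrite mulr_gt0// exprn_gt0.
  have [_ h] := nxP _ vn; apply: le_trans h; rewrite exprS -mulrA ler_pM2l//.
have v0 n : 0 < f (v n) by apply: lt_le_trans (vP n); rewrite mulr_gt0// exprn_gt0.
pose L := A / Num.sqrt (f p).
have sf : 0 < Num.sqrt (f p) by rewrite sqrtr_gt0.
have L0 : 0 < L by rewrite divr_gt0.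
have L2 : 0 < 2 * L by apply: mulr_gt0; [lra|exact: L0].
(* As [f] at least quadruples at each step, the admissible lengths are bounded by a geometric
   sequence of ratio 1/2. *)
have lv n : A / Num.sqrt (f (v n)) <= L * 2^-1 ^+ n.
  have h : 2 ^+ n * Num.sqrt (f p) <= Num.sqrt (f (v n)).
    have -> : 2 ^+ n * Num.sqrt (f p) = Num.sqrt (4 ^+ n * f p).
      rewrite sqrtrM ?exprn_ge0//; congr (_ * _).
      have -> : 4 ^+ n = (2 ^+ n) ^+ 2 :> R by rewrite exprAC; congr (_ ^+ n); rewrite expr2; ring.
      by rewrite sqrtr_sqr ger0_norm// exprn_ge0.
    exact: ler_wsqrtr.
  have sv : 0 < Num.sqrt (f (v n)) by rewrite sqrtr_gt0.
  have p2 : 0 < 2 ^+ n :> R by rewrite exprn_gt0.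
  rewrite /L -mulrA ler_pM2l// exprVn -invfM lef_pV2 ?posrE ?mulr_gt0//.
  by rewrite mulrC.
have jv n : joined F G (v n) (v n.+1) (L * 2^-1 ^+ n).
  by have [j _] := nxP _ (v0 n); exact: joined_weaken j (lv n).
have jmk m k : joined F G (v m) (v (m + k.+1)%N) (2 * L * (2^-1 ^+ m - 2^-1 ^+ (m + k.+1))).
  elim: k => [|k IH].
    rewrite addn1; apply: (joined_weaken (jv m)); rewrite exprS; move: (2^-1 ^+ m) => x.
    by apply: eq_ler; field.
  have := joined_trans IH (jv (m + k.+1)%N); rewrite !addnS => /joined_weaken; apply.
  rewrite [2^-1 ^+ (m + k).+2]exprS; move: (2^-1 ^+ (m + k).+1) => x.
  by apply: eq_ler; field.
have [||r rP] := @joined_complete R S psi F G sF sG metricE et cpl v (fun m => 2 * L * 2^-1 ^+ m).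
- move=> m k; rewrite leq_eqVlt => /orP[/eqP <-|mk].
    (* For equal indices the curve goes one step forward and comes back, of total length twice that
       step, which is the allowed bound. *)
    by apply: (joined_weaken (joined_trans (jv m) (joined_sym (jv m)))); apply: eq_ler; ring.
  have := jmk m (k - m.+1)%N; rewrite (_ : (m + (k - m.+1).+1)%N = k); last by rewrite addnS -addSn subnKC.
  move=> /joined_weaken; apply; rewrite (ler_pM2l L2).
  by rewrite lerBlDr lerDl exprn_ge0.
- move=> e e0.
  have h : `|2^-1 : R| < 1 by rewrite ger0_norm ?invr_ge0//; lra.
  have : \forall m \near \oo, (2^-1 ^+ m : R) < e / (2 * L).
    by apply: (cvgr_lt _ (cvg_expr h)); exact: (divr_gt0 e0 L2).
  move=> [N _ NP]; exists N => m /NP /= k.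
  by rewrite mulrC -ltr_pdivlMr.
have cr : {for r, continuous f} by exact: fC.
have n1 : \forall x \near r, f x < f r + 1 by apply: (cvgr_lt _ cr); rewrite ltrDl ltr01.
have [M MP] := rP _ n1.
have big (m : nat) : m%:R * f p <= f (v m).
  apply: le_trans (vP m); rewrite ler_pM2r//; elim: m => [|m IH]; first by rewrite expr0.
  rewrite exprS -natr1; have : 1 <= 4 ^+ m :> R by apply: exprn_ege1; lra.
  move: IH; move: (4 ^+ m) (m%:R) => x y; lra.
pose m := maxn M (Num.bound ((f r + 1) / f p)).
have := MP m (leq_maxl _ _); rewrite ltNge => /negP; apply; apply: le_trans (big m).
rewrite -ler_pdivrMr//; apply: (@le_trans _ _ (Num.bound ((f r + 1) / f p))%:R).
  by apply/ltW; apply: le_lt_trans (archi_boundP _); rewrite ?ler_norm// divr_ge0 ?(ltW fp)// addr_ge0.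
by rewrite ler_nat leq_maxr.
Qed.

End growth.

(** * The density of three omitted values *)

Section ineq.
Variable R : realType.
Implicit Types (y T Q d : R).

Lemma one_exp8_le y : 0 < y -> 1 + y ^+ 8 <= (1 + y) ^+ 8.
Proof.
move=> y0; have k (x : R) : 0 <= x -> 1 + x ^+ 2 <= (1 + x) ^+ 2 by move=> x0; nra.
have sq (a b : R) : 0 <= a -> a <= b -> a ^+ 2 <= b ^+ 2 by move=> a0 ab; rewrite ler_sqr ?nnegrE// (le_trans a0 ab).
have y2 : 0 <= y ^+ 2 by exact: sqr_ge0.
have -> : (1 + y) ^+ 8 = (((1 + y) ^+ 2) ^+ 2) ^+ 2 by rewrite -!exprM.
have h1 : 1 + y ^+ 2 <= (1 + y) ^+ 2 by apply: k; exact: ltW.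
have h2 : 1 + (y ^+ 2) ^+ 2 <= ((1 + y) ^+ 2) ^+ 2.
  by apply: (le_trans (k _ y2)); apply: sq => //; rewrite addr_ge0.
have y4 : 0 <= (y ^+ 2) ^+ 2 by exact: sqr_ge0.
have -> : y ^+ 8 = ((y ^+ 2) ^+ 2) ^+ 2 by rewrite -!exprM.
by apply: (le_trans (k _ y4)); apply: sq => //; rewrite addr_ge0.
Qed.

Lemma exp8_one_le y : 0 < y -> (1 + y) ^+ 8 <= 2 ^+ 8 * (1 + y ^+ 8).
Proof.
move=> y0; have y8 : 0 <= y ^+ 8 by rewrite exprn_ge0 ?ltW.
have p8 : 0 <= 2 ^+ 8 :> R by rewrite exprn_ge0.
have [y1|/ltW y1] := leP y 1.
  apply: (@le_trans _ _ (2 ^+ 8)); last by rewrite ler_peMr// lerDl.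
  by apply: lerXn2r; rewrite ?nnegrE; lra.
apply: (@le_trans _ _ ((2 * y) ^+ 8)); first by apply: lerXn2r; rewrite ?nnegrE; lra.
by rewrite exprMn ler_wpM2l// lerDr.
Qed.

(** With y = |z - a|^(1/4) the left side is 1 / (1 + |z - a|^2). Three such bounds produce the cube
    of 1 + |nu|^2 in the comparison with the curvature. *)
Lemma theta_lower y : 0 < y -> (1 + y ^+ 8)^-1 <= (1 + y) / y ^+ 7.
Proof.
move=> y0; have y7 : 0 < y ^+ 7 by rewrite exprn_gt0.
have y8 : 0 < 1 + y ^+ 8 by rewrite ltr_pwDl// exprn_ge0 ?ltW.
rewrite ler_pdivlMr// mulrC ler_pdivrMr//.
have [y1|/ltW y1] := leP y 1.
  have h : y ^+ 7 <= 1 by rewrite exprn_ile1// ltW.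
  have h8 : 0 < y ^+ 8 by rewrite exprn_gt0.
  by move: h h8; move: (y ^+ 7) (y ^+ 8) => a b; nra.
have e : y ^+ 8 = y * y ^+ 7 by rewrite exprS.
by rewrite e; move: y7; move: (y ^+ 7) => a; nra.
Qed.

(** The left side equals (1 + 1/y)^7. Away from its puncture a factor of the density thus decays
    like (1 + y)^(-6). *)
Lemma theta_upper y d : 0 < d -> d <= y -> (1 + y) / y ^+ 7 * (1 + y) ^+ 6 <= (1 + d^-1) ^+ 7.
Proof.
move=> d0 dy; have y0 : 0 < y by exact: lt_le_trans dy.
have -> : (1 + y) / y ^+ 7 * (1 + y) ^+ 6 = (1 + y^-1) ^+ 7.
  by field; exact: lt0r_neq0.
have yV : y^-1 <= d^-1 by rewrite lef_pV2.
have yV0 : 0 < y^-1 by rewrite invr_gt0.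
by apply: lerXn2r; rewrite ?nnegrE; lra.
Qed.

(** Here [y1] belongs to the puncture that may be close and [T] stands for 1 + |z|^2. The right side
    carries (y1^7 (1 + y1)^2)^(-1), so an extra (1 + y1)^3 has to be absorbed; with [T] this makes
    the exponent 8 + 3 = 11, and the two far factors provide 6 + 6 = 12. *)
Lemma theta_prod y1 y2 y3 T Q d : 0 < y1 -> 0 < y2 -> 0 < y3 -> 0 < d -> 1 <= Q -> d <= y2 -> d <= y3 ->
  1 + y1 <= Q * (1 + y2) -> 1 + y2 <= Q * (1 + y3) -> 0 <= T -> T <= Q * (1 + y2) ^+ 8 ->
  T * ((1 + y1) / y1 ^+ 7 * ((1 + y2) / y2 ^+ 7) * ((1 + y3) / y3 ^+ 7)) <=
  Q ^+ 10 * ((1 + d^-1) ^+ 7 * (1 + d^-1) ^+ 7) * (y1 ^+ 7 * (1 + y1) ^+ 2)^-1.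
Proof.
move=> p1 p2 p3 d0 Q1 d2 d3 h12 h23 T0 TQ.
have Q0 : 0 < Q by lra.
have a1 : 0 < 1 + y1 by lra.
have a2 : 0 < 1 + y2 by lra.
have a3 : 0 < 1 + y3 by lra.
have k : T * (1 + y1) ^+ 3 <= Q ^+ 10 * ((1 + y2) ^+ 6 * (1 + y3) ^+ 6).
  have k1 : (1 + y1) ^+ 3 <= (Q * (1 + y2)) ^+ 3.
    by apply: lerXn2r h12; rewrite nnegrE ?mulr_ge0 ?ltW.
  have k2 : (1 + y2) ^+ 6 <= (Q * (1 + y3)) ^+ 6.
    by apply: lerXn2r h23; rewrite nnegrE ?mulr_ge0 ?ltW.
  have k0 : 0 <= (1 + y1) ^+ 3 by rewrite exprn_ge0 ?ltW.
  apply: (le_trans (ler_pM T0 k0 TQ k1)).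
  apply: (@le_trans _ _ (Q ^+ 4 * ((1 + y2) ^+ 6 * (1 + y2) ^+ 6))).
    have -> : Q * (1 + y2) ^+ 8 * (Q * (1 + y2)) ^+ 3 = Q ^+ 4 * (1 + y2) ^+ 11 by ring.
    have -> : Q ^+ 4 * ((1 + y2) ^+ 6 * (1 + y2) ^+ 6) = Q ^+ 4 * (1 + y2) ^+ 11 * (1 + y2) by ring.
    by rewrite ler_peMr ?mulr_ge0 ?exprn_ge0 ?(ltW Q0) ?(ltW a2)//; lra.
  have -> : Q ^+ 10 * ((1 + y2) ^+ 6 * (1 + y3) ^+ 6) = Q ^+ 4 * ((1 + y2) ^+ 6 * (Q * (1 + y3)) ^+ 6) by ring.
  by rewrite !ler_wpM2l ?exprn_ge0 ?(ltW Q0) ?(ltW a2).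
have u2 := theta_upper d0 d2; have u3 := theta_upper d0 d3.
set t1 := (y1 ^+ 7 * (1 + y1) ^+ 2)^-1.
have t10 : 0 < t1 by rewrite invr_gt0 mulr_gt0 ?exprn_gt0.
have e1 : (1 + y1) / y1 ^+ 7 = (1 + y1) ^+ 3 * t1.
  by rewrite /t1; field; rewrite !lt0r_neq0.
rewrite e1.
have -> : T * ((1 + y1) ^+ 3 * t1 * ((1 + y2) / y2 ^+ 7) * ((1 + y3) / y3 ^+ 7)) =
   (T * (1 + y1) ^+ 3) * ((1 + y2) / y2 ^+ 7 * ((1 + y3) / y3 ^+ 7)) * t1 by ring.
rewrite ler_pM2r//.
have g2 : 0 < (1 + y2) / y2 ^+ 7 by rewrite divr_gt0 ?exprn_gt0.
have g3 : 0 < (1 + y3) / y3 ^+ 7 by rewrite divr_gt0 ?exprn_gt0.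
apply: (le_trans (ler_wpM2r (ltW (mulr_gt0 g2 g3)) k)).
have -> : Q ^+ 10 * ((1 + y2) ^+ 6 * (1 + y3) ^+ 6) * ((1 + y2) / y2 ^+ 7 * ((1 + y3) / y3 ^+ 7)) =
  Q ^+ 10 * (((1 + y2) / y2 ^+ 7 * (1 + y2) ^+ 6) * ((1 + y3) / y3 ^+ 7 * (1 + y3) ^+ 6)) by ring.
rewrite ler_wpM2l ?exprn_ge0 ?(ltW Q0)//.
by apply: ler_pM => //; rewrite mulr_ge0 ?exprn_ge0 ?ltW.
Qed.

Lemma nsq_sub (a b : R[i]) : nsq (a + b) <= 2 * nsq a + 2 * nsq b.
Proof.
rewrite /nsq Re_add Im_add.
have := sqr_ge0 (cRe a - cRe b); have := sqr_ge0 (cIm a - cIm b); nra.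
Qed.

Lemma nsq_opp (a : R[i]) : nsq (- a) = nsq a.
Proof. by rewrite /nsq Re_opp Im_opp !sqrrN. Qed.

Lemma one_nsq_le (a b : R[i]) : 1 + nsq (a + b) <= 2 * (1 + nsq b) * (1 + nsq a).
Proof.
have := nsq_sub a b; have := nsq_ge0 a; have := nsq_ge0 b; move: (nsq _) (nsq b) (nsq a) => x y z; nra.
Qed.

End ineq.

Section cone.
Variable R : realType.
Implicit Types (r BB d T : R) (z a : R[i]).

(** The argument is a squared modulus r = |z - a|^2. Real powers are encoded by [expR] and [ln], so
    that the Laplacian rules apply: [root8 r] is |z - a|^(1/4) and [expR (theta r)] is the factor of
    the density at [a]. *)
Definition theta r := ln (1 + expR (8^-1 * ln r)) + (- (7 / 8)) * ln r.
Definition root8 r := expR (8^-1 * ln r).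

Lemma root8_exp r : 0 < r -> root8 r ^+ 8 = r.
Proof.
move=> r0; rewrite /root8 -expRM_natl mulrA divff ?mul1r ?lnK ?posrE//.
Qed.

Lemma root8_gt0 r : 0 < root8 r. Proof. exact: expR_gt0. Qed.

Lemma theta_exp r : expR (theta r) = (1 + root8 r) / root8 r ^+ 7.
Proof.
rewrite /theta expRD lnK ?posrE ?addr_gt0 ?expR_gt0//; congr (_ * _).
by rewrite /root8 -expRM_natl -expRN; congr expR; field.
Qed.

Lemma theta_lap r : 0 < r -> root8 r / r / (1 + root8 r) ^+ 2 = (root8 r ^+ 7 * (1 + root8 r) ^+ 2)^-1.
Proof.
move=> r0; rewrite -{2}(root8_exp r0); have h := root8_gt0 r; have h1 : 0 < 1 + root8 r by lra.
by move: (root8 r) h h1 => y h h1; field; rewrite !lt0r_neq0.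
Qed.

(** At most one puncture is close to [z]. As [d <= 1], an eighth root below [d] forces the squared
    distance below [d], and two such distances would give |a - a'|^2 < 4 d. *)
Lemma root8_sep z a a' d : 0 < d -> d <= 1 -> 4 * d <= nsq (a - a') -> 0 < nsq (z - a) -> 0 < nsq (z - a') ->
  root8 (nsq (z - a)) < d -> d <= root8 (nsq (z - a')).
Proof.
move=> d0 d1 dm p p' lt; rewrite leNgt; apply/negP => lt'.
have k r : 0 < r -> root8 r < d -> r < d.
  move=> q l; have y1 : root8 r <= 1 by exact: (le_trans (ltW l) d1).
  have yp := ltW (root8_gt0 r); rewrite -(root8_exp q); apply: le_lt_trans l.
  by rewrite exprS ler_piMr// exprn_ile1.
have := nsq_sub (a - z) (z - a'); rewrite addrA subrK -[a - z]opprB nsq_opp => h.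
have := k _ p lt; have := k _ p' lt'; lra.
Qed.

(** For every puncture the eighth power of 1 + |z - a|^(1/4) is comparable with 1 + |z|^2, so these
    quantities are comparable with one another. *)
Lemma root8_cmp z a a' BB : 2 * (1 + nsq a) <= BB -> 2 * (1 + nsq a') <= BB -> 0 < nsq (z - a) -> 0 < nsq (z - a') ->
  1 + root8 (nsq (z - a)) <= 2 ^+ 8 * (BB * BB) * (1 + root8 (nsq (z - a'))) /\
  1 + nsq z <= 2 ^+ 8 * (BB * BB) * (1 + root8 (nsq (z - a'))) ^+ 8.
Proof.
move=> ha ha' p p'.
have BB1 : 1 <= BB by have := nsq_ge0 a; lra.
have BB0 : 0 <= BB by lra.
have p8 : 1 <= 2 ^+ 8 :> R by apply: exprn_ege1; lra.
have BQ : BB * BB <= 2 ^+ 8 * (BB * BB) by exact: (ler_peMl (mulr_ge0 BB0 BB0) p8).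
have Q1 : 1 <= 2 ^+ 8 * (BB * BB) by apply: le_trans BQ; nra.
have h1 : 1 + nsq (z - a) <= 2 * (1 + nsq a) * (1 + nsq z) by have := one_nsq_le z (- a); rewrite nsq_opp.
have h2 : 1 + nsq z <= 2 * (1 + nsq a') * (1 + nsq (z - a')) by have := one_nsq_le (z - a') a'; rewrite subrK.
have e1 := exp8_one_le (root8_gt0 (nsq (z - a))); have e2 := one_exp8_le (root8_gt0 (nsq (z - a'))).
rewrite (root8_exp p) in e1; rewrite (root8_exp p') in e2.
have y0 := root8_gt0 (nsq (z - a)); have y0' := root8_gt0 (nsq (z - a')).
have z0 : 0 <= 1 + nsq z by have := nsq_ge0 z; lra.
have w0 : 0 <= 1 + nsq (z - a') by lra.
have c1 : 1 + nsq (z - a) <= BB * (1 + nsq z) by apply: (le_trans h1); exact: ler_wpM2r.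
have c2 : 1 + nsq z <= BB * (1 + nsq (z - a')) by apply: (le_trans h2); exact: ler_wpM2r.
have c3 : 1 + nsq z <= BB * (1 + root8 (nsq (z - a'))) ^+ 8 by apply: (le_trans c2); exact: ler_wpM2l.
have u0 : 0 <= 1 + root8 (nsq (z - a)) by lra.
have v0 : 0 <= 1 + root8 (nsq (z - a')) by lra.
have x0 : 0 <= (1 + root8 (nsq (z - a'))) ^+ 8 by exact: exprn_ge0.
have q0 : 0 <= 2 ^+ 8 * (BB * BB) by exact: le_trans Q1.
have c4 : (1 + root8 (nsq (z - a))) ^+ 8 <= 2 ^+ 8 * (BB * BB) * (1 + root8 (nsq (z - a'))) ^+ 8.
  apply: (le_trans e1); rewrite -[_ * (BB * BB) * _]mulrA; apply: ler_wpM2l; first exact: le_trans p8.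
  by apply: (le_trans c1); rewrite -mulrA; exact: ler_wpM2l.
split; last first.
  by apply: (le_trans c3); apply: (ler_wpM2r x0); apply: (le_trans _ BQ); exact: (ler_peMr BB0 BB1).
move: c4 Q1 q0; move: (2 ^+ 8 * (BB * BB)) => Q c4 Q1 q0.
rewrite -(@ler_pXn2r _ 8) ?nnegrE//; last exact: mulr_ge0.
apply: (le_trans c4); rewrite exprMn; apply: ler_wpM2r => //.
by rewrite exprS ler_peMr// exprn_ege1.
Qed.

Lemma theta_ge a z BB : 2 * (1 + nsq a) <= BB -> 0 < nsq (z - a) ->
  1 <= (1 + root8 (nsq (z - a))) / root8 (nsq (z - a)) ^+ 7 * (BB * (1 + nsq z)).
Proof.
move=> hB p.
have l := theta_lower (root8_gt0 (nsq (z - a))); rewrite (root8_exp p) in l.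
have h1 : 1 + nsq (z - a) <= 2 * (1 + nsq a) * (1 + nsq z) by have := one_nsq_le z (- a); rewrite nsq_opp.
have z0 : 0 <= 1 + nsq z by have := nsq_ge0 z; lra.
have c1 : 1 + nsq (z - a) <= BB * (1 + nsq z) by apply: (le_trans h1); exact: ler_wpM2r.
have p1 : 0 < 1 + nsq (z - a) by lra.
apply: (@le_trans _ _ ((1 + nsq (z - a))^-1 * (1 + nsq (z - a)))); first by rewrite mulVf ?lt0r_neq0.
by apply: ler_pM => //; rewrite ?invr_ge0 ltW.
Qed.

Variables a1 a2 a3 : R[i].
Hypotheses (n12 : a1 != a2) (n13 : a1 != a3) (n23 : a2 != a3).

Lemma cone_constants : exists C c0 : R, [/\ 0 < C, 0 < c0 & forall z : R[i],
  let r1 := nsq (z - a1) in let r2 := nsq (z - a2) in let r3 := nsq (z - a3) in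
  0 < r1 -> 0 < r2 -> 0 < r3 ->
  1 <= C * expR (theta r1 + theta r2 + theta r3) * (1 + nsq z) ^+ 3 /\
  c0 * expR (theta r1 + theta r2 + theta r3) * (1 + nsq z) <=
   (root8 r1 / r1 / (1 + root8 r1) ^+ 2 + root8 r2 / r2 / (1 + root8 r2) ^+ 2 + root8 r3 / r3 / (1 + root8 r3) ^+ 2) / 16].
Proof.
have [BB [B1 B2 B3]] : exists BB : R, [/\ 2 * (1 + nsq a1) <= BB, 2 * (1 + nsq a2) <= BB & 2 * (1 + nsq a3) <= BB].
  exists (2 * (1 + nsq a1 + nsq a2 + nsq a3)).
  by have := nsq_ge0 a1; have := nsq_ge0 a2; have := nsq_ge0 a3; split; lra.
have BB1 : 1 <= BB by have := nsq_ge0 a1; lra.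
have BB0 : 0 < BB by lra.
have c12 z := root8_cmp (z := z) B1 B2; have c13 z := root8_cmp (z := z) B1 B3.
have c21 z := root8_cmp (z := z) B2 B1; have c23 z := root8_cmp (z := z) B2 B3.
have c31 z := root8_cmp (z := z) B3 B1; have c32 z := root8_cmp (z := z) B3 B2.
have Q1 : 1 <= 2 ^+ 8 * (BB * BB).
  by apply: (mulr_ege1 (exprn_ege1 _ _) (mulr_ege1 BB1 BB1)); lra.
move: Q1 c12 c13 c21 c23 c31 c32; move: (2 ^+ 8 * (BB * BB)) => Q Q1 c12 c13 c21 c23 c31 c32.
have Q0 : 0 < Q by lra.
have [d [d0 d1 d12 d13 d23]] : exists d : R, [/\ 0 < d, d <= 1, 4 * d <= nsq (a1 - a2), 4 * d <= nsq (a1 - a3) & 4 * d <= nsq (a2 - a3)].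
  have m0 a a' : a != a' -> 0 < nsq (a - a') / 4 by move=> aa; rewrite divr_gt0// nsq_gt0 subr_eq0.
  exists (Num.min 1 (Num.min (nsq (a1 - a2) / 4) (Num.min (nsq (a1 - a3) / 4) (nsq (a2 - a3) / 4)))).
  by split; rewrite ?lt_min ?m0 ?ltr01// mulrC -?ler_pdivlMr// ?mul1r !ge_min ?lexx ?orbT.
pose M := Q ^+ 10 * ((1 + d^-1) ^+ 7 * (1 + d^-1) ^+ 7).
have M0 : 0 < M by rewrite !mulr_gt0 ?exprn_gt0// ltr_wpDr ?invr_ge0 ?ltW.
(* One factor [BB] for each of the three uses of [theta_ge]; the 16 is the denominator in the
   Laplacian of [theta]. *)
exists (BB ^+ 3), (M * 16)^-1; split; [exact: exprn_gt0|by rewrite invr_gt0 mulr_gt0|].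
move=> z r1 r2 r3 r10 r20 r30.
have -> : expR (theta r1 + theta r2 + theta r3) = (1 + root8 r1) / root8 r1 ^+ 7 * ((1 + root8 r2) / root8 r2 ^+ 7) * ((1 + root8 r3) / root8 r3 ^+ 7).
  by rewrite -!theta_exp -!expRD.
rewrite (theta_lap r10) (theta_lap r20) (theta_lap r30).
have T0 : 0 <= 1 + nsq z by have := nsq_ge0 z; lra.
have y10 := root8_gt0 r1; have y20 := root8_gt0 r2; have y30 := root8_gt0 r3.
split.
  have k1 := theta_ge B1 r10; have k2 := theta_ge B2 r20; have k3 := theta_ge B3 r30.
  have := mulr_ege1 (mulr_ege1 k1 k2) k3.
  rewrite -/r1 -/r2 -/r3; move: ((1 + root8 r1) / _) ((1 + root8 r2) / _) ((1 + root8 r3) / _) => A1 A2 A3.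
  by move=> h; apply: (le_trans h); apply: eq_ler; ring.
pose A := (1 + root8 r1) / root8 r1 ^+ 7 * ((1 + root8 r2) / root8 r2 ^+ 7) * ((1 + root8 r3) / root8 r3 ^+ 7); rewrite -/A.
pose t r := (root8 r ^+ 7 * (1 + root8 r) ^+ 2)^-1; rewrite -!/(t _).
have q r : 0 <= t r by rewrite invr_ge0 mulr_ge0 ?exprn_ge0 ?addr_ge0 ?(ltW (root8_gt0 _)).
suff h : (1 + nsq z) * A <= M * (t r1 + t r2 + t r3).
  have -> : (M * 16)^-1 * A * (1 + nsq z) = (1 + nsq z) * A / (M * 16) by rewrite mulrC [RHS]mulrC mulrCA; ring.
  have M16 : 0 < M * 16 by apply: mulr_gt0; [exact: M0|lra].
  rewrite (ler_pdivrMr _ _ M16) (_ : _ / 16 * (M * 16) = M * (t r1 + t r2 + t r3)); first exact: h.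
  by field.
have MM : 0 <= M by exact: ltW.
have [l1|g1] := ltP (root8 r1) d.
  have g2 := root8_sep d0 d1 d12 r10 r20 l1; have g3 := root8_sep d0 d1 d13 r10 r30 l1.
  have h := theta_prod y10 y20 y30 d0 Q1 g2 g3 (c12 _ r10 r20).1 (c23 _ r20 r30).1 T0 (c12 _ r10 r20).2.
  by apply: (le_trans h); rewrite -/(t r1) -/M ler_wpM2l// -addrA lerDl addr_ge0.
have [l2|g2] := ltP (root8 r2) d.
  have g3 := root8_sep d0 d1 d23 r20 r30 l2.
  have h := theta_prod y20 y10 y30 d0 Q1 g1 g3 (c21 _ r20 r10).1 (c13 _ r10 r30).1 T0 (c21 _ r20 r10).2.
  have E : (1 + root8 r2) / root8 r2 ^+ 7 * ((1 + root8 r1) / root8 r1 ^+ 7) * ((1 + root8 r3) / root8 r3 ^+ 7) = A by rewrite /A; ring.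
  rewrite E in h.
  by apply: (le_trans h); rewrite -/(t r2) -/M ler_wpM2l// addrAC lerDr addr_ge0.
(* With the first two punctures at distance at least [d] in the eighth root, the third may be close
   or not: [theta_prod] puts no lower bound on its first variable. In each case a single term of the
   Laplacian suffices. *)
have h := theta_prod y30 y10 y20 d0 Q1 g1 g2 (c31 _ r30 r10).1 (c12 _ r10 r20).1 T0 (c31 _ r30 r10).2.
have E : (1 + root8 r3) / root8 r3 ^+ 7 * ((1 + root8 r1) / root8 r1 ^+ 7) * ((1 + root8 r2) / root8 r2 ^+ 7) = A by rewrite /A; ring.
rewrite E in h.
by apply: (le_trans h); rewrite -/(t r3) -/M ler_wpM2l// lerDr addr_ge0.
Qed.

End cone.

Section omit.
Variables (R : realType) (S : orientedSurface R) (psi : improperAffineFront S).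
Variables (F G : S -> R[i]).
Hypotheses (sF : csmooth F) (sG : csmooth G).
Hypothesis metricE : forall p v, dtau2 psi p v = 2 * (nsq (cdiff F p v) + nsq (cdiff G p v)).
Hypothesis et : forall p, J (chart_at p) (reC G) (imC G) p != 0.
Hypothesis cpl : weakly_complete psi.
Hypothesis hF : hol G F.
Local Notation nu := (dG G F).
Local Notation nu1 := (dG G (dG G F)).
Variables a1 a2 a3 : R[i].
Hypotheses (n12 : a1 != a2) (n13 : a1 != a3) (n23 : a2 != a3).
Hypotheses (o1 : forall p, nu p != a1) (o2 : forall p, nu p != a2) (o3 : forall p, nu p != a3).

Lemma hol_sub a : hol G (fun p => nu p - a) /\ forall p, dG G (fun p => nu p - a) p = nu1 p.
Proof.
have [h1 d1] := hol_cst sG.1 sG.2 et (- a).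
have [h d] := hol_lin sG.1 sG.2 et 1 1 (hol_dG sG.1 sG.2 et hF) h1.
have -> : (fun p => nu p - a) = (fun p => 1 * nu p + 1 * - a) by apply/funext => p; rewrite !mul1r.
by split => // p; rewrite d d1 mul1r mulr0 addr0.
Qed.

Let r (a : R[i]) p := nsq (nu p - a).
Let theta3 p := theta (r a1 p) + theta (r a2 p) + theta (r a3 p).
Let f p := nsq (nu1 p) * expR (theta3 p).
Let u p := ln (nsq (nu1 p)) + theta3 p.

Lemma r_gt0 a p : nu p != a -> 0 < r a p.
Proof. by move=> h; rewrite nsq_gt0 subr_eq0. Qed.

Lemma theta_cont a p : nu p != a -> {for p, continuous (fun p => theta (r a p))}.
Proof.
move=> h; have r0 := r_gt0 h; have [[sa _ _] _] := hol_sub a.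
have cr : {for p, continuous (r a)} by exact: (nsq_smooth_cont sa).
have cl : {for p, continuous (fun p => ln (r a p))} by exact: (@continuous_comp _ _ _ (r a) (@ln R) p cr (continuous_ln r0)).
have cl8 : {for p, continuous (fun p => 8^-1 * ln (r a p))} by exact: (cvgM (cvg_cst (8^-1 : R)) cl).
have ce : {for p, continuous (fun p => 1 + expR (8^-1 * ln (r a p)))}.
  apply: (cvgD (cvg_cst (1 : R))).
  exact: (@continuous_comp _ _ _ (fun p => 8^-1 * ln (r a p)) (@expR R) p cl8 (@continuous_expR R _)).
have e0 : 0 < 1 + expR (8^-1 * ln (r a p)) by rewrite addr_gt0 ?expR_gt0.
have c1 : {for p, continuous (fun p => ln (1 + expR (8^-1 * ln (r a p))))}.
  exact: (@continuous_comp _ _ _ (fun p => 1 + expR (8^-1 * ln (r a p))) (@ln R) p ce (continuous_ln e0)).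
exact: (cvgD c1 (cvgM (cvg_cst (- (7 / 8) : R)) cl)).
Qed.

Lemma nu1_eq0 p : nu1 p = 0.
Proof.
have [C [c0 [C0 c00 cP]]] := cone_constants n12 n13 n23.
have hnu := hol_dG sG.1 sG.2 et hF; have hnu1 := hol_dG sG.1 sG.2 et hnu.
have E0 x : 0 < expR (theta3 x) by exact: expR_gt0.
have fC x : {for x, continuous f}.
  have [s1 _ _] := hnu1.
  have c1 : {for x, continuous (fun p => nsq (nu1 p))} by exact: nsq_smooth_cont.
  have c2 : {for x, continuous theta3} by exact: (cvgD (cvgD (theta_cont (o1 x)) (theta_cont (o2 x))) (theta_cont (o3 x))).
  exact: (cvgM c1 (@continuous_comp _ _ _ theta3 (@expR R) x c2 (@continuous_expR R _))).
have f0 x : 0 <= f x by rewrite mulr_ge0 ?nsq_ge0// ltW.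
have f1 x : 0 < f x -> 0 < nsq (nu1 x).
  by rewrite /f => h; rewrite -(pmulr_lgt0 _ (E0 x)).
have fu x : 0 < f x -> f x = expR (u x).
  by move=> /f1 h; rewrite /f /u expRD lnK.
have cP' x := cP (nu x) (r_gt0 (o1 x)) (r_gt0 (o2 x)) (r_gt0 (o3 x)).
have HK x : nsq (nu1 x) <= C * f x * (1 + nsq (nu x)) ^+ 3.
  have [h _] := cP' x; have := ler_wpM2l (nsq_ge0 (nu1 x)) h; rewrite mulr1 => k.
  by apply: (le_trans k); rewrite /f; apply: eq_ler; rewrite /theta3 /r; ring.
suff : f p = 0 by move/eqP; rewrite mulf_eq0 (gt_eqF (E0 p)) orbF nsq_eq0 => /eqP.
apply: (@density_eq0 R S psi F G sF sG metricE et cpl hF f u C c0 C0 c00 fC f0 fu HK).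
move=> g1 g2 x fx g1x g2x g1P g2P.
have nz : nu1 x != 0 by rewrite -nsq_gt0; exact: f1.
(* Where nu' does not vanish, ln |nu'|^2 is harmonic, so the Laplacian of [u] comes from the three
   [theta] terms. *)
have [b1 [b2 [l0 _]]] := lap_ln_nsq sG.1 sG.2 et g1x g2x g1P g2P hnu1 nz.
have lt a : nu x != a -> exists b1 b2, lap g1 g2 x (fun p => theta (r a p)) b1 b2 (nsq (nu1 x) / 16 * (root8 (r a x) / r a x / (1 + root8 (r a x)) ^+ 2)).
  move=> h; have [ha da] := hol_sub a; have nx : nu x - a != 0 by rewrite subr_eq0.
  have [d1 [d2 l]] := lap_theta sG.1 sG.2 et g1x g2x g1P g2P ha nx.
  by exists d1, d2; move: l; rewrite da.
have [d1 [e1 l1]] := lt _ (o1 x); have [d2 [e2 l2]] := lt _ (o2 x); have [d3 [e3 l3]] := lt _ (o3 x).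
have l := lap_add l0 (lap_add (lap_add l1 l2) l3).
do 3 eexists; split; first exact: l.
have [_ h] := cP' x; have k := ler_wpM2l (nsq_ge0 (nu1 x)) h.
apply: (@le_trans _ _ (nsq (nu1 x) * (c0 * expR (theta3 x) * (1 + nsq (nu x))))).
  by rewrite /f; apply: eq_ler; ring.
by apply: (le_trans k); rewrite /r; apply: eq_ler; ring.
Qed.

End omit.

(** * Reduction to three finite omitted values *)

Section front.
Variables (R : realType) (S : orientedSurface R) (psi : improperAffineFront S).
Local Notation F := (front_F psi).
Local Notation G := (front_G psi).
Local Notation x k := (fun p => front_x psi p 0 k).
Local Notation n k := (fun p => front_n psi p 0 k).
Local Notation L := (fun p => to_C2 (psi p).1 (front_n psi p)).

Lemma front_smooth k : smooth_map (x k) /\ smooth_map (n k).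
Proof.
have [sL _ _ _ _] := front_special_lagrangian psi; have [s1 s2] := sL k.
split.
  by move: s1; congr smooth_map; apply/funext => p; rewrite mxE.
by move: s2; congr smooth_map; apply/funext => p; rewrite mxE.
Qed.

Lemma ord2 (k : 'I_2) : k = 0 \/ k = 1.
Proof. by case: k => [[|[|k]]] hk //; [left|right]; apply/val_inj. Qed.

Lemma diff_row (g : 'rV[R]_2 -> 'rV[R]_2) y v k : (forall k, differentiable (fun y => g y 0 k) y) ->
  'd g y v 0 k = 'd (fun y => g y 0 k) y v.
Proof.
move=> dk.
have E : g = (fun y => g y 0 0 *: ev R 0) + (fun y => g y 0 1 *: ev R 1).
  by apply/funext => z; exact: rV2_ev.
have dg : differentiable g y.
  by rewrite E; exact: (differentiableD (differentiableZl (ev R 0) (dk 0)) (differentiableZl (ev R 1) (dk 1))).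
have Q := @diff_comp _ _ _ _ g (fun z : 'rV[R]_2 => z 0 k) y dg (differentiable_coord _ _ _).
have E1 := congr1 (fun h : 'rV[R]_2 -> R => h v) Q.
exact (etrans (esym (diff_coord (g y) ('d g y v) k)) (esym E1)).
Qed.

Lemma tdiff_row (f : S -> 'rV[R]_2) p v k : (forall k, smooth_map (fun q => f q 0 k)) ->
  tdiff f p v 0 k = tdiff (fun q => f q 0 k) p v.
Proof.
move=> sf; rewrite /tdiff; apply: diff_row => k'.
exact: (C1_diff (smooth_Ck 1 (sf k') (chart_at_atlas p)) (img_cmap (chart_at_dom p))).
Qed.

Lemma half (z : R[i]) : z / 2%:R = (2^-1 * cRe z) +i* (2^-1 * cIm z).
Proof.
have t : (2%:R : R[i]) != 0 by rewrite pnatr_eq0.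
apply: (mulIf t); rewrite mulfVK//; case: z => a b /=.
by rewrite mulr_natr mulr2n; simpc; congr Complex; field.
Qed.

Lemma front_F_coord : (reC F) = (fun p => 2^-1 * x 0 p + 2^-1 * n 0 p) /\
  (imC F) = (fun p => (- 2^-1) * x 1 p + (- 2^-1) * n 1 p).
Proof. by split; apply/funext => p; rewrite /front_F half /=; ring. Qed.

Lemma front_G_coord : (reC G) = (fun p => 2^-1 * x 0 p + (- 2^-1) * n 0 p) /\
  (imC G) = (fun p => 2^-1 * x 1 p + (- 2^-1) * n 1 p).
Proof. by split; apply/funext => p; rewrite /front_G half /=; ring. Qed.

Lemma csmooth_front_F : csmooth F.
Proof.
have [e1 e2] := front_F_coord; have [s0 t0] := front_smooth 0; have [s1 t1] := front_smooth 1.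
by split; [rewrite e1; exact: (smooth_lin _ _ s0 t0)|rewrite e2; exact: (smooth_lin _ _ s1 t1)].
Qed.

Lemma csmooth_front_G : csmooth G.
Proof.
have [e1 e2] := front_G_coord; have [s0 t0] := front_smooth 0; have [s1 t1] := front_smooth 1.
by split; [rewrite e1; exact: (smooth_lin _ _ s0 t0)|rewrite e2; exact: (smooth_lin _ _ s1 t1)].
Qed.

Lemma cdiff_front_F p v : cdiff F p v =
  (2^-1 * tdiff (x 0) p v + 2^-1 * tdiff (n 0) p v) +i* ((- 2^-1) * tdiff (x 1) p v + (- 2^-1) * tdiff (n 1) p v).
Proof.
have [e1 e2] := front_F_coord; have [s0 t0] := front_smooth 0; have [s1 t1] := front_smooth 1.
by rewrite /cdiff e1 e2; congr Complex; exact: tdiff_lin.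
Qed.

Lemma cdiff_front_G p v : cdiff G p v =
  (2^-1 * tdiff (x 0) p v + (- 2^-1) * tdiff (n 0) p v) +i* (2^-1 * tdiff (x 1) p v + (- 2^-1) * tdiff (n 1) p v).
Proof.
have [e1 e2] := front_G_coord; have [s0 t0] := front_smooth 0; have [s1 t1] := front_smooth 1.
by rewrite /cdiff e1 e2; congr Complex; exact: tdiff_lin.
Qed.

Lemma dtau2_front p v : dtau2 psi p v = 2 * (nsq (cdiff F p v) + nsq (cdiff G p v)).
Proof.
have sx k : smooth_map (x k) by have [] := front_smooth k.
have sn k : smooth_map (n k) by have [] := front_smooth k.
have d2 (w : 'rV[R]_2) : dotp w w = w 0 0 ^+ 2 + w 0 1 ^+ 2.
  by rewrite /dotp !big_ord_recl big_ord0 addr0 -!expr2; congr (_ + w 0 _ ^+ 2); apply/val_inj.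
have -> : dtau2 psi p v = dotp (tdiff (front_x psi) p v) (tdiff (front_x psi) p v) +
   dotp (tdiff (@front_n R S psi) p v) (tdiff (@front_n R S psi) p v) by [].
rewrite (cdiff_front_F p v).
rewrite (cdiff_front_G p v).
have X0 := tdiff_row p v 0 sx; have X1 := tdiff_row p v 1 sx.
have N0 := tdiff_row p v 0 sn; have N1 := tdiff_row p v 1 sn.
revert X0 X1 N0 N1.
generalize (tdiff (front_x psi) p v) (tdiff (@front_n R S psi) p v) => X N.
generalize (tdiff (x 0) p v) (tdiff (x 1) p v) (tdiff (n 0) p v) (tdiff (n 1) p v) => a b c d X0 X1 N0 N1.
by rewrite !d2 X0 X1 N0 N1 /nsq /=; field.
Qed.

Lemma cdiff2_front p v k : cdiff2 L p v 0 k = tdiff (x k) p v +i* tdiff (n k) p v.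
Proof.
have e1 : (fun q => cRe (L q 0 k)) = x k by apply/funext => q; rewrite mxE.
have e2 : (fun q => cIm (L q 0 k)) = n k by apply/funext => q; rewrite mxE.
by rewrite mxE /cdiff e1 e2.
Qed.

Lemma front_immersion p v : cdiff F p v = 0 -> cdiff G p v = 0 -> v = 0.
Proof.
have [_ iL _ _ _] := front_special_lagrangian psi.
rewrite cdiff_front_F cdiff_front_G => -[h1 h2] [h3 h4]; apply: (iL p).
have k0 k : tdiff (x k) p v = 0 /\ tdiff (n k) p v = 0.
  move: h1 h2 h3 h4; have [->|->] := ord2 k;
  move: (tdiff (x 0) p v) (tdiff (x 1) p v) (tdiff (n 0) p v) (tdiff (n 1) p v) => a b c d *; split; lra.
by apply/rowP => k; rewrite cdiff2_front [RHS]mxE; have [-> ->] := k0 k.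
Qed.

(** The Lagrangian and the calibration conditions together say that dF and dG, as complex-valued
    forms, have zero wedge product. This proportionality is what later yields holomorphy, without
    introducing a conformal structure. *)
Lemma front_FG_comm p v w : cdiff F p v * cdiff G p w = cdiff F p w * cdiff G p v.
Proof.
have [_ _ o1 o2 _] := front_special_lagrangian psi.
have := special_lagrangian_FG (o1 p v w) (o2 p v w).
rewrite !cdiff_front_F !cdiff_front_G /= !cdiff2_front /=.
move: (tdiff (x 0) p v) (tdiff (x 1) p v) (tdiff (n 0) p v) (tdiff (n 1) p v) => a b c d.
move: (tdiff (x 0) p w) (tdiff (x 1) p w) (tdiff (n 0) p w) (tdiff (n 1) p w) => a' b' c' d' [E1 E2].
by apply: complex_eq; rewrite /=; lra.
Qed.

Lemma cdiff_lin (a b : R[i]) (h k : S -> R[i]) p v : csmooth h -> csmooth k ->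
  cdiff (fun q => a * h q + b * k q) p v = a * cdiff h p v + b * cdiff k p v.
Proof.
move=> [h1 h2] [k1 k2].
have e1 : (fun q => cRe (a * h q + b * k q)) = (fun q => 1 * (cRe a * cRe (h q) + (- cIm a) * cIm (h q)) +
     1 * (cRe b * cRe (k q) + (- cIm b) * cIm (k q))).
  by apply/funext => q; rewrite Re_add !Re_mul; ring.
have e2 : (fun q => cIm (a * h q + b * k q)) = (fun q => 1 * (cRe a * cIm (h q) + cIm a * cRe (h q)) +
     1 * (cRe b * cIm (k q) + cIm b * cRe (k q))).
  by apply/funext => q; rewrite Im_add !Im_mul; ring.
rewrite /cdiff e1 e2.
rewrite (tdiff_lin p v 1 1 (smooth_lin (cRe a) (- cIm a) h1 h2) (smooth_lin (cRe b) (- cIm b) k1 k2)).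
rewrite (tdiff_lin p v 1 1 (smooth_lin (cRe a) (cIm a) h2 h1) (smooth_lin (cRe b) (cIm b) k2 k1)).
rewrite (tdiff_lin p v (cRe a) (- cIm a) h1 h2) (tdiff_lin p v (cRe b) (- cIm b) k1 k2).
rewrite (tdiff_lin p v (cRe a) (cIm a) h2 h1) (tdiff_lin p v (cRe b) (cIm b) k2 k1).
move: (tdiff _ p v) (tdiff _ p v) (tdiff _ p v) (tdiff _ p v) => x y z w.
by apply: complex_eq; rewrite ?Re_add ?Im_add ?Re_mul ?Im_mul /=; ring.
Qed.

End front.

Section ratio.
Variables (R : realType) (S : orientedSurface R) (F G : S -> R[i]).
Hypotheses (sF : csmooth F) (sG : csmooth G).

Lemma tdiff_pd (f : S -> R) p v : tdiff f p v =
  pd false (loc (chart_at p) f) (cmap (chart_at p) p) * v 0 0 + pd true (loc (chart_at p) f) (cmap (chart_at p) p) * v 0 1.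
Proof. exact: diffE2. Qed.

Lemma J_inj p : (forall v, cdiff G p v = 0 -> v = 0) ->
  J (chart_at p) (reC G) (imC G) p != 0.
Proof.
move=> inj; apply/negP => /eqP; rewrite /J /jac /jac2.
have inj' v : tdiff (reC G) p v = 0 -> tdiff (imC G) p v = 0 -> v = 0.
  by move=> h1 h2; apply: inj; rewrite /cdiff h1 h2.
move: inj' => inj'.
have {inj'} inj' (u w : R) : pd false (loc (chart_at p) (reC G)) (cmap (chart_at p) p) * u + pd true (loc (chart_at p) (reC G)) (cmap (chart_at p) p) * w = 0 ->
    pd false (loc (chart_at p) (imC G)) (cmap (chart_at p) p) * u + pd true (loc (chart_at p) (imC G)) (cmap (chart_at p) p) * w = 0 -> u = 0 /\ w = 0.
  move=> h1 h2; have := inj' (\row_k (if k == 0 then u else w)); rewrite !tdiff_pd !mxE /= => /(_ h1 h2) /rowP E.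
  by have := E 0; have := E 1; rewrite !mxE.
move: (pd false _ _) (pd true _ _) (pd false _ _) (pd true _ _) inj' => a b c d inj' E.
(* When the determinant vanishes, the columns of the adjugate matrix lie in the kernel; hence all
   four entries are 0, and then (1, 0) is in the kernel as well. *)
have [h1 h2] : d = 0 /\ - c = 0 by apply: inj'; lra.
have [h3 h4] : b = 0 /\ - a = 0 by apply: inj'; lra.
have [] : (1 : R) = 0 /\ (0 : R) = 0 by apply: inj'; nra.
by move/eqP; rewrite oner_eq0.
Qed.

Hypothesis et : forall p, J (chart_at p) (reC G) (imC G) p != 0.
Variable c : S -> R[i].
Hypothesis FcG : forall p v, cdiff F p v = c p * cdiff G p v.

(** Multiplication by [c p] is complex linear, so dF = c dG is the system of Cauchy-Riemann
    equations in the coordinate [G]. The regularity of [c] follows from its being [dG G F]. *)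
Lemma hol_ratio : hol G F /\ forall p, dG G F p = c p.
Proof.
have k p b : pd b (loc (chart_at p) (reC F)) (cmap (chart_at p) p) =
   cRe (c p) * pd b (loc (chart_at p) (reC G)) (cmap (chart_at p) p) -
   cIm (c p) * pd b (loc (chart_at p) (imC G)) (cmap (chart_at p) p) /\
   pd b (loc (chart_at p) (imC F)) (cmap (chart_at p) p) =
   cRe (c p) * pd b (loc (chart_at p) (imC G)) (cmap (chart_at p) p) +
   cIm (c p) * pd b (loc (chart_at p) (reC G)) (cmap (chart_at p) p).
  rewrite !pdE; have E := FcG p (ev R (if b then 1 else 0)).
  have := congr1 (@cRe R) E; have := congr1 (@cIm R) E; rewrite Re_mul Im_mul /= /tdiff.
  by [].
have D p : [/\ D1 (reC G) (imC G) (reC F) p = cRe (c p),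
   D1 (reC G) (imC G) (imC F) p = cIm (c p),
   D2 (reC G) (imC G) (reC F) p = - cIm (c p) &
   D2 (reC G) (imC G) (imC F) p = cRe (c p)].
  have := et p; have [k1 k2] := k p false; have [k3 k4] := k p true.
  rewrite /D1 /D2 /J /jac /jac2 k1 k2 k3 k4.
  move: (pd false (loc _ (reC G)) _) (pd true (loc _ (reC G)) _)
    (pd false (loc _ (imC G)) _) (pd true (loc _ (imC G)) _) => x y z w j0.
  by split; field.
split; first by split => // p; have [e1 e2 e3 e4] := D p; rewrite ?e1 ?e2 ?e3 ?e4.
by move=> p; rewrite /dG; have [-> -> _ _] := D p; case: (c p).
Qed.

End ratio.

(** * Holomorphic functions with zero derivative are constant *)

Section locally_constant.
Variables (R : realType) (S : orientedSurface R) (G : S -> R[i]).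
Hypothesis sG : csmooth G.
Hypothesis et : forall p, J (chart_at p) (reC G) (imC G) p != 0.

Lemma dG0_near h p : hol G h -> (forall q, dG G h q = 0) -> \forall q \near p, h q = h p.
Proof.
move=> hh h0; have [r [P [r0 Pp P1 P2 nP]]] := branch sG.1 sG.2 et (@filterT _ (nbhs p) _).
set z0 := (_, _) in Pp P1 P2.
have P1' z : ball z0 r z -> cRe (G (P z)) = z.1 /\ cIm (G (P z)) = z.2 by move=> /P1[].
have n1 : \forall q \near p, ball z0 r (cRe (G q), cIm (G q)).
  have c1 : {for p, continuous (reC G)} by apply: smooth_cont; exact: sG.1.
  have c2 : {for p, continuous (imC G)} by apply: smooth_cont; exact: sG.2.
  have cc := @pair_comp_cont R S _ (reC G) (imC G) (fun z => z) p c1 c2 cvg_id.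
  by apply: cc; apply: nbhsx_ballx.
apply: (filter_app _ _ nP); apply: filterS n1 => q qB Pq.
pose g (s : R) := P ((1 - s) * z0.1 + s * cRe (G q), (1 - s) * z0.2 + s * cIm (G q)).
have gB (s : R) : 0 <= s <= 1 -> ball z0 r ((1 - s) * z0.1 + s * cRe (G q), (1 - s) * z0.2 + s * cIm (G q)).
  by move=> s01; apply: (ball_conv2 (ballxx _ r0) qB s01).
have dg (s : R) : 0 <= s <= 1 -> cder (h \o g) s 0.
  move=> s01; have dl (x y : R) : der (fun s : R => (1 - s) * x + s * y) s (y - x).
    apply: (dr_eq (dr_add (dr_mul (dr_sub (dr_cst 1 s) (dr_id s)) (dr_cst x s)) (dr_mul (dr_id s) (dr_cst y s)))); ring.
  have [cg a b] := @branch_der _ _ P (reC G) (imC G)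
     (fun s => (1 - s) * z0.1 + s * cRe (G q)) (fun s => (1 - s) * z0.2 + s * cIm (G q)) s _ _
     (P2 _ (gB s s01)) (branch_near P1' (gB s s01)) (dl _ _) (dl _ _).
  have := @hol_cder _ _ G sG.1 sG.2 et h g s (_ +i* _) hh cg (conj a b).
  by rewrite h0 mulr0.
have g0 : g 0 = p by rewrite /g subr0 !mul1r !mul0r !addr0.
have g1 : g 1 = q by rewrite /g subrr !mul1r !mul0r !add0r.
have := @cder_bound R (fun s => h (g s) - h p) (fun=> 0) 0 1.
rewrite g0 subrr g1 => k; apply/eqP; rewrite -subr_eq0 -nsq_eq0 eq_le nsq_ge0 andbT; apply: k => //.
  by rewrite lexx ler01.
move=> s s01; split; last by rewrite /nsq /= expr0n addr0.
by apply: (cdr_eq (cdr_add (dg s s01) (cdr_cst (- h p) s))); rewrite addr0.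
Qed.

Lemma dG0_cst h p q : hol G h -> (forall q, dG G h q = 0) -> h p = h q.
Proof.
move=> hh h0; have lc x := dG0_near x hh h0.
suff E : [set x | h x = h q] = setT by have : [set x | h x = h q] p by rewrite E.
have op (A : set R[i]) : open [set x : S | A (h x)].
  by rewrite openE => x /= Ax; apply: filterS (lc x) => y /= ->.
apply: (@surface_connected _ S).
- by exists q.
- by exists [set x | h x = h q]; [exact: (op (fun z => z = h q))|rewrite setTI].
- exists [set x | h x = h q]; last by rewrite setTI.
  have -> : [set x | h x = h q] = ~` [set x | h x <> h q].
    by apply/seteqP; split => y /=; [move=> -> []|exact: contrapT].
  exact: (open_closedC (op (fun z => z <> h q))).
Qed.

End locally_constant.

Lemma four_distinct (T : Type) (A : set T) : ~ (A #<= `I_3)%card ->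
  exists x1 x2 x3 x4, [/\ A x1, A x2, A x3 & A x4] /\ [/\ x1 <> x2, x1 <> x3, x1 <> x4 & [/\ x2 <> x3, x2 <> x4 & x3 <> x4]].
Proof.
move=> nA.
have cov (g : nat -> T) : A `<=` g @` `I_3 -> False.
  by move=> h; apply: nA; apply: (card_le_trans (subset_card_le h)); exact: card_image_le.
have [x1 A1] : exists x, A x.
  by apply: contrapT => h; apply: nA; rewrite (_ : A = set0) ?card_le0//; apply/seteqP; split => // y Ay; apply: h; exists y.
have nx (x y z : T) : exists w, [/\ A w, x <> w, y <> w & z <> w].
  apply: contrapT => h; apply: (cov (fun k => if k == 0%N then x else if k == 1%N then y else z)) => w Aw.
  have [->|xw] := pselect (w = x); first by exists 0%N.
  have [->|yw] := pselect (w = y); first by exists 1%N.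
  have [->|zw] := pselect (w = z); first by exists 2%N.
  by case: h; exists w; split => // e; [apply: xw|apply: yw|apply: zw].
have [x2 [A2 h12 _ _]] := nx x1 x1 x1.
have [x3 [A3 h13 h23 _]] := nx x1 x2 x2.
have [x4 [A4 h14 h24 h34]] := nx x1 x2 x3.
by exists x1, x2, x3, x4.
Qed.

Section sphere_coordinates.
Variable R : realType.
Implicit Types s t : sphere R.

(** Homogeneous coordinates on the Riemann sphere, which let infinity be treated like any other
    omitted value. *)
Definition homog s : R[i] * R[i] := if s is Some c then (c, 1) else (1, 0).

Lemma homog_inj s t : s <> t -> (homog s).2 * (homog t).1 - (homog s).1 * (homog t).2 != 0.
Proof.
case: s t => [c|] [d|] //= h; rewrite ?mul1r ?mulr1 ?mulr0 ?mul0r ?subr0 ?sub0r ?oppr_eq0 ?oner_eq0//.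
by rewrite subr_eq0; apply/eqP => e; apply: h; rewrite e.
Qed.

Lemma homog_neq0 s : 0 < nsq (homog s).1 + nsq (homog s).2.
Proof.
have n1 : nsq (1 : R[i]) = 1 by rewrite /nsq /= expr1n expr0n addr0.
have n0 : nsq (0 : R[i]) = 0 by rewrite /nsq /= expr0n addr0.
by case: s => [c|] /=; rewrite n1 ?n0; [have := nsq_ge0 c|]; lra.
Qed.

End sphere_coordinates.

Section reduction.
Variables (R : realType) (S : orientedSurface R) (psi : improperAffineFront S).
Local Notation F := (front_F psi).
Local Notation G := (front_G psi).

Lemma gauss_map_inf p : (forall v, cdiff G p v = 0) -> gauss_map psi p = None.
Proof. by move=> h; rewrite /gauss_map; case: asboolP. Qed.

Lemma gauss_map_fin p v c : cdiff G p v != 0 -> cdiff F p v = c * cdiff G p v -> gauss_map psi p = Some c.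
Proof.
move=> nz E; case H : (gauss_map psi p) => [d|]; last first.
  by move: H; rewrite /gauss_map; case: asboolP => // h; rewrite h eqxx in nz.
by congr Some; apply: (mulIf nz); rewrite -E (gauss_mapP H).
Qed.

(** If the form s2 dF - s1 dG vanished at [p], the Gauss map would take the value [s] there; for
    finite [s] the immersion property rules out that dG vanishes too. *)
Lemma omitted_form s p : ~ range (gauss_map psi) s ->
  exists v, (homog s).2 * cdiff F p v - (homog s).1 * cdiff G p v != 0.
Proof.
move=> ns; apply: contrapT => no; apply: ns; exists p => //.
have E v : (homog s).2 * cdiff F p v = (homog s).1 * cdiff G p v.
  by apply/eqP; rewrite -subr_eq0; apply: contrapT => /negP h; apply: no; exists v.
case: s E {no} => [c|] /= E; last first.
  by apply: gauss_map_inf => v; have := E v; rewrite mul0r mul1r => ->.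
have [h|/existsNP[v nz]] := pselect (forall v, cdiff G p v = 0).
  have : basis0 R = 0.
    by apply: (@front_immersion R S psi p) => //; have := E (basis0 R); rewrite mul1r h mulr0.
  by move=> /rowP /(_ 0); rewrite !mxE /= => /eqP; rewrite oner_eq0.
by apply: (@gauss_map_fin p v); [apply/eqP|have := E v; rewrite mul1r].
Qed.

Variables a b : R[i].
Hypothesis ab : nsq a + nsq b = 1.

(** A unitary change of (F, G). With [(a, b)] proportional to the homogeneous coordinates of an
    omitted value, the differential of [uG] is the form of [omitted_form], which never vanishes;
    that value is moved to infinity. *)
Definition uG p : R[i] := b * F p + (- a) * G p.
Definition uF p : R[i] := conjc a * F p + conjc b * G p.

Lemma csmooth_uG : csmooth uG.
Proof. exact: (csmooth_lin _ _ (csmooth_front_F psi) (csmooth_front_G psi)). Qed.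

Lemma csmooth_uF : csmooth uF.
Proof. exact: (csmooth_lin _ _ (csmooth_front_F psi) (csmooth_front_G psi)). Qed.

Lemma cdiff_uG p v : cdiff uG p v = b * cdiff F p v + (- a) * cdiff G p v.
Proof. exact: (cdiff_lin _ _ _ _ (csmooth_front_F psi) (csmooth_front_G psi)). Qed.

Lemma cdiff_uF p v : cdiff uF p v = conjc a * cdiff F p v + conjc b * cdiff G p v.
Proof. exact: (cdiff_lin _ _ _ _ (csmooth_front_F psi) (csmooth_front_G psi)). Qed.

Lemma dtau2_u p v : dtau2 psi p v = 2 * (nsq (cdiff uF p v) + nsq (cdiff uG p v)).
Proof.
rewrite dtau2_front cdiff_uG cdiff_uF; congr (2 * _).
rewrite -[LHS]mul1r -ab; generalize (cdiff F p v) (cdiff G p v) => [[x y] [z w]].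
by case: a b => [a1 a2] [b1 b2]; rewrite /nsq /=; ring.
Qed.

Lemma conj_ab : conjc a * a + conjc b * b = 1.
Proof.
by move: ab; case: a b => [a1 a2] [b1 b2]; rewrite /nsq /= => h; apply: complex_eq => /=; [rewrite -h|]; ring.
Qed.

Lemma cdiff_F_u p v : cdiff F p v = conjc b * cdiff uG p v + a * cdiff uF p v.
Proof.
rewrite cdiff_uG cdiff_uF -[LHS]mul1r -conj_ab.
by generalize (cdiff F p v) (cdiff G p v) (conjc a) (conjc b) => x y a' b'; ring.
Qed.

Lemma cdiff_G_u p v : cdiff G p v = - conjc a * cdiff uG p v + b * cdiff uF p v.
Proof.
rewrite cdiff_uG cdiff_uF -[LHS]mul1r -conj_ab.
by generalize (cdiff F p v) (cdiff G p v) (conjc a) (conjc b) => x y a' b'; ring.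
Qed.

Lemma uFG_comm p v w : cdiff uF p v * cdiff uG p w = cdiff uF p w * cdiff uG p v.
Proof.
have := front_FG_comm psi p v w; rewrite !cdiff_uF !cdiff_uG.
generalize (cdiff F p v) (cdiff G p v) (cdiff F p w) (cdiff G p w) (conjc a) (conjc b) => x y z t a' b' E.
apply/eqP; rewrite -subr_eq0.
have -> : (a' * x + b' * y) * (b * z + - a * t) - (a' * z + b' * t) * (b * x + - a * y) = (a' * a + b' * b) * (z * y - x * t) by ring.
by rewrite E subrr mulr0.
Qed.

Hypothesis ns : forall p, exists v, cdiff uG p v != 0.

(** By proportionality with a vector where d(uG) is nonzero, d(uF) vanishes wherever d(uG) does, so
    [v] is killed by both dF and dG. *)
Lemma uG_inj p v : cdiff uG p v = 0 -> v = 0.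
Proof.
move=> v0; have [w nz] := ns p; have E := uFG_comm p v w; rewrite v0 mulr0 in E.
have F0 : cdiff uF p v = 0 by apply/eqP; move/eqP: E; rewrite mulf_eq0 (negbTE nz) orbF.
by apply: (@front_immersion R S psi p); rewrite ?cdiff_F_u ?cdiff_G_u v0 F0 !mulr0 addr0.
Qed.

Lemma u_ratio : exists c : S -> R[i], forall p v, cdiff uF p v = c p * cdiff uG p v.
Proof.
have ex p : exists c, forall v, cdiff uF p v = c * cdiff uG p v.
  have [w nz] := ns p; exists (cdiff uF p w / cdiff uG p w) => v.
  by rewrite mulrAC; apply: (mulIf nz); rewrite mulfVK// uFG_comm.
by have [c cP] := choice ex; exists c.
Qed.

End reduction.

Local Open Scope card_scope.

Theorem theorem3p2 (R : realType) (S : orientedSurface R)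
    (psi : improperAffineFront S)
    (complete_psi : weakly_complete psi)
    (nonconstant_nu : ~ (exists c : sphere R, forall p : S, gauss_map psi p = c)) :
  ~` range (gauss_map psi) #<= `I_3.
Proof.
apply: contrapT => /four_distinct[s1 [s2 [s3 [s4 [[h1 h2 h3 h4] [n12 n13 n14 [n23 n24 n34]]]]]]].
have [k [a [b [k0 aE bE ab]]]] : exists k a b : R[i],
    [/\ k != 0, a = k * (homog s4).1, b = k * (homog s4).2 & nsq a + nsq b = 1].
  have N0 := homog_neq0 s4.
  pose k : R[i] := ((Num.sqrt (nsq (homog s4).1 + nsq (homog s4).2))^-1)%:C.
  have k2 : nsq k = (nsq (homog s4).1 + nsq (homog s4).2)^-1.
    by rewrite /nsq /k /= [0 ^+ 2]expr0n /= addr0 exprVn sqr_sqrtr// ltW.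
  exists k, (k * (homog s4).1), (k * (homog s4).2); split => //; first by rewrite -nsq_gt0 k2 invr_gt0.
  by rewrite !nsqM k2 -mulrDr mulVf// lt0r_neq0.
have ns p : exists v, cdiff (uG psi a b) p v != 0.
  have [v H] := omitted_form p h4; exists v; rewrite cdiff_uG aE bE.
  move: H; generalize (cdiff (front_F psi) p v) (cdiff (front_G psi) p v) => x y nz.
  by rewrite mulNr -!mulrA -mulrBr mulf_neq0.
have sG := csmooth_uG psi a b; have sF := csmooth_uF psi a b.
have et p := J_inj (uG_inj ab ns (p := p)).
have [c cP] := u_ratio ns.
have [hF dF] := hol_ratio sF et cP.
have FE p v : cdiff (front_F psi) p v = (conjc b + a * c p) * cdiff (uG psi a b) p v.
  by rewrite (cdiff_F_u psi ab) cP; ring.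
have GE p v : cdiff (front_G psi) p v = (- conjc a + b * c p) * cdiff (uG psi a b) p v.
  by rewrite (cdiff_G_u psi ab) cP; ring.
(* In terms of [uF] and [uG] the form s2 dF - s1 dG becomes m d(uF) + n d(uG). The omitted value [s]
   of the Gauss map thus becomes the value - n / m, finite because [m] vanishes only for [s4]. *)
pose m (s : sphere R) := (homog s).2 * a - (homog s).1 * b.
pose n (s : sphere R) := (homog s).2 * conjc b + (homog s).1 * conjc a.
have m0 s : s <> s4 -> m s != 0.
  move=> /homog_inj h.
  have -> : m s = k * ((homog s).2 * (homog s4).1 - (homog s).1 * (homog s4).2) by rewrite /m aE bE mulrBr !(mulrCA k).
  exact: mulf_neq0.
pose al s := - n s / m s.
have o s : (~` range (gauss_map psi)) s -> s <> s4 -> forall p, dG (uG psi a b) (uF psi a b) p != al s.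
  move=> os /m0 ms p; rewrite dF; apply/eqP => E; have [v] := omitted_form p os.
  rewrite FE GE.
  have -> : (homog s).2 * ((conjc b + a * c p) * cdiff (uG psi a b) p v) -
     (homog s).1 * ((- conjc a + b * c p) * cdiff (uG psi a b) p v) = (n s + c p * m s) * cdiff (uG psi a b) p v.
    by rewrite /n /m; ring.
  by rewrite E /al divfK// subrr mul0r eqxx.
have d s t : s <> t -> s <> s4 -> t <> s4 -> al s != al t.
  move=> /homog_inj st /m0 ms /m0 mt; apply/eqP => /eqP; rewrite /al eqr_div// !mulNr eqr_opp -subr_eq0.
  (* The change of coordinates is unitary, so up to sign it preserves the determinant of two pairs
     of homogeneous coordinates, and distinct values stay distinct. *)
  have -> : n s * m t - n t * m s = - ((conjc a * a + conjc b * b) * ((homog s).2 * (homog t).1 - (homog s).1 * (homog t).2)).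
    by rewrite /n /m; ring.
  by rewrite (conj_ab ab) mul1r oppr_eq0 (negbTE st).
have z := @nu1_eq0 R S psi _ _ sF sG (dtau2_u psi ab) et complete_psi hF (al s1) (al s2) (al s3)
  (d _ _ n12 n14 n24) (d _ _ n13 n14 n34) (d _ _ n23 n24 n34) (o _ h1 n14) (o _ h2 n24) (o _ h3 n34).
have cc p q : c p = c q.
  by rewrite -!dF; apply: (dG0_cst sG et p q (hol_dG sG.1 sG.2 et hF) z).
apply: nonconstant_nu.
(* Connectedness allows the empty surface, on which any value will do. *)
have [[p0 _]|no] := pselect (exists p0 : S, True); last by exists None => p; case: no; exists p.
(* The constant value of the original Gauss map is the inverse rotation of [c p0], and it is
   infinity when the denominator vanishes. *)
have [w0|w0] := eqVneq (- conjc a + b * c p0) 0.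
  by exists None => p; apply: gauss_map_inf => v; rewrite GE (cc p p0) w0 mul0r.
exists (Some ((conjc b + a * c p0) / (- conjc a + b * c p0))) => p.
have [v nz] := ns p; apply: (@gauss_map_fin R S psi p v).
  by rewrite GE (cc p p0) mulf_neq0.
by rewrite GE FE (cc p p0) mulrA divfK.
Qed.
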